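(* Let $p$ be a probability density on $\mathbb{R}^d$ such that $\ln p$ is $C^1$, $\nabla \ln p$ is $L$-Lipschitz with $L\ge 1$, and $p$ satisfies a log-Sobolev inequality with constant $C_{\mathrm{LS}}\ge 1$. Let $s:\mathbb{R}^d\to\mathbb{R}^d$ be a score estimate with $\mathbb{E}_{p}\big[\|\nabla \ln p(x)-s(x)\|^2\big]\le \varepsilon^2.$ Let $0<\varepsilon_{\mathrm{TV}}<1$ and $0<\varepsilon_\chi<1$, and suppose the starting distribution $p_0$ of the algorithm satisfies $\chi^2(p_0\|p)\le K_\chi^2$. Then there are absolute constants such that if $$\varepsilon = O\!\left(\frac{\varepsilon_{\mathrm{TV}}\,\varepsilon_\chi^3}{d L^2 C_{\mathrm{LS}}^{5/2}\big(\ln(2K_\chi/\varepsilon_\chi^2)\vee K_\chi\big)}\right),$$ then running Langevin Monte Carlo with score estimate $s$ (started from $p_0$), step size $h=\Theta\big(\frac{\varepsilon_\chi^2}{dL^2C_{\mathrm{LS}}}\big)$ and time $T=\Theta\big(C_{\mathrm{LS}}\ln\frac{2K_\chi}{\varepsilon_\chi^2}\big)$ results in a distribution $p_T$ such that there is a distribution $\bar p_T$ with $\mathrm{TV}(p_T,\bar p_T)\le \varepsilon_{\mathrm{TV}}$ and $\chi^2(\bar p_T\|p)\le\varepsilon_\chi^2$. In particular, taking $\varepsilon_\chi=\varepsilon_{\mathrm{TV}}$, $\mathrm{TV}(p_T,p)\le 2\varepsilon_{\mathrm{TV}}$.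
   Context: Langevin Monte Carlo (LMC) with score estimate $s$ and step size $h$ is the iteration $x_{(k+1)h}=x_{kh}+h\,s(x_{kh})+\sqrt{2h}\,\xi_{kh}$, where $\xi_{kh}\sim N(0,I_d)$ are i.i.d. and independent of $x_0\sim p_0$; $p_T$ denotes the law of $x_T$. A density $p$ satisfies a log-Sobolev inequality with constant $C_{\mathrm{LS}}$ if $\mathrm{KL}(q\|p)\le \frac{C_{\mathrm{LS}}}{2}\mathbb{E}_q\|\nabla\ln(q/p)\|^2$ for all probability densities $q$. $\chi^2(q\|p)=\int q^2/p-1$. $a\vee b=\max\{a,b\}$. $O(\cdot)$, $\Theta(\cdot)$ hide absolute constants. *)

(* Defs.v *)
From HB Require Import structures.
From mathcomp Require Import all_boot all_order all_algebra.
From mathcomp Require Import all_classical all_reals all_analysis.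

Set Implicit Arguments.
Unset Strict Implicit.
Unset Printing Implicit Defensive.
Import Order.TTheory GRing.Theory Num.Theory.
Import numFieldNormedType.Exports.

Local Open Scope classical_set_scope.
Local Open Scope ring_scope.

Section LMC.
Variable R : realType.

(* Euclidean norm on R^d (the library's norm on matrices is the sup norm). *)
Definition enorm (d : nat) (v : 'rV[R]_d) : R :=
  Num.sqrt (\sum_(i < d) v ord0 i ^+ 2).

Definition borel_fun (d : nat) (f : 'rV[R]_d -> R) : Prop :=
  forall A : set R, measurable A -> <<s [set U | open U] >> (f @^-1` A).

Definition borel_vfun (d : nat) (f : 'rV[R]_d -> 'rV[R]_d) : Prop :=
  forall i : 'I_d, borel_fun (fun x => f x ord0 i).

(* Lebesgue integral over R^d, computed as the iterated integral with respect to
   the one-dimensional Lebesgue measure (by Tonelli, equal to the integral against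
   the d-dimensional Lebesgue measure for nonnegative Borel integrands; it is only
   used below on nonnegative Borel integrands). *)
Fixpoint lebint (d : nat) : ('rV[R]_d -> \bar R) -> \bar R :=
  match d with
  | 0 => fun f => f 0
  | d'.+1 => fun f =>
      (\int[@lebesgue_measure R]_(x in [set: R])
         lebint (fun v : 'rV[R]_d' => f (row_mx (\row_(j < 1) x) v)))%E
  end.

Definition is_density (d : nat) (q : 'rV[R]_d -> R) : Prop :=
  borel_fun q /\ (forall x, 0 <= q x) /\ lebint (fun x => (q x)%:E) = 1%E.

Definition grad (d : nat) (g : 'rV[R]_d -> R) (x : 'rV[R]_d) : 'rV[R]_d :=
  \row_(i < d) ('D_(delta_mx ord0 i) g x).

Definition C1 (d : nat) (g : 'rV[R]_d -> R) : Prop :=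
  (forall x, differentiable g x) /\ continuous (grad g).

Definition lipschitz_e (d : nat) (L : R) (F : 'rV[R]_d -> 'rV[R]_d) : Prop :=
  forall x y, enorm (F x - F y) <= L * enorm (x - y).

(* KL(q || p) = \int p phi(q/p), phi(t) = t ln t - t + 1 (nonnegative integrand;
   equals \int q ln(q/p) for probability densities q, p with p > 0). *)
Definition KL (d : nat) (q p : 'rV[R]_d -> R) : \bar R :=
  lebint (fun x => (p x * ((q x / p x) * ln (q x / p x) - q x / p x + 1))%:E).

Definition chi2 (d : nat) (q p : 'rV[R]_d -> R) : \bar R :=
  (lebint (fun x => (q x ^+ 2 / p x)%:E) - 1)%E.

Definition TV (d : nat) (q1 q2 : 'rV[R]_d -> R) : \bar R :=
  ((2%:R)^-1%:E * lebint (fun x => `|q1 x - q2 x|%:E))%E.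

Definition LSI (d : nat) (p : 'rV[R]_d -> R) (C : R) : Prop :=
  forall q : 'rV[R]_d -> R,
    is_density q -> (forall x, 0 < q x) -> C1 (fun x => ln (q x)) ->
    (KL q p <= (C / 2)%:E *
       lebint (fun x => (q x * enorm (grad (fun y => ln (q y / p y)) x) ^+ 2)%:E))%E.

Definition gauss (d : nat) (s2 : R) (z : 'rV[R]_d) : R :=
  (Num.sqrt (2 * pi * s2)) ^- d * expR (- (enorm z ^+ 2) / (2 * s2)).

(* density of the k-th LMC iterate x_{kh}, x_{(k+1)h} = x_{kh} + h s(x_{kh}) + sqrt(2h) xi,
   xi ~ N(0, I_d) independent of x_{kh}, started from density p0:
   p_{k+1}(y) = \int p_k(x) gauss_{2h}(y - x - h s(x)) dx. *)
Fixpoint lmc_density (d : nat) (s : 'rV[R]_d -> 'rV[R]_d) (h : R)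
    (p0 : 'rV[R]_d -> R) (k : nat) : 'rV[R]_d -> R :=
  match k with
  | 0 => p0
  | k'.+1 => fun y =>
      fine (lebint (fun x => (lmc_density s h p0 k' x *
                               gauss (2 * h) (y - x - h *: s x))%:E))
  end.

End LMC.

(* Main.v *)
(* Write F for the gradient of ln p, I(q) for the integral of q^2/p, u = hL, and
   let q' be the density of x + h b(x) + N(0, 2h) when x has density q and the
   drift b is uniformly close to F.

   The log-Sobolev inequality, applied to p (1 + e (f - E f)), gives a Poincare
   inequality, which tested on Gaussian smoothings shows that replacing (q, p)
   by (q * N(0,h), p * N(0,h)) contracts I(q) towards the squared mass at rate
   h/C.  The step from q to q' passes through the midpoint y = x + N(0,h);
   given y, the second half-step is compared with the law proportional to
   p(z) exp(-|z-y|^2/2h), for which the smoothed step is exactly p-stationary.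
   The extra cost is the chi-square distance between these two laws, which
   Pisier's rotation argument bounds by a multiple of
   h |b-F|^2 + d u^2 + u^2 h |F(x)|^2.  The last term is unbounded; it is absorbed by a
   direct Cauchy-Schwarz estimate that gains the factor exp(-h |F(x)|^2/4):
   the two estimates are averaged with weight 288 u where u h |F|^2 <= 1, and the
   second one alone suffices elsewhere.

   For the given score s, let b equal s where |s - F| is at most a multiple of
   eps_chi / sqrt C and F elsewhere.  Iterating the one-step bound controls the
   chi-square divergence of the chain driven by b, and the two chains separate
   only on the exceptional set, whose mass at each step is bounded by
   Cauchy-Schwarz from its (small) p-mass and the current chi-square. *)
From HB Require Import structures.
From mathcomp Require Import all_boot all_order all_algebra.
From mathcomp Require Import all_classical all_reals all_analysis.
From mathcomp Require Import measurable_realfun ring lra.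
Require Import Defs.
Set Implicit Arguments.
Unset Strict Implicit.
Unset Printing Implicit Defensive.
Import Order.TTheory GRing.Theory Num.Theory.
Import numFieldNormedType.Exports.
Local Open Scope classical_set_scope.
Local Open Scope ring_scope.

(** * Lebesgue measure on row vectors *)


(** The target accuracy decides which errors are affordable. With [h] of order eps_chi^2 / (d L^2
    C), one step contracts [I] at a rate of order h/C, while d u^2 is of order eps_chi^2 h/C: a
    relative error d u^2 per step is just affordable, one of order u is not. The direct
    Cauchy-Schwarz bound loses d u, so it cannot stand alone; given a weight of order u, its loss
    drops to d u^2, and the weight itself only multiplies the contraction rate by a factor close to
    1. Its gain in |F|^2 is indispensable because an iterate is known only through [I], which
    controls no moment of |F|^2 under q^2/p.

    The reference law of the second half-step has normalising constant (p * N(0,h))(y), so its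
    chi-square distance is a product of two Gaussian exponential integrals of opposite sign.
    Pisier's argument bounds that product from a quadratic Taylor bound on ln p, without second
    derivatives.

    No time derivative and no small-parameter limit occurs: the log-Sobolev inequality is used at
    one fixed e, the rotation is cut into finitely many angles, and the contraction factor is
    rational in h. Each shortcut costs an absolute constant. *)

HB.instance Definition _ (R : realType) (d : nat) :=
  Measurable.copy 'rV[R]_d (g_sigma_algebraType (@open 'rV[R]_d)).

Section BorelVectors.
Context {R : realType}.

Lemma open_measurable_rV (d : nat) (U : set 'rV[R]_d) : open U -> measurable U.
Proof. by move=> oU; exact: sub_gen_smallest. Qed.

Lemma measurable_continuous_rV (d : nat) (f : 'rV[R]_d -> R) :
  continuous f -> measurable_fun setT f.
Proof.
move=> /continuousP cf; apply: (measurability _ (RGenOpens.measurableE R)).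
move=> _ [_ [a [b ->] <-]]; rewrite setTI; apply: open_measurable_rV.
exact/cf/interval_open.
Qed.

Lemma measurable_coord (d : nat) (i : 'I_d) :
  measurable_fun setT (fun x : 'rV[R]_d => x ord0 i).
Proof. by apply: measurable_continuous_rV; exact: coord_continuous. Qed.

(** An open set is the union of the countably many boxes with rational centre and radius 1/(n+1)
    that it contains, because the norm on row vectors is the sup norm. Hence the Borel sigma-algebra
    can be tested coordinatewise. *)
Lemma measurable_rV (dS : measure_display) (S : measurableType dS) (d : nat)
    (f : S -> 'rV[R]_d) :
  (forall i, measurable_fun setT (fun s => f s ord0 i)) -> measurable_fun setT f.
Proof.
move=> mf; apply: (@measurability _ _ _ _ _ _ (@open 'rV[R]_d)) => //.
move=> _ [U oU <-]; rewrite setTI.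
pose box (cn : 'rV[rat]_d * nat) : set 'rV[R]_d :=
  [set v | forall i, `|v ord0 i - ratr (cn.1 ord0 i)| < cn.2.+1%:R^-1].
have -> : f @^-1` U = \bigcup_(cn in [set cn | box cn `<=` U]) (f @^-1` box cn).
  apply/seteqP; split=> [s /= Us|s [cn /= bU bs]]; last exact: bU.
  have /nbhs_ballP[e e0 eU] : nbhs (f s) U by exact: open_nbhs_nbhs.
  have e20 : 0 < e / 2 by rewrite divr_gt0.
  have [n n_e] : exists n : nat, n.+1%:R^-1 < e / 2.
    have [n _ /(_ _ (leqnn n)) ne] := near_infty_natSinv_lt (PosNum e20).
    by exists n.
  have n0 : 0 < n.+1%:R^-1 :> R by rewrite invr_gt0 ltr0n.
  have cP i : exists c : rat, `|f s ord0 i - ratr c| < n.+1%:R^-1.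
    have lt_ : f s ord0 i - n.+1%:R^-1 < f s ord0 i + n.+1%:R^-1 by rewrite ltrD2l gtrN.
    have [c] := rat_in_itvoo lt_.
    by rewrite in_itv/= => /andP[c1 c2]; exists c; move: (n.+1%:R^-1) c1 c2 => r c1 c2; rewrite ltr_norml; lra.
  pose c : 'rV[rat]_d := \row_i projT1 (cid (cP i)).
  have cE i : `|f s ord0 i - ratr (c ord0 i)| < n.+1%:R^-1.
    by rewrite mxE; case: (cid (cP i)).
  exists (c, n); last by move=> i; exact: cE.
  move=> v /= vc; apply: eU; split=> // i j; rewrite ord1 /ball/=.
  move: (n.+1%:R^-1) (vc j) (cE j) n_e => r; rewrite !ltr_norml; lra.
rewrite bigcup_mkcond; apply: countable_bigcupT_measurable => // cn.
case: ifPn => // _.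
have -> : f @^-1` box cn =
    \bigcap_(i in [set: 'I_d])
      (fun s => f s ord0 i - ratr (cn.1 ord0 i)) @^-1` [set y | `|y| < cn.2.+1%:R^-1].
  by apply/seteqP; split=> s /= H i; [move=> _; exact: H | exact: H].
apply: fin_bigcap_measurable => // i _; rewrite -[X in measurable X]setTI.
have mg : measurable_fun setT (fun s => f s ord0 i - ratr (cn.1 ord0 i)).
  by apply: measurable_funB => //; exact: mf.
apply: mg => //; apply: open_measurable.
have -> : [set y : R | `|y| < cn.2.+1%:R^-1] = ball 0 (cn.2.+1%:R^-1).
  by apply/seteqP; split=> y; rewrite /ball/= sub0r normrN.
exact: ball_open.
Qed.

End BorelVectors.
Section LebesgueVectors.
Context {R : realType}.
Local Open Scope ereal_scope.

(** Same shape as the [row_mx] in the recursion of [lebint], so that one level of the recursion is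
    an integral against a pushforward along [consv]. *)
Definition consv (d : nat) (z : measurableTypeR R * 'rV[R]_d) : 'rV[R]_d.+1 :=
  row_mx (\row_(j < 1) z.1) z.2.

Lemma consv0 (d : nat) (z : measurableTypeR R * 'rV[R]_d) : consv z ord0 ord0 = z.1.
Proof.
rewrite /consv mxE; case: splitP => j; first by rewrite mxE.
by move=> /=.
Qed.

Lemma consvS (d : nat) (z : measurableTypeR R * 'rV[R]_d) (i : 'I_d) :
  consv z ord0 (lift ord0 i) = z.2 ord0 i.
Proof.
rewrite /consv mxE; case: splitP => j /=.
  by rewrite [j]ord1.
by rewrite /bump add1n => -[] /ord_inj ->.
Qed.

Lemma measurable_consv (d : nat) : measurable_fun setT (@consv d).
Proof.
apply: measurable_rV => i; case: (unliftP ord0 i) => [j ->|->].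
  under eq_fun do rewrite consvS.
  by apply: (measurableT_comp (measurable_coord j)).
by under eq_fun do rewrite consv0; exact: measurable_fst.
Qed.

Definition unconsv (d : nat) (v : 'rV[R]_d.+1) : measurableTypeR R * 'rV[R]_d :=
  (v ord0 ord0, \row_i v ord0 (lift ord0 i)).

Lemma consvK (d : nat) : cancel (@consv d) (@unconsv d).
Proof.
move=> [x v]; congr pair; first by rewrite consv0.
by apply/rowP => i; rewrite mxE consvS.
Qed.

Lemma measurable_unconsv (d : nat) : measurable_fun setT (@unconsv d).
Proof.
apply/measurable_fun_pairP; split; first exact: measurable_coord.
apply: measurable_rV => i.
by under eq_fun do rewrite /= mxE; exact: measurable_coord.
Qed.

Lemma prod_sigma_finite (d1 d2 : measure_display) (T1 : measurableType d1)
    (T2 : measurableType d2) (m1 : {sigma_finite_measure set T1 -> \bar R})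
    (m2 : {sigma_finite_measure set T2 -> \bar R}) :
  sigma_finite setT (m1 \x m2).
Proof.
have /sigma_finiteP[F [F_T F_nd F_oo]] := sigma_finiteT m1.
have /sigma_finiteP[G [G_T G_nd G_oo]] := sigma_finiteT m2.
exists (fun n => F n `*` G n).
  apply/seteqP; split=> // -[x y] _.
  have [n _ Fx] : (\bigcup_i F i) x by rewrite -F_T.
  have [k _ Gy] : (\bigcup_i G i) y by rewrite -G_T.
  exists (maxn n k) => //; split => /=.
  - by move: x Fx; exact/subsetPset/F_nd/leq_maxl.
  - by move: y Gy; exact/subsetPset/G_nd/leq_maxr.
move=> n; have [? ?] := F_oo n; have [? ?] := G_oo n.
split; first exact: measurableX.
by rewrite product_measure1E// lte_mul_pinfty// ge0_fin_numE.
Qed.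

Section LebCons.
Variables (d : nat) (mu : {sigma_finite_measure set 'rV[R]_d -> \bar R}).

Definition leb_cons : set 'rV[R]_d.+1 -> \bar R :=
  pushforward (@lebesgue_measure R \x mu) (@consv d).

Let m_pre (A : set 'rV[R]_d.+1) : measurable A -> measurable (@consv d @^-1` A).
Proof. by move=> mA; rewrite -[X in measurable X]setTI; exact: measurable_consv. Qed.

Let leb_cons0 : leb_cons set0 = 0.
Proof. by rewrite /leb_cons /pushforward preimage_set0 measure0. Qed.

Let leb_cons_ge0 A : 0 <= leb_cons A.
Proof. exact: (measure_ge0 (@lebesgue_measure R \x mu)). Qed.

Let leb_cons_sigma_additive : semi_sigma_additive leb_cons.
Proof.
move=> F mF tF mUF; rewrite /leb_cons /pushforward preimage_bigcup.
apply: (@measure_semi_sigma_additive _ _ _ (@lebesgue_measure R \x mu)) => [n||]; first by apply: m_pre; exact: mF.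
  apply/trivIsetP => /= i j _ _ ij; rewrite -preimage_setI.
  by move/trivIsetP : tF => /(_ _ _ _ _ ij) ->//; rewrite preimage_set0.
by rewrite -preimage_bigcup; exact: m_pre.
Qed.

HB.instance Definition _ := isMeasure.Build _ _ _ leb_cons
  leb_cons0 leb_cons_ge0 leb_cons_sigma_additive.

Let leb_cons_sigma_finite : sigma_finite setT leb_cons.
Proof.
have [F FT Foo] := prod_sigma_finite (@lebesgue_measure R) mu.
exists (fun n => @unconsv d @^-1` F n).
  by rewrite -preimage_bigcup -FT preimage_setT.
move=> n; have [mF Fn] := Foo n; split.
  by rewrite -[X in measurable X]setTI; exact: measurable_unconsv.
rewrite /leb_cons /pushforward.
suff -> : @consv d @^-1` (@unconsv d @^-1` F n) = F n by [].
by apply/seteqP; split=> z /=; rewrite consvK.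
Qed.

HB.instance Definition _ := Measure_isSigmaFinite.Build _ _ _ leb_cons
  leb_cons_sigma_finite.
End LebCons.

(** Each dimension pushes the product of one-dimensional Lebesgue measure and the previous measure
    along [consv]. Sigma-finiteness is carried through the induction because Tonelli needs it here
    and in every later exchange of integrals. *)
Lemma leb_exists (d : nat) :
  exists mu : {sigma_finite_measure set 'rV[R]_d -> \bar R},
  forall f : 'rV[R]_d -> \bar R, measurable_fun setT f -> (forall x, 0 <= f x) ->
    lebint f = \int[mu]_x f x.
Proof.
elim: d => [|d [mu IH]].
  (* For [d = 0], [lebint] evaluates at the only vector: a Dirac mass. *)
  exists (@dirac _ 'rV[R]_0 0%R R) => f mf f0.
  by rewrite integral_dirac// diracT mul1e.
exists (leb_cons mu) => f mf f0 /=.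
have mfc : measurable_fun setT (f \o @consv d).
  by apply: measurableT_comp => //; exact: measurable_consv.
rewrite (ge0_integral_pushforward (@measurable_consv d)
  (@lebesgue_measure R \x mu)) ?preimage_setT//.
rewrite (@fubini_tonelli1 _ _ _ _ _ _ _ (f \o @consv d))//.
apply: eq_integral => x _; rewrite IH//.
exact: (measurableT_comp mfc (pair1_measurable x)).
by move=> z; exact: f0.
Qed.

(** The translated measure agrees with Lebesgue measure on half-open intervals, so the two coincide
    by uniqueness. *)
Lemma lebesgue_integral_shift (f : R -> \bar R) (a : R) :
  measurable_fun setT f -> (forall x, 0 <= f x) ->
  \int[@lebesgue_measure R]_x f (x + a)%R = \int[@lebesgue_measure R]_x f x.
Proof.
move=> mf f0.
pose T := measurableTypeR R.
have ms : measurable_fun [set: T] (fun x : T => (x + a)%R : T).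
  exact: (@measurable_funD _ R R setT id (cst a)).
pose nu : {measure set T -> \bar R} :=
  measure_function_pushforward__canonical__measure_function_Measure
    (@lebesgue_measure R) ms.
transitivity (\int[nu]_x f x).
  rewrite (@ge0_integral_pushforward _ _ T T R _ ms (@lebesgue_measure R) setT f)//.
apply: eq_measure_integral => A mA _; symmetry.
apply: lebesgue_measure_unique => // _ [[b c]] _ <-/=.
rewrite /pushforward.
have -> : (fun x => x + a)%R @^-1` `]b, c] = `](b - a)%R, (c - a)%R]%classic.
  by apply/seteqP; split=> x /=; rewrite !in_itv/= ltrBlDr lerBrDr.
by rewrite !lebesgue_measure_itv/= !lte_fin ltrD2r; case: ifP => // _;
  rewrite -!EFinD; congr EFin; ring.
Qed.

Definition leb (d : nat) := projT1 (cid (leb_exists d)).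

Lemma lebintE (d : nat) (f : 'rV[R]_d -> \bar R) :
  measurable_fun setT f -> (forall x, 0 <= f x) -> lebint f = \int[leb d]_x f x.
Proof. exact: (projT2 (cid (leb_exists d))). Qed.

Lemma eq_lebint (d : nat) (f g : 'rV[R]_d -> \bar R) :
  f =1 g -> lebint f = lebint g.
Proof. by move=> /funext ->. Qed.

Lemma measurable_shift (d : nat) (c : 'rV[R]_d) :
  measurable_fun setT (fun x : 'rV[R]_d => (x + c)%R).
Proof.
apply: measurable_rV => i; under eq_fun do rewrite mxE.
by apply: measurable_funD => //; exact: measurable_coord.
Qed.

Lemma measurable_pairl (d : nat) (f : 'rV[R]_d.+1 -> \bar R) (x : R) :
  measurable_fun setT f -> measurable_fun setT (fun v => f (@consv d (x, v))).
Proof.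
move=> mf.
exact: (measurableT_comp (measurableT_comp mf (@measurable_consv d)) (pair1_measurable _)).
Qed.

Lemma lebint_shift (d : nat) (f : 'rV[R]_d -> \bar R) (c : 'rV[R]_d) :
  measurable_fun setT f -> (forall x, 0 <= f x) ->
  lebint (fun x => f (x + c)%R) = lebint f.
Proof.
elim: d f c => [|d IH] f c mf f0 /=.
  by congr (f _); apply/rowP => i; have := ltn_ord i.
pose G (x : R) : \bar R := lebint (fun v : 'rV[R]_d => f (consv (x, v))).
have GE x : G x = \int[leb d]_v f (consv (x, v)).
  by rewrite /G lebintE//; exact: measurable_pairl.
transitivity (\int[@lebesgue_measure R]_x G (x + c ord0 ord0)%R).
  apply: eq_integral => x _; rewrite /G.
  rewrite -(IH (fun v => f (consv ((x + c ord0 ord0)%R, v))) (\row_i c ord0 (lift ord0 i)))//; last exact: measurable_pairl.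
  apply: eq_lebint => v; congr f; apply/rowP => i; rewrite mxE.
  case: (unliftP ord0 i) => [j ->|->].
    by rewrite (consvS (x, v)) consvS !mxE.
  by rewrite (consv0 (x, v)) consv0.
rewrite lebesgue_integral_shift//.
  rewrite (funext GE).
  have mfc : measurable_fun setT (f \o @consv d).
    by apply: measurableT_comp => //; exact: measurable_consv.
  by apply: (@measurable_fun_fubini_tonelli_F _ _ _ _ _ (leb d) (f \o @consv d)) => // z; exact: f0.
by move=> x; rewrite GE; apply: integral_ge0.
Qed.

Lemma leb_shift (d : nat) (f : 'rV[R]_d -> \bar R) (c : 'rV[R]_d) :
  measurable_fun setT f -> (forall x, 0 <= f x) ->
  \int[leb d]_x f (x + c)%R = \int[leb d]_x f x.
Proof.
move=> mf f0; rewrite -!lebintE//; first exact: lebint_shift.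
exact: (measurableT_comp mf (measurable_shift c)).
Qed.
End LebesgueVectors.

(** * Euclidean geometry, the Gaussian density and measurability rules *)

Section Euclidean.
Context {R : realType} {d : nat}.
Implicit Types u v w : 'rV[R]_d.

Definition dot u v : R := \sum_(i < d) u ord0 i * v ord0 i.
(** The square of [enorm], used in its place so that no square roots enter the estimates. *)
Definition sqn v : R := dot v v.

Lemma dotC u v : dot u v = dot v u.
Proof. by apply: eq_bigr => i _; rewrite mulrC. Qed.

Lemma dotDl u v w : dot (u + v) w = dot u w + dot v w.
Proof. by rewrite -big_split; apply: eq_bigr => i _; rewrite mxE mulrDl. Qed.

Lemma dotZl (a : R) u v : dot (a *: u) v = a * dot u v.
Proof. by rewrite mulr_sumr; apply: eq_bigr => i _; rewrite mxE mulrA. Qed.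

Lemma dotNl u v : dot (- u) v = - dot u v.
Proof. by rewrite -scaleN1r dotZl mulN1r. Qed.

Lemma dotBl u v w : dot (u - v) w = dot u w - dot v w.
Proof. by rewrite dotDl dotNl. Qed.

Lemma dotDr u v w : dot w (u + v) = dot w u + dot w v.
Proof. by rewrite !(dotC w) dotDl. Qed.

Lemma dotZr (a : R) u v : dot u (a *: v) = a * dot u v.
Proof. by rewrite !(dotC u) dotZl. Qed.

Lemma dotNr u v : dot u (- v) = - dot u v.
Proof. by rewrite !(dotC u) dotNl. Qed.

Lemma dotBr u v w : dot w (u - v) = dot w u - dot w v.
Proof. by rewrite !(dotC w) dotBl. Qed.

Lemma sqn_ge0 v : 0 <= sqn v.
Proof. by apply: sumr_ge0 => i _; rewrite -expr2 sqr_ge0. Qed.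

Lemma enorm_sqr v : enorm v ^+ 2 = sqn v.
Proof.
rewrite /enorm sqr_sqrtr; last by apply: sumr_ge0 => i _; rewrite sqr_ge0.
by apply: eq_bigr => i _; rewrite expr2.
Qed.

Lemma enorm_ge0 v : 0 <= enorm v.
Proof. exact: sqrtr_ge0. Qed.

Lemma sqnD u v : sqn (u + v) = sqn u + 2 * dot u v + sqn v.
Proof. rewrite /sqn dotDl !dotDr (dotC v u); ring. Qed.

Lemma sqnB u v : sqn (u - v) = sqn u - 2 * dot u v + sqn v.
Proof. rewrite /sqn dotBl !dotBr (dotC v u); ring. Qed.

Lemma sqnZ (a : R) v : sqn (a *: v) = a ^+ 2 * sqn v.
Proof. rewrite /sqn dotZl dotZr; ring. Qed.

Lemma sqnN v : sqn (- v) = sqn v.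
Proof. by rewrite /sqn dotNl dotNr opprK. Qed.

Lemma dot_young (a : R) u v : 0 < a -> 2 * dot u v <= a * sqn u + a^-1 * sqn v.
Proof.
move=> a0; have := sqn_ge0 (a *: u - v).
rewrite sqnB sqnZ dotZl => H.
rewrite -(ler_pM2l a0) mulrDr (mulrA a a^-1) divff ?gt_eqF// mul1r; nra.
Qed.

Lemma sqnD_le u v : sqn (u + v) <= 2 * sqn u + 2 * sqn v.
Proof.
have := dot_young u v ltr01; rewrite invr1 !mul1r sqnD => H; lra.
Qed.

Lemma sqnD3_le u v w : sqn (u + v + w) <= 3 * sqn u + 3 * sqn v + 3 * sqn w.
Proof.
have := dot_young u v ltr01; have := dot_young u w ltr01.
have := dot_young v w ltr01.
rewrite invr1 !mul1r !sqnD dotDl => *; lra.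
Qed.

Lemma dot_delta v i : dot v (delta_mx ord0 i) = v ord0 i.
Proof.
rewrite /dot (bigD1 i)//= big1 ?addr0; first by rewrite mxE !eqxx mulr1.
by move=> j ji; rewrite mxE eqxx (negbTE ji) mulr0.
Qed.

Lemma gaussE (s2 : R) v :
  gauss s2 v = (Num.sqrt (2 * pi * s2)) ^- d * expR (- sqn v / (2 * s2)).
Proof. by rewrite /gauss enorm_sqr. Qed.

Lemma gauss_gt0 (s2 : R) v : 0 < s2 -> 0 < gauss s2 v.
Proof.
move=> s0; rewrite gaussE mulr_gt0 ?expR_gt0// invr_gt0 exprn_gt0// sqrtr_gt0.
by rewrite !mulr_gt0// pi_gt0.
Qed.

Lemma gauss_ge0 (s2 : R) v : 0 <= gauss s2 v.
Proof. by rewrite gaussE mulr_ge0 ?expR_ge0// invr_ge0 exprn_ge0. Qed.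

Lemma gaussN (s2 : R) v : gauss s2 (- v) = gauss s2 v.
Proof. by rewrite !gaussE sqnN. Qed.

Lemma gauss_le (s2 : R) v : 0 < s2 -> gauss s2 v <= (Num.sqrt (2 * pi * s2)) ^- d.
Proof.
move=> s0; rewrite gaussE ler_piMr// ?invr_ge0 ?exprn_ge0//.
rewrite -[leRHS]expR0 ler_expR mulNr oppr_le0 divr_ge0 ?sqn_ge0//.
by rewrite mulr_ge0// ltW.
Qed.

End Euclidean.

Section MeasurableOps.
Context {R : realType} {dS : measure_display} {S : measurableType dS}.

Lemma measurable_vD (d : nat) (f g : S -> 'rV[R]_d) :
  measurable_fun setT f -> measurable_fun setT g ->
  measurable_fun setT (fun s => f s + g s).
Proof.
move=> mf mg; apply: measurable_rV => i; under eq_fun do rewrite mxE.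
by apply: measurable_funD; exact: (measurableT_comp (measurable_coord i)).
Qed.

Lemma measurable_vN (d : nat) (f : S -> 'rV[R]_d) :
  measurable_fun setT f -> measurable_fun setT (fun s => - f s).
Proof.
move=> mf; apply: measurable_rV => i; under eq_fun do rewrite mxE.
by apply: measurable_funN; exact: (measurableT_comp (measurable_coord i)).
Qed.

Lemma measurable_vZ (d : nat) (a : R) (f : S -> 'rV[R]_d) :
  measurable_fun setT f -> measurable_fun setT (fun s => a *: f s).
Proof.
move=> mf; apply: measurable_rV => i; under eq_fun do rewrite mxE.
by apply: measurable_funM => //; exact: (measurableT_comp (measurable_coord i)).
Qed.

Lemma measurable_dot (d : nat) (f g : S -> 'rV[R]_d) :
  measurable_fun setT f -> measurable_fun setT g ->
  measurable_fun setT (fun s => dot (f s) (g s)).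
Proof.
move=> mf mg; apply: measurable_sum => i.
by apply: measurable_funM; exact: (measurableT_comp (measurable_coord i)).
Qed.

Lemma measurable_sqn (d : nat) (f : S -> 'rV[R]_d) :
  measurable_fun setT f -> measurable_fun setT (fun s => sqn (f s)).
Proof. by move=> mf; exact: measurable_dot. Qed.

Lemma measurable_exp (f : S -> R) :
  measurable_fun setT f -> measurable_fun setT (fun s => expR (f s)).
Proof. exact: (measurableT_comp (@measurable_expR R)). Qed.

Lemma measurable_gauss (d : nat) (s2 : R) (f : S -> 'rV[R]_d) :
  measurable_fun setT f -> measurable_fun setT (fun s => gauss s2 (f s)).
Proof.
move=> mf; under eq_fun do rewrite gaussE.
apply: measurable_funM => //; apply: measurable_exp.
by apply: measurable_funM => //; apply: measurable_funN; exact: measurable_sqn.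
Qed.

Lemma measurable_inv (f : S -> R) : (forall s, 0 <= f s) ->
  measurable_fun setT f -> measurable_fun setT (fun s => (f s)^-1).
Proof.
move=> f0 mf; under eq_fun do rewrite -powR_inv1//.
exact: (measurableT_comp (@measurable_powR R (-1)) mf).
Qed.

End MeasurableOps.

Lemma measurable_vDl {R : realType} (d : nat) (x : 'rV[R]_d) :
  measurable_fun setT (+%R x).
Proof. exact: (measurable_vD (measurable_cst x) (@measurable_id _ _ setT)). Qed.

(* The order matters: closed-form rules first, then composition with a
   measurable function from the context. *)
Ltac meas :=
  repeat match goal with
  | H : measurable_fun setT ?f' |- measurable_fun _ ?f => constr_eq f f'; exact: H
  | |- measurable_fun _ (cst _) => exact: measurable_cst
  | |- measurable_fun _ (fun s => ?c) => exact: measurable_cst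
  | |- measurable_fun _ (fun s => s) => exact: measurable_id
  | |- measurable_fun _ fst => exact: measurable_fst
  | |- measurable_fun _ snd => exact: measurable_snd
  | |- measurable_fun _ (fun s => s.1) => exact: measurable_fst
  | |- measurable_fun _ (fun s => s.2) => exact: measurable_snd
  | |- measurable_fun _ (fun s => fst (@?g s)) =>
      apply: (measurableT_comp measurable_fst)
  | |- measurable_fun _ (fun s => snd (@?g s)) =>
      apply: (measurableT_comp measurable_snd)
  | |- measurable_fun _ (fun s => (@?f s - @?g s)%R) =>
      first [apply: measurable_funB | apply: (measurable_vD _ (measurable_vN _))]
  | |- measurable_fun _ (fun s => (@?f s + @?g s)%R) =>
      first [apply: measurable_funD | apply: measurable_vD]
  | |- measurable_fun _ (+%R _) => exact: measurable_vDl
  | |- measurable_fun _ (fun s => (- @?f s)%R) =>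
      first [apply: measurable_funN | apply: measurable_vN]
  | |- measurable_fun _ (fun s => (_ *: @?f s)%R) => apply: measurable_vZ
  | |- measurable_fun _ (fun s => (@?f s * @?g s)%R) => apply: measurable_funM
  | |- measurable_fun _ (fun s => (@?f s ^+ _)%R) => apply: measurable_funX
  | |- measurable_fun _ (fun s => (@?f s)%:E) => apply/measurable_EFinP
  | |- measurable_fun _ (fun s => expR (@?f s)) => apply: measurable_exp
  | |- measurable_fun _ (fun s => gauss _ (@?f s)) => apply: measurable_gauss
  | |- measurable_fun _ (gauss _) => apply: (@measurable_gauss _ _ _ _ _ id); exact: measurable_id
  | |- measurable_fun _ (@sqn _ _) => apply: (@measurable_sqn _ _ _ _ id); exact: measurable_id
  | |- measurable_fun _ (dot _) =>
      apply: (@measurable_dot _ _ _ _ (cst _) id); [exact: measurable_cst|exact: measurable_id]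
  | |- measurable_fun _ (fun s => dot (@?f s) (@?g s)) => apply: measurable_dot
  | |- measurable_fun _ (fun s => sqn (@?f s)) => apply: measurable_sqn
  | |- measurable_fun _ (fun s => (@?f s, @?g s)) => apply: measurable_fun_pair
  | |- measurable_fun _ (fun s => Num.min (@?f s) (@?g s)) => apply: measurable_minr
  | |- measurable_fun _ (fun s => `|@?f s|%R) => apply: (measurableT_comp (@normr_measurable _ setT))
  | H : measurable_fun setT ?f' |- measurable_fun _ (fun s => ?f (@?g s)) =>
      constr_eq f f'; apply: (measurableT_comp H)
  | H : measurable_fun setT (fun s => (@?f' s)^-1%R)
    |- measurable_fun _ (fun s => (@?f s)^-1%R) => exact: H
  | |- measurable_fun _ (fun s => (@?f s)^-1%R) => apply: measurable_inv
  | |- measurable_fun _ _ => assumption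
  end.


(** * Integrals of nonnegative functions and Gaussian integrals *)

Section NonnegIntegral.
Context {R : realType} {d : nat}.
Implicit Types (f g w : 'rV[R]_d -> R).
Local Open Scope ereal_scope.

(** The integrand is real and the value extended real: nonnegative functions need no integrability
    hypothesis, and finiteness is expressed by an equation [nint f = r%:E]. *)
Definition nint f : \bar R := \int[leb d]_x (f x)%:E.

Lemma nintE f : nint f = \int[leb d]_x (f x)%:E.
Proof. by []. Qed.

Lemma nint_ge0 f : (forall x, 0 <= f x)%R -> 0 <= nint f.
Proof. by move=> f0; apply: integral_ge0 => x _; rewrite lee_fin. Qed.

Lemma lebint_nint f : measurable_fun setT f -> (forall x, 0 <= f x)%R ->
  lebint (fun x => (f x)%:E) = nint f.
Proof.
by move=> mf f0; rewrite lebintE// => *; rewrite ?lee_fin//; meas.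
Qed.

Lemma eq_nint f g : f =1 g -> nint f = nint g.
Proof. by move=> /funext ->. Qed.

Lemma le_nint f g : measurable_fun setT f -> measurable_fun setT g ->
  (forall x, 0 <= f x)%R -> (forall x, f x <= g x)%R -> nint f <= nint g.
Proof.
move=> mf mg f0 fg; apply: ge0_le_integral => //; try by meas.
- by move=> x _; rewrite lee_fin.
- by move=> x _; rewrite lee_fin.
Qed.

Lemma nintD f g : measurable_fun setT f -> measurable_fun setT g ->
  (forall x, 0 <= f x)%R -> (forall x, 0 <= g x)%R ->
  nint (fun x => f x + g x)%R = nint f + nint g.
Proof.
move=> mf mg f0 g0; rewrite /nint; under eq_integral do rewrite EFinD.
by rewrite ge0_integralD// => *; rewrite ?lee_fin//; meas.
Qed.

Lemma nintZ (a : R) f : measurable_fun setT f -> (0 <= a)%R ->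
  (forall x, 0 <= f x)%R -> nint (fun x => a * f x)%R = a%:E * nint f.
Proof.
move=> mf a0 f0; rewrite /nint; under eq_integral do rewrite EFinM.
by rewrite ge0_integralZl// => *; rewrite ?lee_fin//; meas.
Qed.

Lemma nint_shift f (c : 'rV[R]_d) : measurable_fun setT f ->
  (forall x, 0 <= f x)%R -> nint (fun x => f (x + c)%R) = nint f.
Proof.
move=> mf f0; apply: (@leb_shift R d (fun x => (f x)%:E)) => [|x]; first by meas.
by rewrite lee_fin.
Qed.

Lemma measurable_nint (dS : measure_display) (S : measurableType dS)
    (F : S -> 'rV[R]_d -> R) :
  measurable_fun setT (fun z : S * 'rV[R]_d => F z.1 z.2) ->
  (forall s x, 0 <= F s x)%R -> measurable_fun setT (fun s => nint (F s)).
Proof.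
move=> mF F0.
apply: (@measurable_fun_fubini_tonelli_F _ _ _ _ _ (leb d)
  (fun z : S * 'rV[R]_d => (F z.1 z.2)%:E)) => [|z]; first by meas.
by rewrite lee_fin.
Qed.

Lemma measurable_fine_nint (dS : measure_display) (S : measurableType dS)
    (F : S -> 'rV[R]_d -> R) :
  measurable_fun setT (fun z : S * 'rV[R]_d => F z.1 z.2) ->
  (forall s x, 0 <= F s x)%R -> measurable_fun setT (fun s => fine (nint (F s))).
Proof.
move=> mF F0; apply: (measurableT_comp (fine_measurable measurableT)).
exact: measurable_nint.
Qed.

Lemma nint_tonelli (F : 'rV[R]_d -> 'rV[R]_d -> R) :
  measurable_fun setT (fun z : 'rV[R]_d * 'rV[R]_d => F z.1 z.2) ->
  (forall x y, 0 <= F x y)%R ->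
  \int[leb d]_x nint (F x) = \int[leb d]_y nint (F^~ y).
Proof.
move=> mF F0; apply: (@fubini_tonelli _ _ _ _ _ (leb d) (leb d)
  (fun z => (F z.1 z.2)%:E)) => [|z]; first by meas.
by rewrite lee_fin.
Qed.

(** Cauchy-Schwarz in the form (int f)^2 / int w <= int f^2/w. It is the integral of 2 a f <= f^2/w
    + a^2 w at a = r/W, the value that maximises 2 a r - a^2 W. *)
Lemma nint_cs f w (W r : R) : measurable_fun setT f -> measurable_fun setT w ->
  (forall x, 0 <= f x)%R -> (forall x, 0 < w x)%R -> (0 < W)%R ->
  nint w = W%:E -> nint f = r%:E ->
  (r ^+ 2 / W)%:E <= nint (fun x => f x ^+ 2 / w x)%R.
Proof.
move=> mf mw f0 w0 W0 wW fr.
have r0 : (0 <= r)%R by rewrite -lee_fin -fr nint_ge0.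
have mw' : measurable_fun setT (fun x => (w x)^-1)%R.
  by apply: measurable_inv => // x; exact/ltW.
have mi : measurable_fun setT (fun x => f x ^+ 2 / w x)%R by meas.
have i0 x : (0 <= f x ^+ 2 / w x)%R by rewrite divr_ge0 ?sqr_ge0// ltW.
have [ioo|] := eqVneq (nint (fun x => f x ^+ 2 / w x)%R) +oo.
  by rewrite ioo leey.
rewrite -ltey => ifin; rewrite -(@fineK _ (nint _)) ?ge0_fin_numE ?nint_ge0//.
set A := fine _; rewrite lee_fin.
have AE : nint (fun x => f x ^+ 2 / w x)%R = A%:E.
  by rewrite fineK// ge0_fin_numE// nint_ge0.
have [a aE] : exists a, a = (r / W)%R by eexists.
have a0 : (0 <= a)%R by rewrite aE divr_ge0// ltW.
have : nint (fun x => 2 * a * f x)%R <= nint (fun x => f x ^+ 2 / w x + a ^+ 2 * w x)%R.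
  apply: le_nint => [|||x]; [by meas|by meas|by move=> x; rewrite !mulr_ge0|].
  rewrite -subr_ge0.
  have -> : (f x ^+ 2 / w x + a ^+ 2 * w x - 2 * a * f x =
    (f x - a * w x) ^+ 2 / w x)%R by field; rewrite gt_eqF.
  by rewrite divr_ge0 ?sqr_ge0// ltW.
rewrite nintZ ?mulr_ge0// nintD//; [|by meas|by move=> x; rewrite mulr_ge0 ?sqr_ge0 ?ltW].
rewrite nintZ ?sqr_ge0//; last by move=> x; exact: ltW.
rewrite wW fr AE -!EFinM -EFinD lee_fin aE => H.
have -> : (r ^+ 2 / W = 2 * (r / W) * r - (r / W) ^+ 2 * W)%R.
  by field; rewrite gt_eqF.
by rewrite lerBlDr.
Qed.

Lemma nint_fin f : (forall x, 0 <= f x)%R -> nint f < +oo ->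
  nint f = (fine (nint f))%:E.
Proof. by move=> f0 ?; rewrite fineK// ge0_fin_numE// nint_ge0. Qed.

Lemma nint_fin_le f (a : R) : (forall x, 0 <= f x)%R -> nint f <= a%:E ->
  exists2 r : R, nint f = r%:E & (0 <= r <= a)%R.
Proof.
move=> f0 fa; exists (fine (nint f)).
  by rewrite -nint_fin// (le_lt_trans fa) ?ltry.
by rewrite -!lee_fin -nint_fin ?nint_ge0 ?fa// (le_lt_trans fa) ?ltry.
Qed.
End NonnegIntegral.
Opaque nint.

Section GaussIntegral.
Context {R : realType}.
Local Open Scope ereal_scope.

Lemma sqn_consv (d : nat) (z : measurableTypeR R * 'rV[R]_d) :
  sqn (consv z) = (z.1 ^+ 2 + sqn z.2)%R.
Proof.
rewrite /sqn /dot big_ord_recl consv0 expr2; congr (_ + _)%R.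
by apply: eq_bigr => i _; rewrite consvS.
Qed.

Lemma gauss_consv (d : nat) (s2 : R) (z : measurableTypeR R * 'rV[R]_d) :
  (0 < s2)%R ->
  gauss s2 (consv z) = (normal_pdf 0 (Num.sqrt s2) z.1 * gauss s2 z.2)%R.
Proof.
move=> s0; rewrite !gaussE normal_pdfE; last by rewrite gt_eqF// sqrtr_gt0.
rewrite /normal_fun /normal_peak subr0 sqr_sqrtr ?ltW// sqn_consv.
have -> : (s2 * pi *+ 2 = 2 * pi * s2)%R by rewrite -mulr_natl; ring.
have -> : (- (z.1 ^+ 2 + sqn z.2) / (2 * s2) =
   - z.1 ^+ 2 / (s2 *+ 2) + - sqn z.2 / (2 * s2))%R.
  by rewrite -mulr_natl; field; rewrite gt_eqF.
by rewrite expRD exprS invfM; ring.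
Qed.

Lemma nint_gauss (d : nat) (s2 : R) : (0 < s2)%R ->
  nint (fun x : 'rV[R]_d => gauss s2 x) = 1.
Proof.
move=> s0; rewrite -lebint_nint; [|by meas|by move=> x; exact: gauss_ge0].
elim: d => [|d IH] /=.
  rewrite gaussE expr0 invr1 mul1r; congr EFin.
  by rewrite /sqn /dot big_ord0 oppr0 mul0r expR0.
transitivity (\int[@lebesgue_measure R]_x (normal_pdf 0 (Num.sqrt s2) x)%:E).
  apply: eq_integral => x _.
  transitivity (lebint (fun v : 'rV[R]_d => (normal_pdf 0 (Num.sqrt s2) x * gauss s2 v)%:E)).
    by apply: eq_lebint => v; rewrite -(gauss_consv (x, v))//.
  rewrite lebint_nint => [||v]; [|by meas|by rewrite mulr_ge0 ?normal_pdf_ge0 ?gauss_ge0].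
  rewrite nintZ ?normal_pdf_ge0//; [|by meas|by move=> v; exact: gauss_ge0].
  by rewrite -lebint_nint ?IH ?mule1// => *; rewrite ?gauss_ge0//; meas.
exact: integral_normal_pdf.
Qed.

Lemma nint_gaussB (d : nat) (s2 : R) (c : 'rV[R]_d) : (0 < s2)%R ->
  nint (fun x => gauss s2 (x - c)%R) = 1.
Proof.
move=> s0; rewrite (@nint_shift R d (fun x => gauss s2 x)) ?nint_gauss//; first by meas.
by move=> x; exact: gauss_ge0.
Qed.

(** Completing the square turns the integrand into a multiple of the Gaussian of variance t =
    s2/(1-e) and mean t a. The parameter [e] measures the quadratic term in units of the Gaussian
    exponent, so integrability is just [e < 1]. *)
Lemma nint_gauss_exp (d : nat) (s2 e : R) (a : 'rV[R]_d) : (0 < s2)%R -> (e < 1)%R ->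
  nint (fun x => gauss s2 x * expR (dot a x + e * sqn x / (2 * s2)))%R =
  ((Num.sqrt (1 - e)) ^- d * expR (s2 * sqn a / (2 * (1 - e))))%:E.
Proof.
move=> s0 e1.
have e10 : (0 < 1 - e)%R by rewrite subr_gt0.
pose t := (s2 / (1 - e))%R.
have t0 : (0 < t)%R by rewrite divr_gt0.
have E x : (gauss s2 x * expR (dot a x + e * sqn x / (2 * s2)) =
   ((Num.sqrt (1 - e)) ^- d * expR (s2 * sqn a / (2 * (1 - e)))) *
   gauss t (x - t *: a))%R.
  rewrite !gaussE -[LHS]mulrA -expRD [RHS]mulrACA -expRD; congr (_ * expR _)%R.
    rewrite -invfM -exprMn; congr ((_ ^+ _)^-1)%R; rewrite -sqrtrM ?ltW//.
    by congr Num.sqrt; rewrite /t; field; rewrite gt_eqF.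
  rewrite sqnB sqnZ dotZr (dotC x) /t; field.
  by rewrite !gt_eqF.
rewrite (eq_nint E) nintZ ?nint_gaussB ?mule1// ?mulr_ge0 ?expR_ge0 ?invr_ge0 ?exprn_ge0//.
- by meas.
- by move=> x; exact: gauss_ge0.
Qed.

(** For independent u, u' of law N(0,h), the sum v is N(0,2h), and given v the law of u is N(v/2,
    h/2). *)
Lemma gauss_conv (d : nat) (h : R) (u v : 'rV[R]_d) : (0 < h)%R ->
  (gauss h u * gauss h (v - u) = gauss (2 * h) v * gauss (h / 2) (u - 2^-1 *: v))%R.
Proof.
move=> h0; rewrite !gaussE [LHS]mulrACA [RHS]mulrACA -!expRD; congr (_ * expR _)%R.
  rewrite -!invfM -!exprMn; congr ((_ ^+ _)^-1)%R.
  rewrite -!sqrtrM ?mulr_ge0 ?pi_ge0 ?ltW//; congr Num.sqrt.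
  by field.
rewrite !sqnB sqnZ dotZr (dotC v); field.
by rewrite gt_eqF.
Qed.

Lemma nint_gauss_conv (d : nat) (h : R) (v : 'rV[R]_d) : (0 < h)%R ->
  nint (fun u => gauss h u * gauss h (v - u))%R = (gauss (2 * h) v)%:E.
Proof.
move=> h0; rewrite (eq_nint (fun u => gauss_conv u v h0)) nintZ.
- by rewrite nint_gaussB ?mule1// divr_gt0.
- by meas.
- exact: gauss_ge0.
- by move=> x; exact: gauss_ge0.
Qed.
End GaussIntegral.
Opaque gauss dot sqn.

(** * One step through a midpoint *)

Section KernelChi2.
Context {R : realType} {d : nat}.
Variables (u v pi0 : 'rV[R]_d -> R) (k : 'rV[R]_d -> 'rV[R]_d -> R) (J : 'rV[R]_d -> R).
Variables (P m S : R).
Hypotheses (mu : measurable_fun setT u) (mv : measurable_fun setT v)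
  (mpi : measurable_fun setT pi0)
  (mk : measurable_fun setT (fun z : 'rV[R]_d * 'rV[R]_d => k z.1 z.2))
  (mJ : measurable_fun setT J).
Hypotheses (u0 : forall x, 0 <= u x) (v0 : forall x, 0 < v x)
  (pi_gt0 : forall x, 0 < pi0 x) (k0 : forall x y, 0 <= k x y) (P0 : 0 < P).
Hypotheses (iv : nint v = P%:E) (ipi : nint pi0 = P%:E) (iu : nint u = m%:E)
  (iS : nint (fun x => u x ^+ 2 / v x) = S%:E) (ik : forall x, nint (k x) = 1%E)
  (iJ : forall y, nint (fun x => (u x * k x y)%R) = (J y)%:E).

Let m0 : 0 <= m. Proof. by rewrite -lee_fin -iu nint_ge0. Qed.

Let J0 y : 0 <= J y.
Proof. by rewrite -lee_fin -iJ nint_ge0// => x; rewrite mulr_ge0. Qed.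

Let mk1 x : measurable_fun setT (k x).
Proof. exact: (measurableT_comp mk (pair1_measurable x)). Qed.

Let mk2 y : measurable_fun setT (k^~ y).
Proof. exact: (measurableT_comp mk (pair2_measurable y)). Qed.

Let c x y : R := k x y - pi0 y / P.
Let D x y : R := u x ^+ 2 / v x * (P * (c x y ^+ 2 / pi0 y)).

Let D0 x y : 0 <= D x y.
Proof.
have dv (a t : R) : 0 < t -> 0 <= a ^+ 2 / t by move=> t0; rewrite divr_ge0 ?sqr_ge0 ?ltW.
by rewrite /D mulr_ge0 ?dv// mulr_ge0 ?dv// ltW.
Qed.

Let miv : measurable_fun setT (fun x => (v x)^-1).
Proof. by meas => x; exact: ltW. Qed.

Let mipi : measurable_fun setT (fun x => (pi0 x)^-1).
Proof. by meas => x; exact: ltW. Qed.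

Let mD : measurable_fun setT (fun z : 'rV[R]_d * 'rV[R]_d => D z.1 z.2).
Proof.
have ? : measurable_fun setT (fun z : 'rV[R]_d * 'rV[R]_d => (v z.1)^-1).
  exact: (measurableT_comp miv measurable_fst).
have ? : measurable_fun setT (fun z : 'rV[R]_d * 'rV[R]_d => (pi0 z.2)^-1).
  exact: (measurableT_comp mipi measurable_snd).
by rewrite /D /c; meas.
Qed.

(** J - m pi0/P is the integral of u against the centred kernel [c], and Cauchy-Schwarz is applied
    with weight [v]. Since [nint] is meant for nonnegative functions, u |c| is integrated, and the
    one-sided bounds [le1] and [le2] recover the absolute value. *)
Let centered_cs y : (((J y - m * (pi0 y / P)) ^+ 2 / pi0 y)%:E <= nint (D^~ y))%E.
Proof.
pose f x := u x * `|c x y|.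
have mf : measurable_fun setT f by rewrite /f /c; meas.
have f0 x : 0 <= f x by rewrite mulr_ge0.
have t0 : 0 <= pi0 y / P by rewrite divr_ge0// ltW.
have mkuc : measurable_fun setT (fun x => u x * k x y) by meas.
have iut : nint (fun x => pi0 y / P * u x) = (m * (pi0 y / P))%:E.
  by rewrite nintZ// iu -EFinM mulrC.
have [r ir _] : exists2 r, nint f = r%:E & 0 <= r <= J y + m * (pi0 y / P).
  apply: nint_fin_le => //; rewrite EFinD -iut -iJ -nintD//.
  - apply: le_nint => //; first by meas.
    move=> x; rewrite /f (mulrC (pi0 y / P)) -mulrDr ler_wpM2l//.
    rewrite /c (le_trans (ler_normB _ _))// !ger0_norm//.
  - by meas.
  - by move=> x; rewrite mulr_ge0.
  - by move=> x; rewrite mulr_ge0.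
have r0 : 0 <= r by rewrite -lee_fin -ir nint_ge0.
have le1 : J y <= r + m * (pi0 y / P).
  rewrite -lee_fin EFinD -iut -ir -iJ -nintD//; [|by meas|by move=> x; rewrite mulr_ge0].
  apply: le_nint => //; [by meas|by move=> x; rewrite mulr_ge0|move=> x].
  rewrite /f (mulrC (pi0 y / P)) -mulrDr ler_wpM2l// -lerBlDr; exact: ler_norm.
have le2 : m * (pi0 y / P) <= r + J y.
  rewrite -lee_fin EFinD -iut -ir -iJ -nintD//; last by move=> x; rewrite mulr_ge0.
  apply: le_nint => //; [by meas|by meas|by move=> x; rewrite mulr_ge0|move=> x].
  rewrite /f (mulrC (pi0 y / P)) -mulrDr ler_wpM2l// -lerBlDr /c distrC; exact: ler_norm.
have sq : (J y - m * (pi0 y / P)) ^+ 2 <= r ^+ 2.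
  by rewrite -[leLHS]real_normK ?num_real// ler_sqr ?nnegrE// ler_norml; lra.
have := nint_cs mf mv f0 v0 P0 iv ir.
have -> : (nint (D^~ y) = (P / pi0 y)%:E * nint (fun x => (f x ^+ 2 / v x)%R))%E.
  rewrite -nintZ//.
  - apply: eq_nint => x; rewrite /D /f exprMn -normrX ger0_norm ?sqr_ge0//.
    by field; rewrite !gt_eqF.
  - by meas.
  - by rewrite divr_ge0// ltW.
  - by move=> x; rewrite divr_ge0 ?sqr_ge0// ltW.
have Ppi0 : 0 <= P / pi0 y by rewrite divr_ge0// ltW.
move=> /(@lee_wpmul2l _ (P / pi0 y)%:E); rewrite lee_fin => /(_ Ppi0).
apply: le_trans; rewrite -EFinM lee_fin.
have -> : P / pi0 y * (r ^+ 2 / P) = r ^+ 2 / pi0 y by field; rewrite !gt_eqF.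
by rewrite ler_pM2r ?invr_gt0.
Qed.

(** As [k x] has mass 1 and [pi0] mass P, the integral of c^2/pi0 is that of k^2/pi0 minus 1/P. The
    additive form allows infinite values. *)
Let nint_D x : (nint (D x) + (u x ^+ 2 / v x)%:E =
  (u x ^+ 2 / v x)%:E * (P%:E * nint (fun y => (k x y ^+ 2 / pi0 y)%R)))%E.
Proof.
have uv0 : 0 <= u x ^+ 2 / v x by rewrite divr_ge0 ?sqr_ge0// ltW.
have c0 y : 0 <= c x y ^+ 2 / pi0 y by rewrite divr_ge0 ?sqr_ge0// ltW.
have kk0 y : 0 <= k x y ^+ 2 / pi0 y by rewrite divr_ge0 ?sqr_ge0// ltW.
have mc : measurable_fun setT (fun y => c x y ^+ 2 / pi0 y).
  by have := mk1 x => ?; rewrite /c; meas.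
have mkk : measurable_fun setT (fun y => k x y ^+ 2 / pi0 y).
  by have := mk1 x => ?; meas.
have key : (nint (fun y => (c x y ^+ 2 / pi0 y)%R) + (P^-1)%:E =
    nint (fun y => (k x y ^+ 2 / pi0 y)%R))%E.
  have : nint (fun y => c x y ^+ 2 / pi0 y + 2 / P * k x y) =
         nint (fun y => k x y ^+ 2 / pi0 y + P^-1 ^+ 2 * pi0 y).
    by apply: eq_nint => y; rewrite /c; field; rewrite !gt_eqF.
  have ? := mk1 x.
  rewrite (nintD mc)//; [|by meas|by move=> y; rewrite mulr_ge0 ?divr_ge0 ?(ltW P0)].
  rewrite nintD//; [|by meas|by move=> y; rewrite mulr_ge0 ?sqr_ge0 ?ltW].
  rewrite !nintZ ?sqr_ge0 ?divr_ge0 ?ik ?ipi ?ltW//; last by move=> y; exact: ltW.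
  rewrite mule1 -EFinM => E.
  have -> : (P^-1 = 2 / P - P^-1 ^+ 2 * P)%R by field; rewrite gt_eqF.
  by rewrite EFinB addeA E addeK.
rewrite /D nintZ//; [|by have ? := mk1 x; rewrite /c; meas|by move=> y; rewrite mulr_ge0 ?(ltW P0)].
rewrite nintZ ?(ltW P0)// -key; have := nint_ge0 c0.
move: (nint _) => N N0; rewrite ge0_muleDr// ?lee_fin ?invr_ge0 ?(ltW P0)//.
rewrite -EFinM divff ?gt_eqF// ge0_muleDr ?mule1//.
by rewrite mule_ge0 ?lee_fin ?(ltW P0).
Qed.

(** A chi-square estimate for a Markov kernel compared with a single reference law pi0/P: only the
    centred part of the kernel contributes beyond m^2/P, and its cost is the average under u^2/v of
    the chi-square divergence of [k x] from pi0/P. The term [S] stands on the left because that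
    divergence is P int k^2/pi0 minus 1. *)
Lemma kernel_chi2 :
  (nint (fun y => (J y ^+ 2 / pi0 y)%R) + S%:E <= (m ^+ 2 / P)%:E +
   \int[leb d]_x ((u x ^+ 2 / v x)%:E * (P%:E * nint (fun y => (k x y ^+ 2 / pi0 y)%R))))%E.
Proof.
have uv0 x : 0 <= u x ^+ 2 / v x by rewrite divr_ge0 ?sqr_ge0// ltW.
have muv : measurable_fun setT (fun x => u x ^+ 2 / v x) by meas.
have J20 y : 0 <= J y ^+ 2 / pi0 y by rewrite divr_ge0 ?sqr_ge0// ltW.
under eq_integral do rewrite -nint_D.
rewrite ge0_integralD//=; last 4 first.
- by move=> x _; apply: nint_ge0.
- exact: measurable_nint.
- by move=> x _; rewrite lee_fin.
- by meas.
rewrite -[X in (_ + (_ + X))%E]nintE iS.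
rewrite (nint_tonelli mD D0).
have iJm : nint J = m%:E.
  transitivity (\int[leb d]_y nint (fun x => (u x * k x y)%R))%E.
    by apply: eq_integral => y _; rewrite iJ.
  rewrite -(@nint_tonelli _ _ (fun x y => u x * k x y)); last by move=> x y; rewrite mulr_ge0.
  - rewrite -iu; apply: eq_integral => x _; rewrite nintZ// ?ik ?mule1//.
  - by meas.
rewrite [leRHS]addeA leeD2r//.
(* Expanding the square in [centered_cs]; the cross term 2 (m/P) J is kept on the right so that
   every integrand is nonnegative. *)
suff : (nint (fun y => (J y ^+ 2 / pi0 y)%R) + (m ^+ 2 / P)%:E <=
  (2 * (m ^+ 2 / P))%:E + \int[leb d]_y nint (D^~ y))%E.
  rewrite -(@leeD2rE _ (m ^+ 2 / P)%:E)// => /le_trans; apply.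
  by rewrite addeAC -EFinD; rewrite -mulr2n mulr_natl.
have msw : measurable_fun setT (fun z : 'rV[R]_d * 'rV[R]_d => (z.2, z.1)) by meas.
have mJ2 : measurable_fun setT (fun y => J y ^+ 2 / pi0 y) by meas.
have -> : (nint (fun y => (J y ^+ 2 / pi0 y)%R) + (m ^+ 2 / P)%:E)%E =
   nint (fun y => J y ^+ 2 / pi0 y + (m / P) ^+ 2 * pi0 y).
  rewrite nintD//; [|by meas|by move=> y; rewrite mulr_ge0 ?sqr_ge0 ?ltW].
  rewrite nintZ ?sqr_ge0 ?ipi// => [|y]; last exact: ltW.
  by rewrite -EFinM; congr (_ + _%:E)%E; field; rewrite gt_eqF.
have -> : (2 * (m ^+ 2 / P))%:E = nint (fun y => 2 * (m / P) * J y).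
  rewrite nintZ ?iJm -?EFinM//; last by rewrite mulr_ge0 ?divr_ge0 ?(ltW P0).
  by congr EFin; field; rewrite gt_eqF.
rewrite -ge0_integralD//=; last 4 first.
- by move=> y _; rewrite lee_fin !mulr_ge0 ?invr_ge0 ?(ltW P0).
- by meas.
- by move=> y _; apply: nint_ge0.
- apply: (@measurable_nint _ _ _ _ (fun y x => D x y)) => //.
  exact: (measurableT_comp mD msw).
apply: ge0_le_integral => //=.
- by move=> y _; rewrite lee_fin addr_ge0// mulr_ge0 ?sqr_ge0 ?ltW.
- by meas.
- apply: emeasurable_funD; first by meas.
  apply: (@measurable_nint _ _ _ _ (fun y x => D x y)) => //.
  exact: (measurableT_comp mD msw).
- move=> y _; rewrite addeC -leeBlDr// -EFinB.
  apply: le_trans (centered_cs y); rewrite lee_fin le_eqVlt; apply/orP; left; apply/eqP.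
  by field; rewrite !gt_eqF.
Qed.
End KernelChi2.

Section HeatAndDrift.
Context {R : realType} {d : nat}.
Variables (h : R) (h0 : 0 < h).
Local Notation V := 'rV[R]_d.
Local Notation g := (gauss h).

(** The convolution q * N(0,h). Here and below [fine] loses nothing: Gaussian kernels are bounded,
    so the integral is finite as soon as [q] has finite mass ([nint_bounded]). *)
Definition heat (q : V -> R) (y : V) : R :=
  fine (nint (fun x => q x * gauss h (y - x))).

(** Joint density at (y, z) of the midpoint and the end point. The whole drift sits in the second
    half-step, which leaves the first half a pure heat flow, where contraction is available. *)
Definition midpoint (b : V -> V) (q : V -> R) (y z : V) : R :=
  fine (nint (fun x => q x * (gauss h (y - x) * gauss h (z - y - h *: b x)))).

Definition drift_step (b : V -> V) (q : V -> R) (y : V) : R :=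
  fine (nint (fun x => q x * gauss (2 * h) (y - x - h *: b x))).

Lemma nint_bounded (q K : V -> R) (m M : R) :
  measurable_fun setT q -> measurable_fun setT K ->
  (forall x, 0 <= q x) -> (forall x, 0 <= K x <= M) -> nint q = m%:E ->
  nint (fun x => q x * K x) = (fine (nint (fun x => q x * K x)))%:E.
Proof.
move=> mq mK q0 KM iq.
have M0 : 0 <= M by have /andP[/le_trans H /H] := KM 0.
have [r -> _ //] : exists2 r, nint (fun x => q x * K x) = r%:E & 0 <= r <= M * m.
apply: nint_fin_le => [x|]; first by rewrite mulr_ge0//; case/andP: (KM x).
rewrite EFinM -iq -nintZ//; apply: le_nint => [|||x]; [by meas|by meas| |].
  by move=> x; rewrite mulr_ge0//; case/andP: (KM x).
by rewrite mulrC ler_wpM2r//; case/andP: (KM x).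
Qed.

Lemma gauss_bounded (s2 : R) : 0 < s2 ->
  exists2 M : R, 0 <= M & forall z : V, 0 <= gauss s2 z <= M.
Proof.
move=> s0; exists ((Num.sqrt (2 * pi * s2)) ^- d).
  by rewrite invr_ge0 exprn_ge0.
by move=> z; rewrite gauss_ge0 gauss_le.
Qed.

Section Density.
Variables (q : V -> R) (m : R).
Hypotheses (mq : measurable_fun setT q) (q0 : forall x, 0 <= q x)
  (iq : nint q = m%:E).

Lemma nint_heat_kernel y : nint (fun x => q x * g (y - x)) = (heat q y)%:E.
Proof.
by have [M M0 gM] := gauss_bounded h0; apply: (@nint_bounded _ _ m M) => //; meas.
Qed.

Lemma heat_ge0 y : 0 <= heat q y.
Proof.
by rewrite -lee_fin -nint_heat_kernel nint_ge0// => x; rewrite mulr_ge0 ?gauss_ge0.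
Qed.

Lemma measurable_heat : measurable_fun setT (heat q).
Proof.
apply: (@measurable_fine_nint _ _ _ _ (fun y x : V => q x * g (y - x))) => [|y x]; first by meas.
by rewrite mulr_ge0 ?gauss_ge0.
Qed.

Lemma nint_heat : nint (heat q) = m%:E.
Proof.
rewrite -iq nintE; under eq_integral do rewrite -nint_heat_kernel.
rewrite -(@nint_tonelli _ _ (fun x y => q x * g (y - x))); last first.
  by move=> x y; rewrite mulr_ge0 ?gauss_ge0.
- by meas.
- apply: eq_integral => x _; rewrite nintZ ?nint_gaussB ?mule1//; first by meas.
  by move=> y; exact: gauss_ge0.
Qed.

Variables (b : V -> V).
Hypothesis mb : measurable_fun setT b.

Lemma nint_drift_kernel y :
  nint (fun x => q x * gauss (2 * h) (y - x - h *: b x)) = (drift_step b q y)%:E.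
Proof.
have h20 : 0 < 2 * h by rewrite mulr_gt0.
have [M M0 gM] := gauss_bounded h20.
by apply: (@nint_bounded _ _ m M) => //; meas.
Qed.

Lemma drift_step_ge0 y : 0 <= drift_step b q y.
Proof.
by rewrite -lee_fin -nint_drift_kernel nint_ge0// => x; rewrite mulr_ge0 ?gauss_ge0.
Qed.

Lemma measurable_drift_step : measurable_fun setT (drift_step b q).
Proof.
apply: (@measurable_fine_nint _ _ _ _
  (fun y x : V => q x * gauss (2 * h) (y - x - h *: b x))) => [|y x]; first by meas.
by rewrite mulr_ge0 ?gauss_ge0.
Qed.

Lemma nint_drift_step : nint (drift_step b q) = m%:E.
Proof.
have h20 : 0 < 2 * h by rewrite mulr_gt0.
rewrite -iq nintE; under eq_integral do rewrite -nint_drift_kernel.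
rewrite -(@nint_tonelli _ _ (fun x y => q x * gauss (2 * h) (y - x - h *: b x))); last first.
  by move=> x y; rewrite mulr_ge0 ?gauss_ge0.
- by meas.
- apply: eq_integral => x _.
  have E y : q x * gauss (2 * h) (y - x - h *: b x) =
             q x * gauss (2 * h) (y - (x + h *: b x)) by rewrite opprD addrA.
  rewrite (eq_nint E) nintZ ?nint_gaussB ?mule1//; first by meas.
  by move=> y; exact: gauss_ge0.
Qed.
Lemma nint_midpoint_kernel y z :
  nint (fun x => q x * (g (y - x) * g (z - y - h *: b x))) = (midpoint b q y z)%:E.
Proof.
have [M M0 gM] := gauss_bounded h0.
apply: (@nint_bounded _ _ m (M * M)) => //; first by meas.
move=> x; have /andP[a1 a2] := gM (y - x).
have /andP[a3 a4] := gM (z - y - h *: b x).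
by rewrite (mulr_ge0 a1 a3) (ler_pM a1 a3 a2 a4).
Qed.

Lemma measurable_midpoint : measurable_fun setT (fun w : V * V => midpoint b q w.1 w.2).
Proof.
apply: (@measurable_fine_nint _ _ _ (V * V)%type
  (fun (w : V * V) (x : V) => q x * (g (w.1 - x) * g (w.2 - w.1 - h *: b x)))).
  by meas.
by move=> w x; rewrite !mulr_ge0 ?gauss_ge0.
Qed.

Lemma midpoint_ge0 y z : 0 <= midpoint b q y z.
Proof.
by rewrite -lee_fin -nint_midpoint_kernel nint_ge0// => x; rewrite !mulr_ge0 ?gauss_ge0.
Qed.

Lemma nint_midpoint z : nint ((midpoint b q)^~ z) = (drift_step b q z)%:E.
Proof.
rewrite -nint_drift_kernel nintE; under eq_integral do rewrite -nint_midpoint_kernel.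
rewrite -(@nint_tonelli _ _ (fun x y => q x * (g (y - x) * g (z - y - h *: b x)))); last first.
  by move=> x y; rewrite !mulr_ge0 ?gauss_ge0.
- by meas.
- rewrite nintE; apply: eq_integral => x _.
  rewrite nintZ//; [|by meas|by move=> y; rewrite mulr_ge0 ?gauss_ge0].
  rewrite EFinM; congr (_ * _)%E.
  rewrite -(nint_gauss_conv _ h0).
  refine (etrans _ (@nint_shift _ _ (fun u => g u * g (z - x - h *: b x - u)) (- x) _ _)).
  - apply: eq_nint => y; congr (_ * g _).
    by apply/rowP => i; rewrite !mxE; ring.
  - by meas.
  - by move=> u; rewrite mulr_ge0 ?gauss_ge0.
Qed.
End Density.
End HeatAndDrift.
Opaque heat midpoint drift_step.

Section Lift.
Context {R : realType} {d : nat}.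
Variables (h : R) (h0 : 0 < h).
Local Notation V := 'rV[R]_d.
Local Notation g := (gauss h).
Variables (p q : V -> R) (b : V -> V) (m Iq : R).
Hypotheses (mp : measurable_fun setT p) (mq : measurable_fun setT q)
  (mb : measurable_fun setT b) (p0 : forall x, 0 < p x) (q0 : forall x, 0 <= q x)
  (ip : nint p = 1%E) (iq : nint q = m%:E) (iI : nint (fun x => q x ^+ 2 / p x) = Iq%:E).

Let ple x : 0 <= p x. Proof. exact: ltW. Qed.
Let mJ := measurable_midpoint h mq q0 mb.
Let J0 := midpoint_ge0 h0 mq q0 iq mb.

Let mip : measurable_fun setT (fun x => (p x)^-1).
Proof. by meas => x; exact: ltW. Qed.

(** If this integral of a positive function vanished, the whole space would be negligible,
    contradicting that [p] has mass 1. *)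
Lemma heat_gt0 y : 0 < heat h p y.
Proof.
rewrite lt_neqAle (heat_ge0 h0 mp ple ip) andbT; apply/eqP => E.
have := nint_heat_kernel h0 mp ple ip y; rewrite -E nintE => H.
have : (\int[leb d]_x `|(p x * g (y - x))%:E| = 0)%E.
  rewrite -[RHS]H; apply: eq_integral => x _.
  by rewrite gee0_abs// lee_fin mulr_ge0 ?gauss_ge0.
have mf : measurable_fun setT (fun x => (p x * g (y - x))%:E) by meas.
move/(ae_eq_integral_abs _ measurableT mf) => ae0.
have : (leb d).-negligible [set: V].
  apply: negligibleS ae0 => x _ /= /(_ I) /eqP.
  by rewrite eqe gt_eqF// mulr_gt0 ?gauss_gt0.
move/negligibleP => /(_ measurableT) muT0.
have := ip; rewrite nintE.
rewrite null_set_integral//; last by meas.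
by move=> /eqP; rewrite eqe eq_sym oner_eq0.
Qed.

Local Notation J := (midpoint h b q).

(** Forgetting the midpoint cannot increase the chi-square functional: Cauchy-Schwarz in [y] with
    weight p(z) g(z-y), whose integral over [y] is p(z). *)
Lemma drift_step_lift :
  (nint (fun z => (drift_step h b q z ^+ 2 / p z)%R) <=
   \int[leb d]_y nint (fun z => (J y z ^+ 2 / (p z * g (z - y)))%R))%E.
Proof.
have w0 y z : 0 < p z * g (z - y) by rewrite mulr_gt0 ?gauss_gt0.
have mW : measurable_fun setT (fun w : V * V => J w.1 w.2 ^+ 2 / (p w.2 * g (w.2 - w.1))).
  by meas => w; exact: ltW.
have W0 y z : 0 <= J y z ^+ 2 / (p z * g (z - y)) by rewrite divr_ge0 ?sqr_ge0 ?(ltW (w0 _ _)).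
rewrite nint_tonelli// nintE; apply: ge0_le_integral => //=.
- by move=> z _; rewrite lee_fin divr_ge0 ?sqr_ge0.
- have ? := measurable_drift_step h mq q0 mb; meas.
- have msw : measurable_fun setT (fun z : V * V => (z.2, z.1)) by meas.
  exact: (@measurable_nint _ _ _ _ (fun z y : V => J y z ^+ 2 / (p z * g (z - y)))
    (measurableT_comp mW msw) (fun z y => W0 y z)).
move=> z _; apply: (@nint_cs _ _ (J^~ z) (fun y => p z * g (z - y)) (p z)).
- exact: (measurableT_comp mJ (pair2_measurable z)).
- by meas.
- by move=> y; exact: J0.
- by move=> y; exact: w0.
- exact: p0.
- have E y : p z * g (z - y) = p z * g (y - z) by rewrite -gaussN opprB.
  rewrite (eq_nint E) nintZ ?nint_gaussB ?mule1//; first by meas.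
  by move=> x; exact: gauss_ge0.
- exact: (nint_midpoint h0 mq q0 iq mb z).
Qed.

(** One plus a chi-square divergence, averaged over the midpoint [y]: that of N(y + h b(x), h) from
    the law proportional to p(z) g(z-y), whose normalising constant is [heat h p y]. *)
Definition kernel_excess (x : V) : \bar R :=
  (\int[leb d]_y ((g (y - x))%:E * ((heat h p y)%:E *
     nint (fun z => (g (z - y - h *: b x) ^+ 2 / (p z * g (z - y)))%R))))%E.

Lemma kernel_excess_ge0 x : (0 <= kernel_excess x)%E.
Proof.
apply: integral_ge0 => y _; apply: mule_ge0; first by rewrite lee_fin; exact: gauss_ge0.
apply: mule_ge0; first by rewrite lee_fin; exact/ltW/heat_gt0.
apply: nint_ge0 => z.
exact: (divr_ge0 (sqr_ge0 _) (mulr_ge0 (ple z) (gauss_ge0 _ _))).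
Qed.

Lemma measurable_kernel_excess : measurable_fun setT kernel_excess.
Proof.
have mhp : measurable_fun setT (heat h p) by exact: measurable_heat.
have mX : measurable_fun setT (fun w : V * V => nint (fun z =>
   g (z - w.2 - h *: b w.1) ^+ 2 / (p z * g (z - w.2)))).
  apply: (@measurable_nint _ _ _ (V * V)%type (fun (w : V * V) (z : V) =>
   g (z - w.2 - h *: b w.1) ^+ 2 / (p z * g (z - w.2)))).
    by meas => w; exact: (mulr_ge0 (ple w.2) (gauss_ge0 _ _)).
  by move=> w z; exact: (divr_ge0 (sqr_ge0 _) (mulr_ge0 (ple z) (gauss_ge0 _ _))).
pose E (w : V * V) : \bar R := ((g (w.2 - w.1))%:E * ((heat h p w.2)%:E *
     nint (fun z => (g (z - w.2 - h *: b w.1) ^+ 2 / (p z * g (z - w.2)))%R)))%E.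
have mE : measurable_fun setT E.
  apply: emeasurable_funM; first by meas.
  by apply: emeasurable_funM; [meas|exact: mX].
apply: (@measurable_fun_fubini_tonelli_F _ _ _ _ _ (leb d) E mE) => w.
apply: mule_ge0; first by rewrite lee_fin; exact: gauss_ge0.
apply: mule_ge0; first by rewrite lee_fin; exact/ltW/heat_gt0.
apply: nint_ge0 => z.
exact: (divr_ge0 (sqr_ge0 _) (mulr_ge0 (ple z) (gauss_ge0 _ _))).
Qed.

(* The step goes through the midpoint y; the joint law of (y, z) is compared
   with p(z) g(z - y), whose conditional law given y is the reference. *)
Lemma drift_step_chi2 :
  (nint (fun z => (drift_step h b q z ^+ 2 / p z)%R) + Iq%:E <=
   nint (fun y => (heat h q y ^+ 2 / heat h p y)%R) +
   \int[leb d]_x ((q x ^+ 2 / p x)%:E * kernel_excess x))%E.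
Proof.
pose q2 x := q x ^+ 2 / p x.
have q20 x : 0 <= q2 x by rewrite divr_ge0 ?sqr_ge0.
have mq2 : measurable_fun setT q2 by rewrite /q2; meas.
have iS y : nint (fun x => q2 x * g (y - x)) = (heat h q2 y)%:E.
  exact: (nint_heat_kernel h0 mq2 q20 iI).
have w0 y z : 0 < p z * g (z - y) by rewrite mulr_gt0 ?gauss_gt0.
have mX : measurable_fun setT (fun w : (V * V) * V =>
   g (w.2 - w.1.2 - h *: b w.1.1) ^+ 2 / (p w.2 * g (w.2 - w.1.2))).
  by meas => w; exact: ltW.
have mX2 : measurable_fun setT (fun w : V * V => nint (fun z =>
   g (z - w.2 - h *: b w.1) ^+ 2 / (p z * g (z - w.2)))).
  apply: (@measurable_nint _ _ _ (V * V)%type (fun (w : V * V) (z : V) =>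
   g (z - w.2 - h *: b w.1) ^+ 2 / (p z * g (z - w.2)))) => // w z.
  by rewrite divr_ge0 ?sqr_ge0 ?(ltW (w0 _ _)).
have X0 x y : (0 <= nint (fun z => (g (z - y - h *: b x) ^+ 2 / (p z * g (z - y)))%R))%E.
  by apply: nint_ge0 => z; rewrite divr_ge0 ?sqr_ge0 ?(ltW (w0 _ _)).
have mhp : measurable_fun setT (heat h p) by exact: measurable_heat.
have mihp : measurable_fun setT (fun y => (heat h p y)^-1).
  by apply: measurable_inv => // y; exact/ltW/heat_gt0.
have mhq : measurable_fun setT (heat h q) by exact: measurable_heat.
have mhq2 : measurable_fun setT (heat h q2) by exact: measurable_heat.
pose E (w : V * V) : \bar R := ((q2 w.1 * g (w.2 - w.1))%:E * ((heat h p w.2)%:E *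
     nint (fun z => (g (z - w.2 - h *: b w.1) ^+ 2 / (p z * g (z - w.2)))%R)))%E.
have mE : measurable_fun setT E.
  apply: emeasurable_funM; first by meas.
  apply: emeasurable_funM.
    by meas.
  exact: mX2.
have E0 w : (0 <= E w)%E.
  apply: mule_ge0; first by rewrite lee_fin mulr_ge0 ?gauss_ge0.
  by apply: mule_ge0; [rewrite lee_fin; exact/ltW/heat_gt0 | exact: X0].
have -> : (\int[leb d]_x ((q x ^+ 2 / p x)%:E * kernel_excess x) =
           \int[leb d]_y \int[leb d]_x E (x, y))%E.
  rewrite -(@fubini_tonelli _ _ _ _ _ (leb d) (leb d) E)//.
  apply: eq_integral => x _; rewrite /kernel_excess.
  have mK : measurable_fun setT (fun y : V => ((g (y - x))%:E * ((heat h p y)%:E *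
     nint (fun z => (g (z - y - h *: b x) ^+ 2 / (p z * g (z - y)))%R)))%E).
    apply: emeasurable_funM; first by meas.
    apply: emeasurable_funM; first by meas.
    exact: (measurableT_comp mX2 (pair1_measurable x)).
  rewrite -(ge0_integralZl (leb d) measurableT mK).
  - by apply: eq_integral => y _; rewrite /E /q2 muleA -EFinM.
  - move=> y _; apply: mule_ge0; first by rewrite lee_fin gauss_ge0.
    by apply: mule_ge0; [rewrite lee_fin; exact/ltW/heat_gt0 | exact: X0].
  - by rewrite lee_fin; exact: q20.
have iq2 : nint q2 = Iq%:E by exact: iI.
rewrite -(nint_heat h0 mq2 q20 iq2) [X in (_ <= X + _)%E]nintE -[leRHS]ge0_integralD; last 5 first.
- exact: measurableT.
- by move=> y _; rewrite lee_fin divr_ge0 ?sqr_ge0// (ltW (heat_gt0 _)).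
- by meas.
- by move=> y _; apply: integral_ge0.
- exact: (@measurable_fun_fubini_tonelli_G _ _ _ _ _ (leb d) E mE E0).
have mJJ : measurable_fun setT (fun y => nint (fun z => J y z ^+ 2 / (p z * g (z - y)))).
  apply: (@measurable_nint _ _ _ _ (fun y z : V => J y z ^+ 2 / (p z * g (z - y)))).
    by meas => w; exact/ltW/w0.
  by move=> y z; rewrite divr_ge0 ?sqr_ge0 ?(ltW (w0 _ _)).
have JJ0 y : (0 <= nint (fun z => (J y z ^+ 2 / (p z * g (z - y)))%R))%E.
  by apply: nint_ge0 => z; rewrite divr_ge0 ?sqr_ge0 ?(ltW (w0 _ _)).
apply: (@le_trans _ _ (\int[leb d]_y nint (fun z => (J y z ^+ 2 / (p z * g (z - y)))%R) +
   nint (heat h q2))%E).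
  by apply: leeD2r; exact: drift_step_lift.
have hq20 y : 0 <= heat h q2 y by exact: (heat_ge0 h0 mq2 q20 iq2).
rewrite [X in (_ + X <= _)%E]nintE -[leLHS]ge0_integralD; last 5 first.
- exact: measurableT.
- by move=> y _; exact: JJ0.
- exact: mJJ.
- by move=> y _; rewrite lee_fin; exact: hq20.
- by meas.
apply: ge0_le_integral.
- exact: measurableT.
- by move=> y _; apply: adde_ge0; [exact: JJ0|rewrite lee_fin; exact: hq20].
- by apply: emeasurable_funD; [exact: mJJ|meas].
- apply: emeasurable_funD; first by meas.
  exact: (@measurable_fun_fubini_tonelli_G _ _ _ _ _ (leb d) E mE E0).
move=> y _.
(* For fixed [y], [kernel_chi2] is applied to q g and p g. Its m^2/P is the heat-flow integrand
   (heat q)^2 / heat p, and its [S] is the heat flow of q^2/p, which integrates over [y] to [Iq]. *)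
have uv x : (q x * g (y - x)) ^+ 2 / (p x * g (y - x)) = q2 x * g (y - x).
  by rewrite /q2; field; rewrite !gt_eqF ?gauss_gt0.
have := @kernel_chi2 _ _ (fun x => q x * g (y - x)) (fun x => p x * g (y - x))
  (fun z => p z * g (z - y)) (fun x z => g (z - y - h *: b x)) (J y)
  (heat h p y) (heat h q y) (heat h q2 y).
under eq_integral do rewrite uv.
apply.
- by meas.
- by meas.
- by meas.
- by meas.
- exact: (measurableT_comp mJ (pair1_measurable y)).
- by move=> x; rewrite mulr_ge0 ?gauss_ge0.
- by move=> x; rewrite mulr_gt0 ?gauss_gt0.
- by move=> z; exact: w0.
- by move=> x z; exact: gauss_ge0.
- exact: heat_gt0.
- exact: (nint_heat_kernel h0 mp ple ip).
- rewrite -(nint_heat_kernel h0 mp ple ip); apply: eq_nint => x.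
  by rewrite -gaussN opprB.
- exact: (nint_heat_kernel h0 mq q0 iq).
- by rewrite (eq_nint uv).
- move=> x; have EE z : g (z - y - h *: b x) = g (z - (y + h *: b x)) by rewrite opprD addrA.
  by rewrite (eq_nint EE) nint_gaussB.
- move=> z; rewrite -(nint_midpoint_kernel h0 mq q0 iq mb); apply: eq_nint => x; by rewrite mulrA.
Qed.
End Lift.

(** * Signed integrals and Gaussian moments *)

Section SignedIntegral.
Context {R : realType} {d : nat}.
Implicit Types (f k : 'rV[R]_d -> R).

Definition intg f := (leb d).-integrable setT (EFin \o f).
Definition rint f : R := Rintegral (leb d) setT f.

Lemma intgW f : measurable_fun setT f -> (forall x, 0 <= f x) -> (nint f < +oo)%E ->
  intg f.
Proof.
move=> mf f0; rewrite nintE => foo; apply/integrableP; split; first exact/measurable_EFinP.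
rewrite (eq_integral (fun x => (f x)%:E))// => x _ /=.
by rewrite ger0_norm.
Qed.

Lemma intg_le f k : measurable_fun setT f -> (forall x, `|f x| <= k x) -> intg k -> intg f.
Proof.
move=> mf fk; apply: le_integrable => //; first exact/measurable_EFinP.
by move=> x _ /=; rewrite lee_fin (le_trans (fk x))// ler_norm.
Qed.

Lemma intgD f k : intg f -> intg k -> intg (fun x => f x + k x).
Proof. by move=> If Ik; exact: (integrableD _ If Ik). Qed.

Lemma intgZ (a : R) f : intg f -> intg (fun x => a * f x).
Proof. by move=> If; exact: (integrableZl _ a If). Qed.

Lemma rintD f k : intg f -> intg k -> rint (fun x => f x + k x) = rint f + rint k.
Proof. by move=> If Ik; exact: RintegralD. Qed.

Lemma rintZ (a : R) f : intg f -> rint (fun x => a * f x) = a * rint f.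
Proof. by move=> If; exact: RintegralZl. Qed.

Lemma rint_le f k : intg f -> intg k -> (forall x, f x <= k x) -> rint f <= rint k.
Proof. by move=> If Ik fk; exact: le_Rintegral. Qed.

Lemma rint_nint f (r : R) : nint f = r%:E -> rint f = r.
Proof. by rewrite nintE /rint /Rintegral => ->. Qed.

Lemma eq_rint f k : f =1 k -> rint f = rint k.
Proof. by move=> /funext ->. Qed.

Lemma eq_intg f k : f =1 k -> intg f -> intg k.
Proof. by move=> /funext ->. Qed.

Lemma intg_sum (I : Type) (s : seq I) (F : I -> 'rV[R]_d -> R) :
  (forall i, intg (F i)) -> intg (fun x => \sum_(i <- s) F i x).
Proof.
move=> IF; elim: s => [|i s IH].
  by apply: (eq_intg (f := cst 0)) => [x|]; [rewrite big_nil|exact: integrable0].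
by apply: eq_intg (intgD (IF i) IH) => x; rewrite big_cons.
Qed.

Lemma rint_sum (I : Type) (s : seq I) (F : I -> 'rV[R]_d -> R) :
  (forall i, intg (F i)) -> rint (fun x => \sum_(i <- s) F i x) = \sum_(i <- s) rint (F i).
Proof.
move=> IF; elim: s => [|i s IH].
  rewrite big_nil; apply: rint_nint; rewrite nintE.
  by under eq_integral do rewrite big_nil; rewrite integral0.
rewrite big_cons -IH -rintD//; last exact: intg_sum.
by apply: eq_rint => x; rewrite big_cons.
Qed.

Lemma rint_abs f k : intg f -> intg k -> (forall x, `|f x| <= k x) -> `|rint f| <= rint k.
Proof.
move=> If Ik fk; rewrite ler_norml; apply/andP; split.
  rewrite -mulN1r -rintZ//; apply: rint_le => //; first exact: intgZ.
  by move=> x; rewrite mulN1r; have := fk x; rewrite ler_norml => /andP[].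
by apply: rint_le => // x; rewrite (le_trans (ler_norm _)).
Qed.
End SignedIntegral.

Section GaussMoments.
Context {R : realType} {d : nat}.
Variables (h : R) (h0 : 0 < h).
Local Notation V := 'rV[R]_d.
Local Notation g := (gauss h).
Implicit Types (w z : V).

Lemma le_abs_cosh (a : R) : `|a| <= expR a + expR (- a).
Proof.
have := expR_ge1Dx a; have := expR_ge1Dx (- a).
have := expR_ge0 a; have := expR_ge0 (- a).
by rewrite ler_norml => *; lra.
Qed.

(** Polynomial moments are dominated by exponential ones, which have a closed form. For t >= 0, 4
    exp(t) >= 4 (1 + t/2)^2 >= t^2. *)
Lemma sqr_le_cosh (a : R) : a ^+ 2 <= 4 * (expR a + expR (- a)).
Proof.
have H (t : R) : 0 <= t -> t ^+ 2 <= 4 * expR t.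
  move=> t0; have -> : t = t / 2 + t / 2 by field.
  have := expR_ge1Dx (t / 2); rewrite expRD; nra.
have e1 := expR_ge0 a; have e2 := expR_ge0 (- a).
have [a0|a0] := leP 0 a; first by have := H _ a0; lra.
by have := H (- a); rewrite sqrrN; lra.
Qed.

Lemma nint_gauss_expdot w :
  nint (fun z => g z * expR (dot w z / h)) = (expR (sqn w / (2 * h)))%:E.
Proof.
have E z : g z * expR (dot w z / h) =
   g z * expR (dot (h^-1 *: w) z + 0 * sqn z / (2 * h)).
  by rewrite !mul0r addr0 dotZl mulrC (mulrC (dot w z)) mulrC.
rewrite (eq_nint E) nint_gauss_exp ?ltr01// subr0 sqrtr1 expr1n invr1 mul1r sqnZ.
by congr (expR _)%:E; field; rewrite gt_eqF.
Qed.

Lemma intg_gauss_exp w : intg (fun z => g z * expR (dot w z / h)).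
Proof.
apply: intgW; first by meas.
  by move=> z; rewrite mulr_ge0 ?gauss_ge0 ?expR_ge0.
by rewrite nint_gauss_expdot ltry.
Qed.

Lemma intg_gauss : intg (fun z : V => g z).
Proof.
apply: intgW; first by meas.
  by move=> z; rewrite gauss_ge0.
by rewrite nint_gauss ?ltry.
Qed.

Lemma rint_gauss : rint (fun z : V => g z) = 1.
Proof. by apply: rint_nint; rewrite nint_gauss. Qed.

Section Bounded.
Variables (phi : V -> R) (n : R).
Hypotheses (mphi : measurable_fun setT phi) (bphi : forall z, `|phi z| <= n).

Let n0 : 0 <= n. Proof. exact: le_trans (normr_ge0 _) (bphi 0). Qed.

Lemma intg_bounded : intg (fun z => phi z * g z).
Proof.
apply: (@intg_le _ _ _ (fun z => n * g z)); first by meas.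
  by move=> z; rewrite normrM (ger0_norm (gauss_ge0 _ _)) ler_wpM2r ?gauss_ge0.
exact/intgZ/intg_gauss.
Qed.

Lemma intg_bounded_exp w : intg (fun z => phi z * (g z * expR (dot w z / h))).
Proof.
apply: (@intg_le _ _ _ (fun z => n * (g z * expR (dot w z / h)))); first by meas.
  move=> z; have gz0 : 0 <= g z * expR (dot w z / h) by rewrite mulr_ge0 ?gauss_ge0 ?expR_ge0.
  by rewrite normrM (ger0_norm gz0) ler_wpM2r.
exact/intgZ/intg_gauss_exp.
Qed.

Lemma intg_bounded_dot w : intg (fun z => phi z * (g z * (dot w z / h))).
Proof.
apply: (@intg_le _ _ _ (fun z => n * (g z * expR (dot w z / h)) +
                               n * (g z * expR (dot (- w) z / h)))); first by meas.
  move=> z; rewrite -mulrDr -mulrDr normrM ler_pM// normrM (ger0_norm (gauss_ge0 _ _)).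
  by rewrite ler_wpM2l ?gauss_ge0// dotNl mulNr le_abs_cosh.
by apply: intgD; exact/intgZ/intg_gauss_exp.
Qed.
End Bounded.

Lemma intg_dot w : intg (fun z => g z * (dot w z / h)).
Proof.
apply: eq_intg (@intg_bounded_dot (cst 1) 1 _ _ w) => [z||z].
- by rewrite mul1r.
- exact: measurable_cst.
- by rewrite normr1.
Qed.

Lemma rint_gauss_exp w : rint (fun z => g z * expR (dot w z / h)) = expR (sqn w / (2 * h)).
Proof. by apply: rint_nint; rewrite nint_gauss_expdot. Qed.

(** With a = <w,z>/h, the inequality a <= exp(a - c) + c - 1 is integrated; the choice of c makes
    exp(a - c) have mean 1. *)
Let mean_le w : rint (fun z => g z * (dot w z / h)) <= sqn w / (2 * h).
Proof.
set c := sqn w / (2 * h).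
have I1 := intgZ (expR (- c)) (intg_gauss_exp w).
have I2 := intgZ (c - 1) intg_gauss.
apply: (@le_trans _ _ (rint (fun z => expR (- c) * (g z * expR (dot w z / h)) +
   (c - 1) * g z))).
  apply: rint_le => [||z]; [exact: intg_dot|exact: intgD|].
  have -> : expR (- c) * (g z * expR (dot w z / h)) + (c - 1) * g z =
    g z * (expR (- c) * expR (dot w z / h) + (c - 1)) by ring.
  rewrite -expRD ler_wpM2l ?gauss_ge0//.
  by have := expR_ge1Dx (- c + dot w z / h); lra.
rewrite (rintD I1 I2) (rintZ _ (intg_gauss_exp w)) (rintZ _ intg_gauss).
by rewrite rint_gauss_exp rint_gauss -/c -expRD addNr expR0; lra.
Qed.

(** The mean is linear in [w] but, by [mean_le], bounded above by a quadratic function of [w].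
    Scaling [w] towards 0 forces it to be nonpositive, and replacing [w] by its opposite gives
    equality. *)
Lemma gauss_mean w : rint (fun z => g z * (dot w z / h)) = 0.
Proof.
have scal (t : R) w' : rint (fun z => g z * (dot (t *: w') z / h)) =
    t * rint (fun z => g z * (dot w' z / h)).
  rewrite -rintZ; last exact: intg_dot.
  by apply: eq_rint => z; rewrite dotZl; ring.
have le0 w' : rint (fun z => g z * (dot w' z / h)) <= 0.
  set X := rint _; have [//|X0] := leP X 0.
  pose c := sqn w' / (2 * h).
  have c0 : 0 <= c by rewrite divr_ge0 ?sqn_ge0// mulr_ge0// ltW.
  pose t := X / (2 * (c + 1)).
  have t0 : 0 < t by rewrite divr_gt0// mulr_gt0// ltr_wpDl.
  have := mean_le (t *: w'); rewrite scal -/X sqnZ -mulrA -/c.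
  rewrite expr2 -mulrA ler_pM2l//.
  have : t * (2 * (c + 1)) = X by rewrite /t divfK// gt_eqF// mulr_gt0// ltr_wpDl.
  nra.
apply/eqP; rewrite eq_le le0/=.
by have := le0 (-1 *: w); rewrite scal mulN1r oppr_le0.
Qed.

(** The exact value is sqn w / h; the constant 16 is the price of deducing the bound from
    exponential moments alone. *)
Lemma gauss_second_moment w :
  (nint (fun z => (g z * (dot w z / h) ^+ 2)%R) <= (16 * sqn w / h)%:E)%E.
Proof.
have [w0|w0] := eqVneq (sqn w) 0.
  (* The scale [l] used below would not exist here. Young's inequality with an arbitrarily small
     weight on [sqn z] forces [dot w z = 0]. *)
  have E z : g z * (dot w z / h) ^+ 2 = 0.
    have [t0 t1] : 2 * dot w z <= 0 /\ 0 <= 2 * dot w z.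
      have H (e : R) w' : sqn w' = 0 -> 0 < e -> 2 * dot w' z <= e * sqn z.
        move=> w'0 e0; have := @dot_young _ _ (e^-1) w' z.
        by rewrite invr_gt0 w'0 mulr0 add0r invrK; apply.
      have H2 w' : sqn w' = 0 -> 2 * dot w' z <= 0.
        move=> w'0; have [//|X0] := leP (2 * dot w' z) 0.
        have s0 := sqn_ge0 z.
        have e0 : 0 < 2 * dot w' z / (2 * (sqn z + 1)).
          by rewrite divr_gt0// mulr_gt0// ltr_wpDl.
        have := H _ _ w'0 e0.
        have : 2 * dot w' z / (2 * (sqn z + 1)) * (2 * (sqn z + 1)) = 2 * dot w' z.
          by rewrite divfK// gt_eqF// mulr_gt0// ltr_wpDl.
        by move: (_ / _) e0 => e; nra.
      split; first exact: H2.
      by have := H2 (- w); rewrite sqnN dotNl mulrN oppr_le0; apply.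
    have -> : dot w z = 0 by lra.
    by rewrite mul0r expr0n/= mulr0.
  rewrite (eq_nint E) nintE integral0 w0 mulr0 mul0r//.
have {}w0 : 0 < sqn w by rewrite lt_neqAle eq_sym w0 sqn_ge0.
(* At this scale both exponential moments equal exp(1/2) <= 2, and (4 / l^2) (2 + 2) = 16 sqn w /
   h. *)
pose l := Num.sqrt (h / sqn w).
have l2 : l ^+ 2 = h / sqn w by rewrite sqr_sqrtr// divr_ge0 ?sqn_ge0// ltW.
have l20 : 0 < l ^+ 2 by rewrite l2 divr_gt0.
have key z : g z * (dot w z / h) ^+ 2 <= 4 / l ^+ 2 *
    (g z * expR (dot (l *: w) z / h) + g z * expR (dot (- (l *: w)) z / h)).
  rewrite [leRHS](_ : _ = g z * (4 / l ^+ 2 *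
    (expR (dot (l *: w) z / h) + expR (dot (- (l *: w)) z / h)))); last by ring.
  rewrite ler_wpM2l ?gauss_ge0// mulrAC ler_pdivlMr// mulrC -exprMn.
  by have := sqr_le_cosh (l * (dot w z / h)); rewrite dotNl dotZl mulNr mulrA.
have k0 : 0 <= 4 / l ^+ 2 by rewrite divr_ge0// ltW.
have p1 w' z : 0 <= g z * expR (dot w' z / h) by rewrite mulr_ge0 ?gauss_ge0 ?expR_ge0.
apply: (@le_trans _ _ (nint (fun z => 4 / l ^+ 2 *
    (g z * expR (dot (l *: w) z / h) + g z * expR (dot (- (l *: w)) z / h)))%R)).
  apply: le_nint => //; [by meas|by meas|].
  by move=> z; rewrite mulr_ge0 ?gauss_ge0 ?sqr_ge0.
rewrite nintZ//; [|by meas|by move=> z; rewrite addr_ge0].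
rewrite nintD//; [|by meas|by meas].
rewrite !nint_gauss_expdot sqnN sqnZ l2 -EFinD -EFinM lee_fin.
have -> : h / sqn w * sqn w / (2 * h) = 2^-1 by field; rewrite !gt_eqF.
have e2 : expR (2^-1 : R) <= 2.
  have := expR_ge1Dx (- 2^-1 : R); rewrite expRN => H.
  have e0 := expR_gt0 (2^-1 : R).
  rewrite -[leLHS]invrK -[leRHS]invrK lef_pV2 ?posrE ?invr_gt0//; lra.
rewrite (_ : 4 / _ = 4 * sqn w / h); last by field; rewrite !gt_eqF.
have : 0 < 4 * sqn w / h by rewrite divr_gt0// mulr_gt0.
rewrite (_ : 16 * sqn w / h = 4 * sqn w / h * 4); last by ring.
by move=> H; rewrite ler_pM2l//; lra.
Qed.
End GaussMoments.

(** * Gradients, descent lemma and Gaussian smoothing *)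

Section Calculus.
Context {R : realType} {d : nat}.
Local Notation V := 'rV[R]_d.
Implicit Types (G : V -> R) (x v w : V).

(** The codomain [R^o] lets the map be declared linear into a normed module, as differentials
    require. *)
Definition dotl v : V -> R^o := dot v.

Lemma dotl_linear v : linear (dotl v).
Proof. by move=> a x y; rewrite /dotl dotDr dotZr. Qed.

HB.instance Definition _ v := GRing.isLinear.Build R V R^o _ (dotl v) (dotl_linear v).

Lemma coord_le_norm v i : `|v ord0 i| <= `|v|.
Proof.
rewrite [leRHS]/Num.Def.normr /= mx_normrE.
by apply/bigmax_geP; right => /=; exists (ord0, i).
Qed.

Lemma sqn_le_norm v : sqn v <= d%:R * `|v| ^+ 2.
Proof.
have -> : sqn v = \sum_(i < d) v ord0 i * v ord0 i by [].
rewrite mulr_natl -[X in _ *+ X]card_ord -sumr_const; apply: ler_sum => i _.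
by rewrite -expr2 -real_normK ?num_real// ler_sqr ?nnegrE// coord_le_norm.
Qed.

Lemma dot_le_norm v w : `|dot v w| <= (\sum_i `|v ord0 i|) * `|w|.
Proof.
have -> : dot v w = \sum_(i < d) v ord0 i * w ord0 i by [].
rewrite mulr_suml (le_trans (ler_norm_sum _ _ _))//; apply: ler_sum => i _.
by rewrite normrM ler_wpM2l// coord_le_norm.
Qed.

Lemma dotl_continuous v : continuous (dotl v).
Proof.
move=> x; apply/(@cvg_ballP R R^o V (nbhs x) (nbhs_filter x)) => e e0.
pose S := \sum_i `|v ord0 i|.
have S0 : 0 <= S by apply: sumr_ge0.
apply/nbhs_ballP; exists (e / (S + 1)) => /=; first by rewrite divr_gt0// ltr_wpDl.
move=> y; rewrite -!ball_normE /= => xy; rewrite -linearB.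
apply: (le_lt_trans (dot_le_norm _ _)); rewrite -/S.
apply: (@le_lt_trans _ _ ((S + 1) * `|x - y|)); first by rewrite ler_wpM2r// lerDl.
by rewrite mulrC -ltr_pdivlMr// ltr_wpDl.
Qed.

Section QuadraticRemainder.
Variables (G : V -> R) (v : V -> V) (M : R).
Hypotheses (M0 : 0 <= M)
  (rem : forall x w, `|G (x + w) - G x - dot (v x) w| <= M * sqn w).

(** A quadratic remainder, uniform in the base point, already identifies the differential. This
    section thus replaces differentiation under the integral sign by one inequality. *)
Lemma quad_diff x : (G : V -> R^o) \o shift x = cst (G x : R^o) + dotl (v x) +o_ (0 : V) id.
Proof.
apply/eqaddoP => e e0.
pose K := M * d%:R + 1.
have K0 : 0 < K by rewrite ltr_wpDl// mulr_ge0.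
near=> w.
have we : `|w| <= e / K.
  near: w; apply/nbhs_ballP; exists (e / K) => /=; first by rewrite divr_gt0.
  by move=> w; rewrite -ball_normE /= sub0r normrN => /ltW.
rewrite -[X in `|X|]/(G (w + x) - (G x + dot (v x) w)) (addrC w) opprD addrA.
apply: (le_trans (rem _ _)); apply: (@le_trans _ _ (K * `|w| * `|w|)).
  apply: (@le_trans _ _ (M * (d%:R * `|w| ^+ 2))); first by rewrite ler_wpM2l ?sqn_le_norm.
  by rewrite mulrA expr2 mulrA !ler_wpM2r// lerDl.
by rewrite ler_wpM2r// mulrC -ler_pdivlMr.
Unshelve. all: by end_near. Qed.

Lemma quad_d x : 'd (G : V -> R^o) x = dotl (v x) :> (V -> R^o).
Proof. by apply: diff_unique; [exact: dotl_continuous|exact: quad_diff]. Qed.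

Lemma quad_differentiable x : differentiable (G : V -> R^o) x.
Proof.
apply/diff_locallyP; rewrite quad_d; split; first exact: dotl_continuous.
exact: quad_diff.
Qed.

Lemma quad_grad x : grad G x = v x.
Proof.
apply/rowP => i; rewrite mxE deriveE; last exact: quad_differentiable.
by rewrite quad_d; exact: dot_delta.
Qed.

(** Three expansions are compared: at x + w along u, at x along w + u, and at x along w. Their
    remainders add up to M (3 sqn u + 3 sqn w), as sqn (w + u) <= 2 sqn w + 2 sqn u. *)
Lemma quad_lip x w u : `|dot (v (x + w)) u - dot (v x) u| <= 3 * M * (sqn u + sqn w).
Proof.
have r1 := rem (x + w) u; have r2 := rem x (w + u); have r3 := rem x w.
have s1 := sqnD_le w u.
rewrite addrA dotDr in r2; move: r1 r2 r3 s1.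
have := sqn_ge0 u; have := sqn_ge0 w.
set a := G (x + w + u); set b := G (x + w); set c := G x.
set A := dot (v (x + w)) u; set B := dot (v x) u; set C := dot (v x) w.
set U := sqn u; set W := sqn w; set Z := sqn (w + u).
move=> W0 U0 r1 r2 r3 ZUW.
have MZ : M * Z <= 2 * M * W + 2 * M * U.
  by have := ler_wpM2l M0 ZUW; lra.
have MU : 0 <= M * U by rewrite mulr_ge0.
have MW : 0 <= M * W by rewrite mulr_ge0.
move: r1 r2 r3; rewrite !ler_norml => /andP[? ?] /andP[? ?] /andP[? ?].
by apply/andP; split; nra.
Qed.

Lemma quad_C1 : C1 G.
Proof.
split; first exact: quad_differentiable.
rewrite (_ : grad G = v); last by apply/funext => x; exact: quad_grad.
move=> x; apply/(@cvg_ballP R V V (nbhs x) (nbhs_filter x)) => e e0.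
pose K := 3 * M + 1.
have K0 : 0 < K by rewrite ltr_wpDl// mulr_ge0.
(* [quad_lip] with u = t e_j and sqn w <= t^2 bounds t times the change of the j-th coordinate by 2
   K t^2, so the change is at most e/2. The factor [D] below converts the sup norm to the Euclidean
   one. *)
pose t := e / (4 * K).
have t0 : 0 < t by rewrite divr_gt0// mulr_gt0.
pose D := d%:R + 1 : R.
have D1 : 1 <= D by rewrite lerDr.
have D0 : 0 < D by rewrite (lt_le_trans ltr01).
apply/nbhs_ballP; exists (t / D) => /=; first by rewrite divr_gt0.
move=> y xyb; have xy : `|x - y| < t / D by move: xyb; rewrite -ball_normE.
split=> // i j; rewrite ord1.
rewrite /ball /= distrC.
have := quad_lip x (y - x) (t *: delta_mx ord0 j).
rewrite (addrC x) subrK !dotZr !dot_delta -mulrBr normrM (gtr0_norm t0) sqnZ.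
have -> : sqn (delta_mx ord0 j : V) = 1.
  by rewrite -[LHS]/(dot _ _) dot_delta mxE !eqxx.
rewrite mulr1.
have s1 : sqn (y - x) <= t ^+ 2.
  apply: (le_trans (sqn_le_norm _)); rewrite distrC.
  have xyt : `|x - y| * D <= t by rewrite -ler_pdivlMr// ltW.
  have xy0 := normr_ge0 (x - y).
  have : (`|x - y| * D) ^+ 2 <= t ^+ 2 by rewrite ler_sqr ?nnegrE ?(ltW t0)// mulr_ge0// (ltW D0).
  rewrite exprMn; apply: le_trans; rewrite mulrC ler_wpM2l ?sqr_ge0//.
  have dD : (d%:R : R) <= D by rewrite lerDl.
  by apply: (le_trans dD); rewrite expr2 ler_peMl// ltW.
set X := `|_ - _| => HX.
have : t * X <= t * (2 * K * t).
  apply: (le_trans HX); have : 0 <= t ^+ 2 by exact: sqr_ge0.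
  by have := ler_wpM2l M0 s1; rewrite /K; nra.
rewrite ler_pM2l// => /le_lt_trans; apply.
have -> : 2 * K * t = e / 2 by rewrite /t; field; rewrite gt_eqF.
lra.
Qed.
End QuadraticRemainder.

Section Descent.
Variables (U : V -> R) (L : R).
Hypotheses (C1U : C1 U) (L0 : 0 < L) (LipU : lipschitz_e L (grad U)).

Lemma derive_dot x v : 'D_v U x = dot (grad U x) v.
Proof.
have dU := C1U.1 x; rewrite deriveE//.
rewrite {1}[v]row_sum_delta linear_sum.
have -> : dot (grad U x) v = \sum_(i < d) grad U x ord0 i * v ord0 i by [].
by apply: eq_bigr => i _; rewrite linearZ mxE deriveE// mulrC.
Qed.

Lemma sqn_lip x y : sqn (grad U x - grad U y) <= L ^+ 2 * sqn (x - y).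
Proof.
rewrite -!enorm_sqr -exprMn ler_sqr ?nnegrE ?mulr_ge0 ?enorm_ge0 ?(ltW L0) ?LipU//.
Qed.

(** The mean value theorem along the segment, in place of an integral, gives the constant L where
    L/2 would be sharp. *)
Lemma descent x v : `|U (x + v) - U x - dot (grad U x) v| <= L * sqn v.
Proof.
pose phi (t : R) := U (x + t *: v).
have E t : (fun r : R => r^-1 *: ((phi \o shift t) (r *: 1) - phi t)) =
           (fun r : R => r^-1 *: ((U \o shift (x + t *: v)) (r *: v) - U (x + t *: v))).
  apply/funext => r; rewrite /phi /= (_ : r *: (1 : R) = r); last exact: mulr1.
  congr (_ *: (U _ - _)).
  by apply/rowP => i; rewrite !mxE; ring.
have dphi t : is_derive t (1 : R) phi (dot (grad U (x + t *: v)) v).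
  apply: DeriveDef.
    by rewrite /derivable E; have := diff_derivable (v := v) (C1U.1 (x + t *: v)).
  by rewrite -derive_dot /derive E.
have cphi : {within `[0, 1], continuous phi}.
  by apply: derivable_within_continuous => t _; case: (dphi t).
have [c] := @MVT R phi (fun t => dot (grad U (x + t *: v)) v) 0 1 ltr01
  (fun t _ => dphi t) cphi.
rewrite in_itv/= => /andP[c0 c1].
rewrite /phi scale1r scale0r addr0 subr0 mulr1 => ->.
rewrite -dotBl.
have lip : sqn (grad U (x + c *: v) - grad U x) <= L ^+ 2 * sqn v.
  apply: (le_trans (sqn_lip _ _)); rewrite addrAC subrr add0r sqnZ.
  rewrite ler_wpM2l ?sqr_ge0// ler_piMl ?sqn_ge0// expr_le1// ltW//.
have young w : sqn w <= L ^+ 2 * sqn v -> dot w v <= L * sqn v.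
  move=> wl; have Li : 0 < L^-1 by rewrite invr_gt0.
  have := @dot_young _ _ (L^-1) w v Li; rewrite invrK.
  have : L^-1 * sqn w <= L * sqn v.
    by rewrite mulrC ler_pdivrMr// -mulrA (mulrC (sqn v)) mulrA -expr2.
  have := sqn_ge0 v; lra.
rewrite ler_norml young// andbT lerNl -dotNl.
by apply: young; rewrite sqnN.
Qed.
End Descent.
End Calculus.

Section Smoothing.
Context {R : realType} {d : nat}.
Variables (h : R) (h0 : 0 < h).
Local Notation V := 'rV[R]_d.
Local Notation g := (gauss h).
Variables (psi : V -> R) (n : R).
Hypotheses (mpsi : measurable_fun setT psi) (psi0 : forall x, 0 <= psi x <= n).

Definition smooth (f : V -> R) (x : V) : R := fine (nint (fun z => f (x + z) * gauss h z)).

Let n0 : 0 <= n. Proof. by have /andP[/le_trans H /H] := psi0 0. Qed.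

Let phi (x z : V) : R := psi (x + z).
Let mphi x : measurable_fun setT (phi x).
Proof. by rewrite /phi; meas. Qed.

Let phi0 x z : 0 <= phi x z. Proof. by case/andP: (psi0 (x + z)). Qed.

Let bphi x z : `|phi x z| <= n.
Proof. by rewrite (ger0_norm (phi0 x z)); case/andP: (psi0 (x + z)). Qed.

Lemma nint_smooth (f : V -> R) (M : R) x : measurable_fun setT f ->
  (forall y, 0 <= f y <= M) ->
  nint (fun z => f (x + z) * g z) = (smooth f x)%:E /\ 0 <= smooth f x <= M.
Proof.
move=> mf f0.
have mfx : measurable_fun setT (fun z => f (x + z)) by meas.
have M0 : 0 <= M by have /andP[/le_trans H /H] := f0 0.
have f00 z : 0 <= f (x + z) by have /andP[] := f0 (x + z).
have fM z : f (x + z) <= M by have /andP[] := f0 (x + z).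
have fg0 z : 0 <= f (x + z) * g z by rewrite mulr_ge0 ?gauss_ge0.
have le1 : (nint (fun z => f (x + z) * g z)%R <= M%:E)%E.
  rewrite -[M%:E]mule1 -(@nint_gauss R d h h0) -nintZ//.
  - apply: le_nint => //; [by meas|by meas|move=> z].
    by rewrite ler_wpM2r ?gauss_ge0.
  - by meas.
  - by move=> z; rewrite gauss_ge0.
have [r rE /andP[r0 rM]] := nint_fin_le fg0 le1.
by rewrite /smooth rE /= r0 rM.
Qed.

Let G x := smooth psi x.

Let GE x : G x = rint (fun z => phi x z * g z).
Proof. by apply/esym/rint_nint; case: (nint_smooth x mpsi psi0). Qed.

(** Gaussian integration by parts: the derivative is put on the Gaussian, so [psi] need only be
    bounded and measurable. *)
Let v (x : V) : V := \row_i rint (fun z => phi x z * (g z * (dot (delta_mx ord0 i) z / h))).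

Let vE x w : dot (v x) w = rint (fun z => phi x z * (g z * (dot w z / h))).
Proof.
have -> : dot (v x) w = \sum_(i < d) v x ord0 i * w ord0 i by [].
transitivity (\sum_(i < d) rint (fun z => w ord0 i *
   (phi x z * (g z * (dot (delta_mx ord0 i) z / h))))).
  by apply: eq_bigr => i _; rewrite mxE rintZ 1?mulrC//; exact: (intg_bounded_dot h0 (mphi x) (bphi x)).
rewrite -rint_sum => [|i]; last exact/intgZ/(intg_bounded_dot h0 (mphi x) (bphi x)).
apply: eq_rint => z.
have -> : dot w z = \sum_(i < d) w ord0 i * dot (delta_mx ord0 i) z.
  rewrite [LHS](_ : _ = \sum_(i < d) w ord0 i * z ord0 i)//.
  by apply: eq_bigr => i _; rewrite dotC dot_delta.
rewrite mulr_suml !mulr_sumr; apply: eq_bigr => i _; ring.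
Qed.

Let c (w : V) : R := sqn w / (2 * h).

Let gauss_tilt w z : g (z - w) = expR (- c w) * (g z * expR (dot w z / h)).
Proof.
rewrite !gaussE mulrCA -!mulrA -!expRD; congr (_ * expR _).
by rewrite sqnB /c (dotC z); field; rewrite gt_eqF.
Qed.

Let G_shift x w : G (x + w) = rint (fun z => expR (- c w) * (phi x z * (g z * expR (dot w z / h)))).
Proof.
apply/esym/rint_nint; have [<- _] := nint_smooth (x + w) mpsi psi0.
refine (etrans _ (@nint_shift _ _ (fun z => psi (x + w + z) * g z) (- w) _ _)).
- apply: eq_nint => z; rewrite gauss_tilt /phi.
  have -> : x + w + (z - w) = x + z by apply/rowP => i; rewrite !mxE; ring.
  ring.
- by meas.
- by move=> z; rewrite mulr_ge0 ?gauss_ge0//; case/andP: (psi0 (x + w + z)).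
Qed.

(** Shifting by [w] tilts the Gaussian by exp(a - c), where a = <w,z>/h and c = [c w]. The quantity
    X = exp(a - c) - 1 - a is at least -c, so |X| <= X + 2c, and X has mean 0; the bound is n times
    2c. *)
Let rem x w : `|G (x + w) - G x - dot (v x) w| <= n / h * sqn w.
Proof.
have c0 : 0 <= c w by rewrite divr_ge0 ?sqn_ge0// mulr_ge0// ltW.
have I1 := intgZ (expR (- c w)) (intg_bounded_exp h0 (mphi x) (bphi x) w).
have I2 := intgZ (-1) (intg_bounded h0 (mphi x) (bphi x)).
have I3 := intgZ (-1) (intg_bounded_dot h0 (mphi x) (bphi x) w).
have J1 := intgZ (expR (- c w)) (intg_gauss_exp h0 w).
have J2 := intgZ (2 * c w - 1) (@intg_gauss _ d _ h0).
have J3 := intgZ (-1) (intg_dot h0 w).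
have -> : G (x + w) - G x - dot (v x) w = rint (fun z =>
    expR (- c w) * (phi x z * (g z * expR (dot w z / h))) + -1 * (phi x z * g z) +
    -1 * (phi x z * (g z * (dot w z / h)))).
  rewrite (rintD (intgD I1 I2) I3) (rintD I1 I2) -G_shift vE (GE x).
  rewrite (rintZ _ (intg_bounded h0 (mphi x) (bphi x))).
  rewrite (rintZ _ (intg_bounded_dot h0 (mphi x) (bphi x) w)); ring.
have -> : n / h * sqn w = rint (fun z => n * (expR (- c w) * (g z * expR (dot w z / h)) +
   (2 * c w - 1) * g z + -1 * (g z * (dot w z / h)))).
  rewrite (rintZ _ (intgD (intgD J1 J2) J3)) (rintD (intgD J1 J2) J3) (rintD J1 J2).
  rewrite (rintZ _ (intg_gauss_exp h0 w)) (rintZ _ (@intg_gauss _ d _ h0)).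
  rewrite (rintZ _ (intg_dot h0 w)) rint_gauss_exp// rint_gauss// gauss_mean// -/(c w).
  rewrite -expRD addNr expR0 /c; field; rewrite gt_eqF//.
apply: rint_abs; [exact: intgD (intgD I1 I2) I3|exact: intgZ (intgD (intgD J1 J2) J3)|move=> z].
rewrite (_ : _ + _ + _ = phi x z * (g z * (expR (- c w) * expR (dot w z / h) - 1 - dot w z / h)));
  last by ring.
rewrite [leRHS](_ : _ = n * (g z * (expR (- c w) * expR (dot w z / h) - 1 - dot w z / h + 2 * c w)));
  last by ring.
rewrite normrM ler_pM// normrM (ger0_norm (gauss_ge0 _ _)) ler_wpM2l ?gauss_ge0// -expRD.
by have := expR_ge1Dx (- c w + dot w z / h); rewrite ler_norml; lra.
Qed.

Lemma smooth_C1 : C1 (smooth psi).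
Proof. by apply: quad_C1 rem; rewrite divr_ge0// ltW. Qed.

(** A reverse Poincare inequality: the gradient is the covariance of [psi] with <.,z>/h, hence
    controlled by the variance of [psi]. The sharp factor would be h; the 16 comes from
    [gauss_second_moment]. *)
Lemma smooth_grad x :
  h / 16 * sqn (grad (smooth psi) x) + smooth psi x ^+ 2 <= smooth (fun y => psi y ^+ 2) x.
Proof.
rewrite (quad_grad _ rem) ?divr_ge0 ?(ltW h0)//.
have psi20 y : 0 <= psi y ^+ 2 <= n ^+ 2.
  by have /andP[a b] := psi0 y; rewrite sqr_ge0 ler_sqr ?nnegrE.
have mpsi2 : measurable_fun setT (fun y => psi y ^+ 2) by meas.
have [SE _] := nint_smooth x mpsi2 psi20.
set S := smooth (fun y => psi y ^+ 2) x in SE *.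
have [GEn /andP[G0 Gn]] := nint_smooth x mpsi psi0; rewrite -/(G x) in GEn G0 Gn *.
set a := fun z => dot (v x) z / h.
have mp2 : measurable_fun setT (fun z => phi x z ^+ 2) by have := mphi x => ?; meas.
have bp2 z : `|phi x z ^+ 2| <= n ^+ 2.
  by rewrite normrX ler_sqr ?nnegrE.
have I1 : intg (fun z => phi x z ^+ 2 * g z) by exact: (intg_bounded h0 mp2 bp2).
have I2 := intg_bounded h0 (mphi x) (bphi x).
have I3 := @intg_gauss _ d _ h0.
have I4 : intg (fun z => g z * a z ^+ 2).
  apply: intgW; first by rewrite /a; meas.
    by move=> z; rewrite mulr_ge0 ?gauss_ge0 ?sqr_ge0.
  by rewrite (le_lt_trans (gauss_second_moment h0 (v x)))// ltry.
have I5 := intg_bounded_dot h0 (mphi x) (bphi x) (v x).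
have I6 := intg_dot h0 (v x).
have A2 : rint (fun z => g z * a z ^+ 2) <= 16 * sqn (v x) / h.
  have := gauss_second_moment h0 (v x).
  have g0 z : 0 <= g z * (dot (v x) z / h) ^+ 2 by rewrite mulr_ge0 ?gauss_ge0 ?sqr_ge0.
  by move=> /(nint_fin_le g0)[r rE /andP[_ rb]]; rewrite (rint_nint rE).
(* Young's inequality 2 (phi - G) a <= (16/h) (phi - G)^2 + (h/16) a^2 *)
have key : 2 * sqn (v x) <= 16 / h * (S - G x ^+ 2) + sqn (v x).
  have -> : 2 * sqn (v x) = rint (fun z => 2 * (phi x z * (g z * (dot (v x) z / h))) +
      (- (2 * G x)) * (g z * (dot (v x) z / h))).
    rewrite (rintD (intgZ _ I5) (intgZ _ I6)) (rintZ _ I5) (rintZ _ I6) gauss_mean// mulr0 addr0.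
    by rewrite -vE.
  have II := intgD (intgD (intgZ (16 / h) I1) (intgZ (- (32 / h * G x)) I2))
     (intgD (intgZ (16 / h * G x ^+ 2) I3) (intgZ (h / 16) I4)).
  apply: (@le_trans _ _ (rint (fun z => (16 / h * (phi x z ^+ 2 * g z) +
     (- (32 / h * G x)) * (phi x z * g z)) + (16 / h * G x ^+ 2 * g z +
     h / 16 * (g z * a z ^+ 2))))).
    apply: rint_le => //; first exact: (intgD (intgZ _ I5) (intgZ _ I6)).
    move=> z; rewrite -subr_ge0 -/(a z).
    rewrite (_ : _ - _ = g z * ((4 * (phi x z - G x) - h / 4 * a z) ^+ 2 / h)); last first.
      by field; rewrite gt_eqF.
    by rewrite mulr_ge0 ?gauss_ge0// divr_ge0 ?sqr_ge0// ltW.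
  rewrite (rintD (intgD (intgZ (16 / h) I1) (intgZ (- (32 / h * G x)) I2))
     (intgD (intgZ (16 / h * G x ^+ 2) I3) (intgZ (h / 16) I4))).
  rewrite (rintD (intgZ (16 / h) I1) (intgZ (- (32 / h * G x)) I2)).
  rewrite (rintD (intgZ (16 / h * G x ^+ 2) I3) (intgZ (h / 16) I4)).
  rewrite (rintZ _ I1) (rintZ _ I2) (rintZ _ I3) (rintZ _ I4) rint_gauss// -GE (rint_nint SE).
  have : h / 16 * rint (fun z => g z * a z ^+ 2) <= sqn (v x).
    have -> : sqn (v x) = h / 16 * (16 * sqn (v x) / h) by field; rewrite gt_eqF.
    by rewrite ler_wpM2l// divr_ge0// ltW.
  have : 0 < h^-1 by rewrite invr_gt0.
  set X := h / 16 * rint _; move: (h^-1) => hi _ XX; nra.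
have -> : S = h / 16 * (16 / h * (S - G x ^+ 2)) + G x ^+ 2 by field; rewrite gt_eqF.
by rewrite lerD2r ler_wpM2l ?divr_ge0 ?(ltW h0)//; lra.
Qed.
End Smoothing.

(** * Poincare inequality and heat contraction *)

Section Poincare.
Context {R : realType} {d : nat}.
Local Notation V := 'rV[R]_d.

Lemma borel_measurable (f : V -> R) : borel_fun f <-> measurable_fun setT f.
Proof.
split=> [bf _ Y mY|mf A mA]; first by rewrite setTI; exact: bf.
have := mf measurableT A mA; rewrite setTI; exact.
Qed.

Lemma C1_continuous (f : V -> R) : C1 f -> continuous f.
Proof. by move=> [df _] x; exact: (differentiable_continuous (df x)). Qed.

Lemma C1_measurable (f : V -> R) : C1 f -> measurable_fun setT f.
Proof. by move=> cf; exact: (measurable_continuous_rV (C1_continuous cf)). Qed.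

Lemma C1_measurable_grad (f : V -> R) : C1 f -> measurable_fun setT (grad f).
Proof.
move=> [_ cg]; apply: measurable_rV => i; apply: measurable_continuous_rV => x.
exact: (cvg_comp _ _ (cg x) (@coord_continuous R 1 d ord0 i (grad f x))).
Qed.

Lemma C1D (f k : V -> R) : C1 f -> C1 k ->
  C1 (fun x => f x + k x) /\ grad (fun x => f x + k x) = (fun x => grad f x + grad k x).
Proof.
move=> [df cf] [dk ck].
have gE : grad (fun x => f x + k x) = (fun x => grad f x + grad k x).
  apply/funext => x; apply/rowP => i; rewrite !mxE.
  by rewrite -deriveD//; exact: diff_derivable.
split; last exact: gE.
split=> [x|]; first exact: (differentiableD (df x) (dk x)).
by rewrite gE => x; exact: (cvgD (cf x) (ck x)).
Qed.

Lemma C1_comp (f : V -> R) (th dth : R -> R) : C1 f ->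
  (forall x, is_derive (f x) 1 th (dth (f x))) -> continuous (dth \o f) ->
  C1 (th \o f) /\ grad (th \o f) = (fun x => dth (f x) *: grad f x).
Proof.
move=> [df cf] dth_ cdth.
have dthf x : differentiable th (f x) by apply/derivable1_diffP; case: (dth_ x).
have dc x : differentiable (th \o f) x by exact: differentiable_comp.
have gE : grad (th \o f) = (fun x => dth (f x) *: grad f x).
  apply/funext => x; apply/rowP => i; rewrite !mxE !deriveE// diff_comp//=.
  by rewrite diff1E// derive1E; case: (dth_ x) => _ ->; rewrite mulrC.
split; last exact: gE.
split; first exact: dc.
by rewrite gE => x; exact: (cvgZ (cdth x) (cf x)).
Qed.

(** With s = r^2 and ln r >= 1 - 1/r, the entropy term is at least (r - 1)^2, while (s - 1)^2 = (r -
    1)^2 (r + 1)^2 and (1 + sqrt(3/2))^2 < 5. *)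
Lemma entropy_lower (s : R) : 0 < s -> s <= 3 / 2 ->
  (s - 1) ^+ 2 <= 5 * (s * ln s - s + 1).
Proof.
move=> s0 s32; have [r r0 rE] : exists2 r : R, 0 < r & s = r ^+ 2.
  by exists (Num.sqrt s); rewrite ?sqrtr_gt0// sqr_sqrtr// ltW.
have lr : 1 - r^-1 <= ln r.
  have ri : 0 < r^-1 by rewrite invr_gt0.
  have := @le_ln1Dx R (r^-1 - 1); rewrite addrCA subrr addr0 lnV ?posrE// => H.
  by have := H _; lra.
have ls : r ^+ 2 - r <= r ^+ 2 * ln r.
  have -> : r ^+ 2 - r = r ^+ 2 * (1 - r^-1) by field; rewrite gt_eqF.
  by rewrite ler_wpM2l ?sqr_ge0.
have lE : ln s = ln r + ln r by rewrite rE expr2 lnM ?posrE.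
rewrite lE {1 2 3}rE; rewrite rE in s32.
have -> : (r ^+ 2 - 1) ^+ 2 = (r - 1) ^+ 2 * (r + 1) ^+ 2 by ring.
have r1 : (r + 1) ^+ 2 <= 5 by nra.
have : (r - 1) ^+ 2 * (r + 1) ^+ 2 <= (r - 1) ^+ 2 * 5 by rewrite ler_wpM2l ?sqr_ge0.
nra.
Qed.

Variables (p : V -> R) (C : R).
Hypotheses (dp : is_density p) (p0 : forall x, 0 < p x)
  (cp : C1 (fun x => ln (p x))) (C0 : 0 <= C) (lsi : LSI p C).

Let mp : measurable_fun setT p. Proof. by apply/borel_measurable; case: dp. Qed.

Lemma density_nint (q : V -> R) : is_density q -> nint q = 1%E.
Proof.
move=> [/borel_measurable mq [q0 iq]]; rewrite -iq; exact/esym/lebint_nint.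
Qed.

(** Usually the perturbation size tends to 0. A fixed size keeps the perturbed ratio q/p in
    [1/2, 3/2], where [entropy_lower] bounds the entropy below pointwise and 1/w <= 2 bounds the
    Fisher term, so the constant becomes 5 C instead of C. *)
Lemma lsi_poincare (f : V -> R) (n m : R) : C1 f -> 0 < n ->
  (forall x, 0 <= f x <= n) -> nint (fun x => p x * f x) = m%:E ->
  (nint (fun x => (p x * f x ^+ 2)%R) <=
   (m ^+ 2)%:E + (5 * C)%:E * nint (fun x => (p x * sqn (grad f x))%R))%E.
Proof.
move=> cf n0 fn im.
have ple x : 0 <= p x by exact: ltW.
have ip := density_nint dp.
have mf := C1_measurable cf.
have mg := C1_measurable_grad cf.
have f0 x : 0 <= f x by case/andP: (fn x).
have fle x : f x <= n by case/andP: (fn x).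
have m0 : 0 <= m by rewrite -lee_fin -im nint_ge0// => x; rewrite mulr_ge0.
have mn : m <= n.
  rewrite -lee_fin -im -[n%:E]mule1 -ip -nintZ// ?(ltW n0)//.
  apply: le_nint => [|||x]; [by meas|by meas|by move=> x; rewrite mulr_ge0|].
  by rewrite mulrC ler_wpM2r.
(* Since [f] and its mean lie in [0, n], e |f - m| <= 1/2. *)
pose e := (2 * n)^-1.
have e0 : 0 < e by rewrite invr_gt0 mulr_gt0.
have en : e * n = 2^-1 by rewrite /e invfM -mulrA mulVf ?mulr1 ?gt_eqF.
pose w x := 1 + e * (f x - m).
have em : 0 <= e * m <= 2^-1 by rewrite mulr_ge0 ?(ltW e0)//= -en ler_wpM2l ?(ltW e0).
have wb x : 2^-1 <= w x <= 3 / 2.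
  have : 0 <= e * f x <= 2^-1 by rewrite mulr_ge0 ?(ltW e0)//= -en ler_wpM2l ?(ltW e0).
  by rewrite /w mulrBr; lra.
have w0 x : 0 < w x by have := wb x; lra.
have mw : measurable_fun setT w by rewrite /w; meas.
pose q x := p x * w x.
have q0 x : 0 < q x by rewrite mulr_gt0.
have mq : measurable_fun setT q by rewrite /q; meas.
have iq : nint q = 1%E.
  have E x : q x = (1 - e * m) * p x + e * (p x * f x) by rewrite /q /w; ring.
  have em1 : 0 <= 1 - e * m by lra.
  rewrite (eq_nint E) nintD; [|by meas|by meas| |].
  - rewrite !nintZ ?(ltW e0)//; [|by meas|by move=> x; rewrite mulr_ge0].
    by rewrite ip im mule1 -EFinM -EFinD subrK.
  - by move=> x; rewrite mulr_ge0.
  - by move=> x; rewrite !mulr_ge0 ?(ltW e0).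
have dq : is_density q.
  split; first by apply/borel_measurable.
  by split=> [x|]; [exact: ltW | rewrite lebint_nint// => x; exact: ltW].
pose th (t : R) := ln (1 + e * (t - m)).
pose dth (t : R) := e / (1 + e * (t - m)).
have dth_ x : is_derive (f x) 1 th (dth (f x)).
  have d1 : is_derive (f x) 1 (fun t : R => 1 + e * (t - m)) e.
    have -> : (fun t : R => 1 + e * (t - m)) = (fun t => cst (1 - e * m) t + e *: (id t : R^o)).
      by apply/funext => t /=; rewrite /GRing.scale /=; ring.
    by apply: is_derive_eq; rewrite /GRing.scale/= add0r mulr1.
  rewrite /dth mulrC; apply: (@is_derive1_comp R (@ln R) (fun t : R => 1 + e * (t - m))).
  exact: is_derive1_ln (w0 x).
have cw : continuous w.
  move=> x; have cfx : f y @[y --> x] --> f x by exact: (C1_continuous cf).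
  have FF : Filter (nbhs x) := nbhs_filter x.
  have c1 : f y - m @[y --> x] --> f x - m.
    by apply: (@cvgB _ _ _ _ FF f (cst m) _ _ cfx); exact: cvg_cst.
  have c2 : e * (f y - m) @[y --> x] --> e * (f x - m).
    by apply: (@cvgM _ _ _ FF (cst e) _ _ _ _ c1); exact: cvg_cst.
  by apply: (@cvgD _ _ _ _ FF (cst (1 : R)) _ _ _ _ c2); exact: cvg_cst.
have cdth : continuous (dth \o f).
  move=> x; have wx : w x != 0 by rewrite gt_eqF.
  have cwx : w y @[y --> x] --> w x by exact: cw.
  have FF : Filter (nbhs x) := nbhs_filter x.
  apply: (@cvgM _ _ _ FF (cst e) (fun y => (w y)^-1)); first exact: cvg_cst.
  exact: (@cvgV _ _ _ FF _ _ wx cwx).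
have [cth gth] := C1_comp cf dth_ cdth.
have lnq : (fun x => ln (q x)) = (fun x => ln (p x) + (th \o f) x).
  by apply/funext => x; rewrite /q lnM ?posrE.
have cq : C1 (fun x => ln (q x)) by rewrite lnq; exact: (C1D cp cth).1.
have qp x : q x / p x = w x by rewrite /q mulrC mulKf// gt_eqF.
have := lsi dq q0 cq; rewrite /KL.
have -> : (fun y => ln (q y / p y)) = th \o f by apply/funext => y; rewrite qp.
rewrite gth.
have ent0 x : 0 <= p x * ((q x / p x) * ln (q x / p x) - q x / p x + 1).
  rewrite qp mulr_ge0//; have := entropy_lower (w0 x).
  have /andP[_ w1] := wb x; move=> /(_ w1); have := sqr_ge0 (w x - 1); lra.
have ment : measurable_fun setT (fun x => p x * ((q x / p x) * ln (q x / p x) - q x / p x + 1)).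
  have -> : (fun x => p x * ((q x / p x) * ln (q x / p x) - q x / p x + 1)) =
     (fun x => p x * (w x * ln (w x) - w x + 1)) by apply/funext => x; rewrite qp.
  have mln : measurable_fun setT (fun x => ln (w x)).
    exact: (measurableT_comp (@measurable_ln R)).
  by meas.
have mwi : measurable_fun setT (fun x => (w x)^-1) by apply: measurable_inv => // x; exact: ltW.
have EG x : q x * enorm (dth (f x) *: grad f x) ^+ 2 =
   e ^+ 2 * (p x * sqn (grad f x) / w x).
  by rewrite enorm_sqr sqnZ /q /dth -/(w x); field; rewrite gt_eqF.
have pg0 x : 0 <= p x * sqn (grad f x) by rewrite mulr_ge0 ?sqn_ge0.
rewrite lebint_nint//.
rewrite (eq_lebint (g := fun x => (e ^+ 2 * (p x * sqn (grad f x) / w x))%:E)); last by move=> x; rewrite EG.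
rewrite lebint_nint; [|by meas|by move=> x; rewrite mulr_ge0 ?sqr_ge0// divr_ge0 ?(ltW (w0 x))].
move=> H.
set D := nint (fun x => p x * sqn (grad f x)).
have D0 : (0 <= D)%E by apply: nint_ge0.
pose X := nint (fun x => p x * (f x - m) ^+ 2).
have mpf : measurable_fun setT (fun x => p x * (f x - m) ^+ 2) by meas.
have X0 : (0 <= X)%E by apply: nint_ge0 => x; rewrite mulr_ge0 ?sqr_ge0.
have le1 : ((e ^+ 2)%:E * X <= 5%:E * ((C / 2)%:E * ((e ^+ 2)%:E * (2%:E * D))))%E.
  apply: (@le_trans _ _ (5%:E * nint (fun x => (p x * ((q x / p x) * ln (q x / p x) - q x / p x + 1))%R))%E).
    rewrite -nintZ ?sqr_ge0// => [|x]; last by rewrite mulr_ge0 ?sqr_ge0.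
    rewrite -nintZ//; apply: le_nint => [|||x]; [by meas| | |].
    - by apply: measurable_funM; [exact: measurable_cst|exact: ment].
    - by move=> x; apply: mulr_ge0; [exact: sqr_ge0|apply: mulr_ge0 => //; exact: sqr_ge0].
    rewrite qp mulrCA [leRHS]mulrCA ler_wpM2l// -exprMn.
    have -> : e * (f x - m) = w x - 1 by rewrite /w; ring.
    by apply: entropy_lower => //; case/andP: (wb x).
  apply: lee_wpmul2l => //; apply: (le_trans H); apply: lee_wpmul2l.
    by rewrite lee_fin divr_ge0.
  rewrite nintZ ?sqr_ge0//; [|by meas|by move=> x; rewrite divr_ge0 ?(ltW (w0 x))].
  apply: lee_wpmul2l; first by rewrite lee_fin sqr_ge0.
  rewrite -nintZ//; last by meas.
  apply: le_nint => [|||x]; [by meas|by meas|by move=> x; rewrite divr_ge0 ?(ltW (w0 x))|].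
  rewrite mulrC ler_wpM2r// -[leRHS]invrK lef_pV2 ?posrE ?invr_gt0//.
  by case/andP: (wb x).
have {}le1 : (X <= (5 * C)%:E * D)%E.
  have e20 : 0 < e ^+ 2 by rewrite exprn_gt0.
  have : (((e ^+ 2)^-1)%:E * ((e ^+ 2)%:E * X) <=
     ((e ^+ 2)^-1)%:E * (5%:E * ((C / 2)%:E * ((e ^+ 2)%:E * (2%:E * D)))))%E.
    by apply: lee_wpmul2l => //; rewrite lee_fin invr_ge0 ltW.
  rewrite !muleA -!EFinM mulVf ?gt_eqF// mul1e; congr (_ <= _%:E * _)%E.
  by field; rewrite gt_eqF.
have : (X + (2 * m * m)%:E = nint (fun x => (p x * f x ^+ 2)%R) + (m ^+ 2)%:E)%E.
  have -> : (2 * m * m)%:E = nint (fun x => 2 * m * (p x * f x)).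
    by rewrite nintZ; [rewrite im -EFinM|meas|rewrite mulr_ge0|move=> x; rewrite mulr_ge0].
  have -> : (m ^+ 2)%:E = nint (fun x => m ^+ 2 * p x).
    by rewrite nintZ ?sqr_ge0// ip mule1.
  have sq0 (k : R) x : 0 <= p x * k ^+ 2 by rewrite mulr_ge0 ?sqr_ge0.
  have mm0 x : 0 <= 2 * m * (p x * f x) by rewrite !mulr_ge0.
  have mp0 x : 0 <= m ^+ 2 * p x by rewrite mulr_ge0 ?sqr_ge0.
  rewrite -(nintD mpf _ (fun x => sq0 (f x - m) x) mm0); last by meas.
  rewrite -(nintD _ _ (fun x => sq0 (f x) x) mp0); [|by meas|by meas].
  by apply: eq_nint => x; ring.
have -> : (2 * m * m)%:E = ((m ^+ 2)%:E + (m ^+ 2)%:E)%E by rewrite -EFinD; congr EFin; ring.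
rewrite addeA => /(congr1 (fun t => t - (m ^+ 2)%:E)%E); rewrite !addeK// => <-.
by rewrite addeC leeD2l.
Qed.
End Poincare.

Section MonotoneLimit.
Context {R : realType} {d : nat}.
Variables (F : nat -> 'rV[R]_d -> R) (f : 'rV[R]_d -> R).
Hypotheses (mF : forall k, measurable_fun setT (F k)) (F0 : forall k x, 0 <= F k x)
  (F_nd : forall x, {homo F^~ x : a b / (a <= b)%N >-> a <= b})
  (F_cvg : forall x, F k x @[k --> \oo] --> f x).

Lemma nint_monotone_cvg : nint (F k) @[k --> \oo] --> nint f.
Proof.
have := @cvg_monotone_convergence _ _ R (leb d) setT measurableT (fun k x => (F k x)%:E).
have -> : (\int[leb d]_x limn (fun k => (F k x)%:E) = nint f)%E.
  rewrite nintE; apply: eq_integral => x _; apply/cvg_lim => //.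
  by apply: cvg_EFin; [exact: nearW|exact: F_cvg].
have -> : (fun k => \int[leb d]_x (F k x)%:E)%E = (fun k => nint (F k)).
  by apply/funext => k; rewrite nintE.
apply.
- by move=> k; have := mF k => ?; meas.
- by move=> k x _; rewrite lee_fin.
- by move=> x _ a b ab; rewrite lee_fin; exact: F_nd.
Qed.

Lemma nint_le_lim (B : \bar R) : (forall k, nint (F k) <= B)%E -> (nint f <= B)%E.
Proof.
move=> FB; have c := nint_monotone_cvg.
rewrite -(cvg_lim (@ereal_hausdorff R) c); apply: lime_le; last exact: nearW.
by apply/cvg_ex; eexists; exact: c.
Qed.
End MonotoneLimit.

Section HeatContraction.
Context {R : realType} {d : nat}.
Local Notation V := 'rV[R]_d.
Variables (h : R) (h0 : 0 < h).
Local Notation g := (gauss h).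

(** Duality between [heat] on densities and [smooth] on test functions, by Tonelli and z = y - x. *)
Lemma nint_heat_smooth (q f : V -> R) (m n : R) :
  measurable_fun setT q -> (forall x, 0 <= q x) -> nint q = m%:E ->
  measurable_fun setT f -> (forall x, 0 <= f x <= n) ->
  nint (fun x => q x * smooth h f x) = nint (fun y => heat h q y * f y).
Proof.
move=> mq q0 iq mf fn.
have f0 x : 0 <= f x by case/andP: (fn x).
have F0 x y : 0 <= q x * (f y * g (y - x)) by rewrite !mulr_ge0 ?gauss_ge0.
have mF : measurable_fun setT (fun z : V * V => q z.1 * (f z.2 * g (z.2 - z.1))) by meas.
transitivity (\int[leb d]_x nint (fun y => q x * (f y * g (y - x)))%R)%E.
  rewrite nintE; apply: eq_integral => x _.
  have fg0 y : 0 <= f y * g (y - x) by rewrite mulr_ge0 ?gauss_ge0.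
  rewrite nintZ//; last by meas.
  have [E _] := nint_smooth h0 x mf fn.
  rewrite EFinM -E; apply: (congr1 (fun t => (q x)%:E * t)%E); apply: esym.
  refine (etrans _ (@nint_shift _ _ (fun z => f (x + z) * g z) (- x) _ _)).
  - by apply: eq_nint => y; rewrite [x + (y - x)]addrC subrK.
  - by meas.
  - by move=> z; rewrite mulr_ge0 ?gauss_ge0.
rewrite (nint_tonelli mF F0) [RHS]nintE; apply: eq_integral => y _.
rewrite EFinM muleC -(nint_heat_kernel h0 mq q0 iq y) -nintZ//.
- by apply: eq_nint => x; ring.
- by meas.
- by move=> x; rewrite mulr_ge0 ?gauss_ge0.
Qed.

Variables (p : V -> R) (Cp : R).
Hypotheses (mp : measurable_fun setT p) (p0 : forall x, 0 < p x) (ip : nint p = 1%E)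
  (Cp0 : 0 < Cp).
Hypothesis PI : forall (f : V -> R) (n m : R), C1 f -> 0 < n ->
  (forall x, 0 <= f x <= n) -> nint (fun x => p x * f x) = m%:E ->
  (nint (fun x => (p x * f x ^+ 2)%R) <=
   (m ^+ 2)%:E + Cp%:E * nint (fun x => (p x * sqn (grad f x))%R))%E.

Let ple x : 0 <= p x. Proof. exact: ltW. Qed.
Let hp0 y : 0 < heat h p y. Proof. exact: (heat_gt0 h0 mp p0 ip). Qed.
Let mhp : measurable_fun setT (heat h p). Proof. exact: (measurable_heat h mp ple). Qed.
Let mihp : measurable_fun setT (fun y => (heat h p y)^-1).
Proof. by apply: measurable_inv => // y; exact: ltW. Qed.
Let mip : measurable_fun setT (fun y => (p y)^-1).
Proof. by apply: measurable_inv. Qed.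

(** With t = 16 Cp/h this is t/(1+t): the factor obtained by eliminating the gradient term between
    [PI] and [smooth_grad]. Its gap is 1 - kap = h/(h + 16 Cp). *)
Definition kap : R := (16 * Cp / h) / (1 + 16 * Cp / h).

Lemma kap_bd : 0 < kap < 1.
Proof.
have t0 : 0 < 16 * Cp / h by rewrite divr_gt0// mulr_gt0.
have t1 : 0 < 1 + 16 * Cp / h by rewrite addr_gt0.
by rewrite /kap (divr_gt0 t0 t1)/= ltr_pdivrMr// mul1r ltrDr.
Qed.

Section BoundedRatio.
Variables (q : V -> R) (n m : R).
Hypotheses (mq : measurable_fun setT q) (q0 : forall x, 0 <= q x) (iq : nint q = m%:E)
  (n0 : 0 < n) (qn : forall x, q x <= n * p x).

Let psi y := heat h q y / heat h p y.

(** Let [psi] be the ratio after the heat flow and G = [smooth h psi]. By duality int q G and int p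
    (smooth psi^2) both equal the new functional [It], and int p G = m. Averaging [smooth_grad] and
    applying [PI] to [G] bounds [E2] = int p G^2; a weighted square then brings in int q^2/p. The
    bound on q/p makes [psi] an admissible test function and all quantities finite. *)
Lemma heat_contraction_bounded :
  (nint (fun y => (heat h q y ^+ 2 / heat h p y)%R) <=
   kap%:E * nint (fun x => (q x ^+ 2 / p x)%R) + ((1 - kap) * m ^+ 2)%:E)%E.
Proof.
have mhq : measurable_fun setT (heat h q) := measurable_heat h mq q0.
have hq0 y : 0 <= heat h q y := heat_ge0 h0 mq q0 iq y.
have mpsi : measurable_fun setT psi by rewrite /psi; meas.
have hqp y : heat h q y <= n * heat h p y.
  rewrite -lee_fin EFinM -(nint_heat_kernel h0 mq q0 iq) -(nint_heat_kernel h0 mp ple ip).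
  rewrite -nintZ; [|by meas|exact: ltW|by move=> x; rewrite mulr_ge0 ?gauss_ge0].
  apply: le_nint => [|||x]; [by meas|by meas|by move=> x; rewrite mulr_ge0 ?gauss_ge0|].
  by rewrite mulrA ler_wpM2r ?gauss_ge0.
have psin y : 0 <= psi y <= n.
  by rewrite divr_ge0 ?(ltW (hp0 y))//= ler_pdivrMr.
have psi2n y : 0 <= psi y ^+ 2 <= n ^+ 2.
  by have /andP[a b] := psin y; rewrite sqr_ge0 ler_sqr ?nnegrE ?(ltW n0).
have mpsi2 : measurable_fun setT (fun y => psi y ^+ 2) by meas.
pose G := smooth h psi.
have cG : C1 G := smooth_C1 h0 mpsi psin.
have mG := C1_measurable cG.
have mgG := C1_measurable_grad cG.
have Gn x : 0 <= G x <= n by case: (nint_smooth h0 x mpsi psin).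
have G0 x : 0 <= G x by case/andP: (Gn x).
pose S := smooth h (fun y => psi y ^+ 2).
have mS : measurable_fun setT S.
  apply: (@measurable_fine_nint _ _ _ _ (fun x z : V => psi (x + z) ^+ 2 * g z)).
    by meas.
  by move=> x z; rewrite mulr_ge0 ?gauss_ge0 ?sqr_ge0.
have S0 x : 0 <= S x by case: (nint_smooth h0 x mpsi2 psi2n) => _ /andP[].
have m0 : 0 <= m by rewrite -lee_fin -iq nint_ge0.
have hpsi y : heat h p y * psi y = heat h q y by rewrite /psi mulrC divfK// gt_eqF.
have ipG : nint (fun x => p x * G x) = m%:E.
  rewrite (nint_heat_smooth mp ple ip mpsi psin) -(nint_heat h0 mq q0 iq).
  by apply: eq_nint => y; exact: hpsi.
have hple y : 0 <= heat h p y := ltW (hp0 y).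
have hh0 y : 0 <= heat h q y ^+ 2 / heat h p y := divr_ge0 (sqr_ge0 _) (hple y).
have qq0 y : 0 <= q y ^+ 2 / p y := divr_ge0 (sqr_ge0 _) (ple y).
have [It iIt _] : exists2 r, nint (fun y => heat h q y ^+ 2 / heat h p y) = r%:E & 0 <= r <= n * m.
  apply: (nint_fin_le hh0).
  rewrite EFinM -(nint_heat h0 mq q0 iq) -nintZ; [|exact: mhq|exact: ltW|exact: hq0].
  apply: le_nint => [|||y]; [by meas|by meas|exact: hh0|].
  by rewrite (ler_pdivrMr _ _ (hp0 y)) expr2 mulrAC; exact: (ler_wpM2r (hq0 y) (hqp y)).
have iqG : nint (fun x => q x * G x) = It%:E.
  rewrite (nint_heat_smooth mq q0 iq mpsi psin) -iIt.
  by apply: eq_nint => y; rewrite /psi; ring.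
have ipS : nint (fun x => p x * S x) = It%:E.
  rewrite (nint_heat_smooth mp ple ip mpsi2 psi2n) -iIt.
  by apply: eq_nint => y; rewrite /psi; field; rewrite gt_eqF.
have [Iq iIq _] : exists2 r, nint (fun x => q x ^+ 2 / p x) = r%:E & 0 <= r <= n * m.
  apply: (nint_fin_le qq0).
  rewrite EFinM -iq -nintZ; [|exact: mq|exact: ltW|exact: q0].
  apply: le_nint => [|||y]; [by meas|by meas|exact: qq0|].
  by rewrite (ler_pdivrMr _ _ (p0 y)) expr2 mulrAC; exact: (ler_wpM2r (q0 y) (qn y)).
have pgG0 x : 0 <= p x * sqn (grad G x) by rewrite mulr_ge0 ?sqn_ge0.
have pG20 x : 0 <= p x * G x ^+ 2 by rewrite mulr_ge0 ?sqr_ge0.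
have h16 : 0 < h / 16 by rewrite divr_gt0.
have sg x := smooth_grad h0 mpsi psin x.
have le1 : ((h / 16)%:E * nint (fun x => (p x * sqn (grad G x))%R) +
    nint (fun x => (p x * G x ^+ 2)%R) <= It%:E)%E.
  rewrite -nintZ//; [|by meas|exact: ltW].
  rewrite -nintD//; [|by meas|by meas|by move=> x; rewrite mulr_ge0// ltW].
  rewrite -ipS; apply: le_nint => [|||x]; [by meas|by meas| |].
    by move=> x; rewrite addr_ge0// mulr_ge0// ltW.
  rewrite mulrCA -mulrDr ler_wpM2l//; exact: sg.
have [E2 iE2 /andP[E20 _]] : exists2 r, nint (fun x => p x * G x ^+ 2) = r%:E & 0 <= r <= It.
  apply: nint_fin_le => //; apply: le_trans le1; rewrite leeDr//.
  by rewrite mule_ge0 ?lee_fin ?(ltW h16)// nint_ge0.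
have [D iD /andP[D0 DI]] : exists2 r, nint (fun x => p x * sqn (grad G x)) = r%:E &
    0 <= r <= 16 / h * (It - E2).
  apply: nint_fin_le => //.
  have : ((16 / h)%:E * ((h / 16)%:E * nint (fun x => (p x * sqn (grad G x))%R)) <=
     (16 / h)%:E * (It - E2)%:E)%E.
    apply: lee_wpmul2l; first by rewrite lee_fin divr_ge0// ltW.
    by rewrite EFinB leeBrDr// -iE2.
  rewrite muleA -!EFinM (_ : 16 / h * (h / 16) = 1) ?mul1e//.
  by field; rewrite gt_eqF.
have := PI cG n0 Gn ipG; rewrite iE2 iD -EFinM -EFinD lee_fin => pi1.
rewrite iIt iIq -EFinM -EFinD lee_fin.
pose t := 16 * Cp / h.
have t0 : 0 < t by rewrite divr_gt0// mulr_gt0.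
have tD : Cp * D <= t * (It - E2).
  have -> : t * (It - E2) = Cp * (16 / h * (It - E2)) by rewrite /t; ring.
  by rewrite ler_wpM2l// ltW.
have kE : kap * (1 + t) = t by rewrite /kap -/t divfK// gt_eqF// addr_gt0.
have /andP[k0 k1] := kap_bd.
have E2k : E2 <= (1 - kap) * m ^+ 2 + kap * It.
  have H : (1 + t) * E2 <= m ^+ 2 + t * It by lra.
  rewrite -(@ler_pM2l _ (1 + t)) ?addr_gt0//; apply: (le_trans H).
  have -> : (1 + t) * ((1 - kap) * m ^+ 2 + kap * It) =
    (1 + t - kap * (1 + t)) * m ^+ 2 + kap * (1 + t) * It by ring.
  by rewrite kE; lra.
(* Nonnegativity of the integral of (kap q + (1 - kap) m p - G p)^2 / p. The combination of [q] and
   [m p] is the one for which, after inserting [E2k], the m^2 terms sum to kap (1 - kap) m^2. *)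
have key : 2 * kap * It + 2 * (1 - kap) * m * m <=
   kap ^+ 2 * Iq + ((1 - kap) * m) ^+ 2 + 2 * kap * (1 - kap) * m * m + E2.
  have n1k : 0 <= 1 - kap by lra.
  have kle : 0 <= kap by exact: ltW.
  have c1 : 0 <= 2 * kap := mulr_ge0 (ler0n R 2) kle.
  have c2 : 0 <= 2 * (1 - kap) * m := mulr_ge0 (mulr_ge0 (ler0n R 2) n1k) m0.
  have c3 : 0 <= 2 * kap * (1 - kap) * m := mulr_ge0 (mulr_ge0 c1 n1k) m0.
  have c4 : 0 <= kap ^+ 2 := sqr_ge0 _.
  have c5 : 0 <= ((1 - kap) * m) ^+ 2 := sqr_ge0 _.
  have a1 x : 0 <= 2 * kap * (q x * G x) := mulr_ge0 c1 (mulr_ge0 (q0 x) (G0 x)).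
  have a2 x : 0 <= 2 * (1 - kap) * m * (p x * G x) := mulr_ge0 c2 (mulr_ge0 (ple x) (G0 x)).
  have b1 x : 0 <= kap ^+ 2 * (q x ^+ 2 / p x) := mulr_ge0 c4 (qq0 x).
  have b2 x : 0 <= ((1 - kap) * m) ^+ 2 * p x := mulr_ge0 c5 (ple x).
  have b3 x : 0 <= 2 * kap * (1 - kap) * m * q x := mulr_ge0 c3 (q0 x).
  have mqG : measurable_fun setT (fun x => q x * G x) by meas.
  have mpG : measurable_fun setT (fun x => p x * G x) by meas.
  have mqq : measurable_fun setT (fun x => q x ^+ 2 / p x) by meas.
  have qG0 x : 0 <= q x * G x := mulr_ge0 (q0 x) (G0 x).
  have pG0 x : 0 <= p x * G x := mulr_ge0 (ple x) (G0 x).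
  have L : nint (fun x => 2 * kap * (q x * G x) + 2 * (1 - kap) * m * (p x * G x)) =
      (2 * kap * It + 2 * (1 - kap) * m * m)%:E.
    rewrite nintD; [|by meas|by meas|exact: a1|exact: a2].
    by rewrite (nintZ mqG c1 qG0) (nintZ mpG c2 pG0) iqG ipG -!EFinM -EFinD.
  have Rr : nint (fun x => kap ^+ 2 * (q x ^+ 2 / p x) + ((1 - kap) * m) ^+ 2 * p x +
       2 * kap * (1 - kap) * m * q x + p x * G x ^+ 2) =
      (kap ^+ 2 * Iq + ((1 - kap) * m) ^+ 2 + 2 * kap * (1 - kap) * m * m + E2)%:E.
    rewrite nintD; [|by meas|by meas|by move=> x; exact: (addr_ge0 (addr_ge0 (b1 x) (b2 x)) (b3 x))|exact: pG20].
    rewrite nintD; [|by meas|by meas|by move=> x; exact: (addr_ge0 (b1 x) (b2 x))|exact: b3].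
    rewrite nintD; [|by meas|by meas|exact: b1|exact: b2].
    rewrite (nintZ mqq c4 qq0) (nintZ mp c5 ple) (nintZ mq c3 q0).
    by rewrite iIq ip iq iE2 mule1 -!EFinM -!EFinD.
  rewrite -lee_fin -L -Rr; apply: le_nint => [|||x]; [by meas|by meas| |].
    by move=> x; exact: (addr_ge0 (a1 x) (a2 x)).
  rewrite -subr_ge0 (_ : _ - _ = (kap * q x + (1 - kap) * m * p x - G x * p x) ^+ 2 / p x).
    by rewrite divr_ge0 ?sqr_ge0.
  by field; rewrite gt_eqF.
rewrite -(ler_pM2l k0).
have -> : kap * (kap * Iq + (1 - kap) * m ^+ 2) =
  kap ^+ 2 * Iq + (kap - kap ^+ 2) * m ^+ 2 by ring.
have -> : kap * It = 2 * kap * It - kap * It by ring.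
move: key E2k; nra.
Qed.
End BoundedRatio.

(** The bounded case is applied to min(q, (k+1) p), which increases to [q]; its mass is at most m,
    and monotone convergence passes to the limit on the left. *)
Lemma heat_contraction (q : V -> R) (m : R) :
  measurable_fun setT q -> (forall x, 0 <= q x) -> nint q = m%:E ->
  (nint (fun y => (heat h q y ^+ 2 / heat h p y)%R) <=
   kap%:E * nint (fun x => (q x ^+ 2 / p x)%R) + ((1 - kap) * m ^+ 2)%:E)%E.
Proof.
move=> mq q0 iq.
have m0 : 0 <= m by rewrite -lee_fin -iq nint_ge0.
have /andP[k0 k1] := kap_bd.
have mhq : measurable_fun setT (heat h q) := measurable_heat h mq q0.
pose qk (k : nat) x := Num.min (q x) (k.+1%:R * p x).
have mqk k : measurable_fun setT (qk k) by rewrite /qk; meas.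
have qk0 k x : 0 <= qk k x by rewrite le_min q0 mulr_ge0.
have qkq k x : qk k x <= q x by rewrite ge_min lexx.
have qkn k x : qk k x <= k.+1%:R * p x by rewrite ge_min lexx orbT.
have qk_nd x : {homo qk^~ x : a b / (a <= b)%N >-> a <= b}.
  move=> a b ab; rewrite /qk le_min !ge_min lexx /=; apply/orP; right.
  by rewrite ler_wpM2r// ler_nat ltnS.
have iqk k : exists2 r, nint (qk k) = r%:E & 0 <= r <= m.
  by apply: nint_fin_le => //; rewrite -iq; apply: le_nint.
have mhqk k : measurable_fun setT (heat h (qk k)) by exact: measurable_heat.
have hqk0 k y : 0 <= heat h (qk k) y.
  by have [r ir _] := iqk k; exact: (heat_ge0 h0 (mqk k) (qk0 k) ir).
have hqkE k y : nint (fun x => qk k x * g (y - x)) = (heat h (qk k) y)%:E.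
  by have [r ir _] := iqk k; exact: (nint_heat_kernel h0 (mqk k) (qk0 k) ir).
have bound k : (nint (fun y => (heat h (qk k) y ^+ 2 / heat h p y)%R) <=
   kap%:E * nint (fun x => (q x ^+ 2 / p x)%R) + ((1 - kap) * m ^+ 2)%:E)%E.
  have [r ir /andP[r0 rm]] := iqk k.
  apply: (le_trans (heat_contraction_bounded (mqk k) (qk0 k) ir (ltr0Sn _ k) (qkn k))).
  apply: leeD.
    apply: lee_wpmul2l; first by rewrite lee_fin ltW.
    apply: le_nint => [|||x]; [by have := mqk k => ?; meas|by meas|by move=> x; rewrite divr_ge0 ?sqr_ge0|].
    by rewrite ler_wpM2r ?invr_ge0// ler_sqr ?nnegrE.
  by rewrite lee_fin ler_wpM2l ?subr_ge0 ?(ltW k1)// ler_sqr ?nnegrE.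
have nd_heat y : {homo (fun k => heat h (qk k) y) : a b / (a <= b)%N >-> a <= b}.
  move=> a b ab; rewrite -lee_fin -!hqkE; apply: le_nint => [|||x].
  - by have := mqk a => ?; meas.
  - by have := mqk b => ?; meas.
  - by move=> x; rewrite mulr_ge0 ?gauss_ge0.
  - by rewrite ler_wpM2r ?gauss_ge0// qk_nd.
have cv_qk x : qk k x @[k --> \oo] --> q x.
  have [N Nq] : exists N : nat, q x <= N%:R * p x.
    exists (Num.truncn (q x / p x)).+1.
    by rewrite -ler_pdivrMr// ltW// truncnS_gt.
  apply: cvg_near_cst; exists N => // k /= Nk; rewrite /qk min_l//.
  by apply: (le_trans Nq); rewrite ler_wpM2r// ler_nat (leq_trans Nk).
have cv_heat y : heat h (qk k) y @[k --> \oo] --> heat h q y.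
  have := @nint_monotone_cvg _ _ (fun k x => qk k x * g (y - x)) (fun x => q x * g (y - x)).
  rewrite (nint_heat_kernel h0 mq q0 iq y) => cvh.
  have -> : (fun k => heat h (qk k) y) = fine \o (fun k => nint (fun x => qk k x * g (y - x))).
    by apply/funext => k /=; rewrite hqkE.
  apply: fine_cvg; apply: cvh.
  - by move=> k; have := mqk k => ?; meas.
  - by move=> k x; exact: (mulr_ge0 (qk0 k x) (gauss_ge0 _ _)).
  - by move=> x a b ab; exact: (ler_wpM2r (gauss_ge0 _ _) (qk_nd x _ _ ab)).
  - by move=> x; apply: cvgMl; exact: cv_qk.
apply: (@nint_le_lim _ _ (fun k y => heat h (qk k) y ^+ 2 / heat h p y)).
- by move=> k; have := mhqk k => ?; meas.
- by move=> k y; exact: (divr_ge0 (sqr_ge0 _) (ltW (hp0 y))).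
- move=> y a b ab; rewrite ler_pM2r ?invr_gt0 ?hp0//.
  by rewrite ler_sqr ?nnegrE ?hqk0//; exact: nd_heat.
- move=> y; apply: cvgMl; rewrite expr2; under eq_fun do rewrite expr2.
  by apply: cvgM; exact: cv_heat.
- exact: bound.
Qed.
End HeatContraction.

(** * Gaussian rotation *)

Section Rotation.
Context {R : realType} {d : nat}.
Local Notation V := 'rV[R]_d.
Implicit Types (K : V -> V -> R).

Definition dint K : \bar R := (\int[leb d]_x nint (K x))%E.

Lemma eq_dint K1 K2 : (forall x y, K1 x y = K2 x y) -> dint K1 = dint K2.
Proof. by move=> E; apply: eq_integral => x _; apply: eq_nint => y; exact: E. Qed.

Section Shears.
Variable K : V -> V -> R.
Hypotheses (mK : measurable_fun setT (fun z : V * V => K z.1 z.2))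
  (K0 : forall x y, 0 <= K x y).

Lemma shear_r (a : R) : dint (fun x y => K x (y + a *: x)) = dint K.
Proof.
apply: eq_integral => x _; apply: nint_shift.
  exact: (measurableT_comp mK (pair1_measurable x)).
by move=> y; exact: K0.
Qed.

Lemma shear_l (a : R) : dint (fun x y => K (x + a *: y) y) = dint K.
Proof.
rewrite /dint (nint_tonelli mK K0).
rewrite (@nint_tonelli _ _ (fun x y => K (x + a *: y) y)); last first.
- by move=> x y; exact: K0.
- have msh : measurable_fun setT (fun z : V * V => (z.1 + a *: z.2, z.2)) by meas.
  exact: (measurableT_comp mK msh).
apply: eq_integral => y _; apply: (@nint_shift _ _ (K^~ y)).
  exact: (measurableT_comp mK (pair2_measurable y)).
by move=> x; exact: K0.
Qed.
End Shears.

(* A plane rotation is a product of three shears, so that translation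
   invariance of the Lebesgue measure suffices. *)
Lemma dint_rotation K (c s : R) :
  measurable_fun setT (fun z : V * V => K z.1 z.2) -> (forall x y, 0 <= K x y) ->
  c ^+ 2 + s ^+ 2 = 1 -> s != 0 ->
  dint (fun x y => K (c *: x + s *: y) (- s *: x + c *: y)) = dint K.
Proof.
move=> mK K0 cs s0.
(* The tangent of half the angle: the shears are a, -s and again a. *)
pose a := (1 - c) / s.
pose K1 (x y : V) := K (x + a *: y) y.
pose K2 (x y : V) := K1 x (y + - s *: x).
have msh : measurable_fun setT (fun z : V * V => (z.1 + a *: z.2, z.2)) by meas.
have msh2 : measurable_fun setT (fun z : V * V => (z.1, z.2 + - s *: z.1)) by meas.
have mK1 : measurable_fun setT (fun z : V * V => K1 z.1 z.2).
  exact: (measurableT_comp mK msh).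
have mK2 : measurable_fun setT (fun z : V * V => K2 z.1 z.2).
  exact: (measurableT_comp mK1 msh2).
have K10 x y : 0 <= K1 x y by exact: K0.
have K20 x y : 0 <= K2 x y by exact: K0.
rewrite -(shear_l mK K0 a) -[RHS](shear_r mK1 K10 (- s)) -[RHS](shear_l mK2 K20 a).
apply: eq_dint => x y; rewrite /K2 /K1.
have aE : a * s = 1 - c by rewrite /a divfK.
have asE : a * (1 + c) = s.
  rewrite /a mulrAC (_ : (1 - c) * (1 + c) = s * s) ?mulfK//.
  by rewrite -expr2 (_ : s ^+ 2 = 1 - c ^+ 2); [ring|rewrite -cs; ring].
congr K; apply/rowP => i; rewrite !mxE.
  transitivity ((1 - a * s) * x ord0 i + a * (2 - a * s) * y ord0 i); last by ring.
  by rewrite aE -asE; ring.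
transitivity (- s * x ord0 i + (1 - a * s) * y ord0 i); last by ring.
by rewrite aE; ring.
Qed.

Variables (h : R) (h0 : 0 < h).
Local Notation g := (gauss h).

Lemma gauss_rotation K (c s : R) :
  measurable_fun setT (fun z : V * V => K z.1 z.2) -> (forall x y, 0 <= K x y) ->
  c ^+ 2 + s ^+ 2 = 1 -> s != 0 ->
  dint (fun x y => g x * g y * K (c *: x + s *: y) (- s *: x + c *: y)) =
  dint (fun x y => g x * g y * K x y).
Proof.
move=> mK K0 cs s0.
refine (etrans _ (@dint_rotation (fun x y => g x * g y * K x y) c s _ _ cs s0)); last 2 first.
- by meas.
- by move=> x y; exact: (mulr_ge0 (mulr_ge0 (gauss_ge0 _ _) (gauss_ge0 _ _)) (K0 x y)).
apply: eq_dint => x y; apply: (congr1 (fun t => t * _)).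
rewrite !gaussE mulrACA [RHS]mulrACA -!expRD; apply: (congr1 (fun t => _ * expR t)).
rewrite -!mulrDl -!opprD; apply: (congr1 (fun t => - t / _)).
rewrite !sqnD !sqnZ !dotZl !dotZr.
by rewrite sqrrN (_ : s ^+ 2 = 1 - c ^+ 2); [ring|rewrite -cs; ring].
Qed.
End Rotation.

(** Turns the determinant factors of Gaussian integrals into exponentials linear in the dimension;
    it rests on exp(-2t) <= 1 - t for t <= 1/2. *)
Lemma sqrt_inv_exp {R : realType} (d : nat) (t : R) : 0 <= t -> t <= 2^-1 ->
  (Num.sqrt (1 - t)) ^- d <= expR (d%:R * t).
Proof.
move=> t0 t1.
have e1 : expR (- (2 * t)) <= 1 - t.
  have e0 := expR_gt0 (2 * t); have := expR_ge1Dx (2 * t).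
  rewrite expRN => e2; rewrite -(ler_pM2r e0) mulVf ?gt_eqF//; nra.
have e2 : expR (- t) <= Num.sqrt (1 - t).
  rewrite -[leLHS]ger0_norm ?expR_ge0// -sqrtr_sqr ler_wsqrtr//.
  by rewrite expr2 -expRD (_ : - t + - t = - (2 * t)); [|ring].
rewrite expRM_natl -exprVn.
apply: lerXn2r; rewrite ?nnegrE ?invr_ge0 ?sqrtr_ge0 ?expR_ge0//.
have := e2; rewrite expRN => e3.
rewrite -[leRHS]invrK lef_pV2 ?posrE ?invr_gt0 ?expR_gt0//.
by apply: lt_le_trans e3; rewrite invr_gt0 expR_gt0.
Qed.

Section Pisier.
Context {R : realType} {d : nat}.
Local Notation V := 'rV[R]_d.
Variables (h : R) (h0 : 0 < h).
Local Notation g := (gauss h).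

Let g0 (x : V) : 0 <= g x := gauss_ge0 h x.

Variables (Phi : V -> R) (H : V -> V) (L B : R).
Hypotheses (mPhi : measurable_fun setT Phi) (L0 : 0 < L)
  (hL : 184 * (h * L) ^+ 2 <= 1)
  (taylor : forall x w, Phi w - Phi x <= dot (H x) (w - x) + L * sqn (w - x))
  (Hbd : forall x, sqn (H x) <= B + 6 * L ^+ 2 * sqn x).

(** Here [c] and [s] are the cosine and sine of an angle, and [n] counts how often it fits into a
    quarter turn. The quarter turn itself, [T 1 0 1], compares [Phi y] with [Phi x]. *)
Let T (n c s : R) (x y : V) : R := expR (n * (Phi (c *: x + s *: y) - Phi x)).
Let E n c s := dint (fun x y => g x * g y * T n c s x y).

Let T0 n c s x y : 0 <= T n c s x y. Proof. exact: expR_ge0. Qed.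

Let mT n c s : measurable_fun setT (fun z : V * V => T n c s z.1 z.2).
Proof. by rewrite /T; meas. Qed.

Let mgT n c s : measurable_fun setT (fun z : V * V => g z.1 * g z.2 * T n c s z.1 z.2).
Proof. by have := mT n c s => ?; meas. Qed.

Let gT0 n c s x y : 0 <= g x * g y * T n c s x y.
Proof. exact: (mulr_ge0 (mulr_ge0 (g0 x) (g0 y)) (T0 _ _ _ _ _)). Qed.

Lemma le_dint (K1 K2 : V -> V -> R) :
  measurable_fun setT (fun z : V * V => K1 z.1 z.2) ->
  measurable_fun setT (fun z : V * V => K2 z.1 z.2) ->
  (forall x y, 0 <= K1 x y) -> (forall x y, K1 x y <= K2 x y) -> (dint K1 <= dint K2)%E.
Proof.
move=> m1 m2 K10 K12.
have K20 x y : 0 <= K2 x y by exact: le_trans (K10 x y) (K12 x y).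
apply: ge0_le_integral => //.
- by move=> x _; exact: nint_ge0.
- exact: measurable_nint.
- exact: measurable_nint.
- move=> x _; apply: le_nint => //.
  + exact: (measurableT_comp m1 (pair1_measurable x)).
  + exact: (measurableT_comp m2 (pair1_measurable x)).
Qed.

Lemma dintD (K1 K2 : V -> V -> R) :
  measurable_fun setT (fun z : V * V => K1 z.1 z.2) ->
  measurable_fun setT (fun z : V * V => K2 z.1 z.2) ->
  (forall x y, 0 <= K1 x y) -> (forall x y, 0 <= K2 x y) ->
  (dint (fun x y => (K1 x y + K2 x y)%R) = dint K1 + dint K2)%E.
Proof.
move=> m1 m2 K10 K20; rewrite /dint -ge0_integralD//.
- apply: eq_integral => x _; rewrite nintD//.
  + exact: (measurableT_comp m1 (pair1_measurable x)).
  + exact: (measurableT_comp m2 (pair1_measurable x)).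
- by move=> x _; exact: nint_ge0.
- exact: measurable_nint.
- by move=> x _; exact: nint_ge0.
- exact: measurable_nint.
Qed.

(** A turn by the double angle is two successive turns, so the exponent is n(A + B), and exp(n(A +
    B)) is at most the mean of exp(2nA) and exp(2nB). Rotation invariance gives both the same
    integral. *)
Let doubling n c s : c ^+ 2 + s ^+ 2 = 1 -> s != 0 ->
  (E n (c ^+ 2 - s ^+ 2) (2 * c * s) <= E (2 * n) c s)%E.
Proof.
move=> cs s0.
pose T' (x y : V) := T (2 * n) c s (c *: x + s *: y) (- s *: x + c *: y).
pose A (x y : V) := g x * g y * (2^-1 * T (2 * n) c s x y).
pose A' (x y : V) := g x * g y * (2^-1 * T' x y).
have mrot : measurable_fun setT (fun z : V * V =>
   (c *: z.1 + s *: z.2, - s *: z.1 + c *: z.2)) by meas.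
have mT' : measurable_fun setT (fun z : V * V => T' z.1 z.2).
  exact: (measurableT_comp (mT (2 * n) c s) mrot).
have mA : measurable_fun setT (fun z : V * V => A z.1 z.2).
  by have := mT (2 * n) c s => ?; rewrite /A; meas.
have mA' : measurable_fun setT (fun z : V * V => A' z.1 z.2) by rewrite /A'; meas.
have hT0 x y : 0 <= 2^-1 * T (2 * n) c s x y by rewrite mulr_ge0// T0.
have A0 x y : 0 <= A x y := mulr_ge0 (mulr_ge0 (g0 x) (g0 y)) (hT0 x y).
have A'0 x y : 0 <= A' x y := mulr_ge0 (mulr_ge0 (g0 x) (g0 y)) (hT0 _ _).
have AA' : dint A' = dint A.
  apply: (gauss_rotation h _ hT0 cs s0).
  exact: (measurable_funM (measurable_cst _) (mT (2 * n) c s)).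
have AE : E (2 * n) c s = (dint A + dint A)%E.
  refine (etrans _ (dintD mA mA A0 A0)); apply: eq_dint => x y.
  by rewrite /A -mulrDr; apply: (congr1 (fun t => _ * t)); field.
rewrite AE -{1}AA' -(dintD mA' mA A'0 A0).
apply: (le_dint (mgT _ _ _) _ (gT0 _ _ _)).
  exact: (measurable_funD mA' mA).
move=> x y; rewrite /A' /A -mulrDr.
apply: (ler_wpM2l (mulr_ge0 (g0 x) (g0 y))).
rewrite /T' /T.
have -> : (c ^+ 2 - s ^+ 2) *: x + (2 * c * s) *: y =
   c *: (c *: x + s *: y) + s *: (- s *: x + c *: y).
  by apply/rowP => i; rewrite !mxE; ring.
move: (Phi (c *: (c *: x + s *: y) + s *: (- s *: x + c *: y))) => p2.
move: (Phi (c *: x + s *: y)) (Phi x) => p1 p00.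
have -> : n * (p2 - p00) = n * (p2 - p1) + n * (p1 - p00) by ring.
have e1 : 2 * n * (p2 - p1) = n * (p2 - p1) + n * (p2 - p1) by ring.
have e2 : 2 * n * (p1 - p00) = n * (p1 - p00) + n * (p1 - p00) by ring.
rewrite e1 e2 !expRD.
have := sqr_ge0 (expR (n * (p2 - p1)) - expR (n * (p1 - p00))); nra.
Qed.

Let ang (j : nat) : R := pi / 2 / 2 ^+ j.

Let ang_bd j : 0 < ang j <= pi / 2.
Proof.
have p0 : 0 < pi / 2 :> R by rewrite divr_gt0 ?pi_gt0.
have e1 : 1 <= 2 ^+ j :> R by rewrite exprn_ege1// ler1n.
by rewrite /ang divr_gt0 ?exprn_gt0//= ler_pdivrMr ?exprn_gt0// ler_peMr// ltW.
Qed.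

Let iter_doubling j : (E 1 0 1 <= E (2 ^+ j) (cos (ang j)) (sin (ang j)))%E.
Proof.
elim: j => [|j IH].
  by rewrite /ang expr0 divr1 cos_pihalf sin_pihalf.
apply: (le_trans IH).
have aE : ang j = ang j.+1 *+ 2.
  rewrite /ang exprS -mulr_natl; field.
  by rewrite expf_neq0// pnatr_eq0.
have /andP[a0 a1] := ang_bd j.+1.
have s0 : 0 < sin (ang j.+1).
  by apply: sin_gt0_pi; rewrite a0/=; have := pi_gt0 R; lra.
rewrite aE cos_mulr2n sin_mulr2n (exprS 2 j).
have cs := cos2Dsin2 (ang j.+1).
have -> : cos (ang j.+1) ^+ 2 *+ 2 - 1 = cos (ang j.+1) ^+ 2 - sin (ang j.+1) ^+ 2.
  by rewrite -cs -mulr_natl; ring.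
have -> : (cos (ang j.+1) * sin (ang j.+1)) *+ 2 = 2 * cos (ang j.+1) * sin (ang j.+1).
  by rewrite -mulr_natl mulrA.
by apply: (doubling _ cs); rewrite gt_eqF.
Qed.

Let sin_le (x : R) : 0 < x -> sin x <= x.
Proof.
move=> x0.
have cs : {within `[0, x], continuous (@sin R)}.
  by apply: continuous_subspaceT => y; exact: continuous_sin.
have [t _] := @MVT R (@sin R) (@cos R) 0 x x0 (fun t _ => is_derive_sin t) cs.
rewrite sin0 !subr0 => ->; rewrite ler_piMl ?(ltW x0)//; exact: cos_le1.
Qed.

(** The displacement is s y - (1 - c) x. As n s <= 2 the linear term in [y] stays bounded, whereas 1
    - c <= s^2 and n s^2 <= 4 h L make the part along [x] and the quadratic remainder of size h
    L. *)
Let exponent_bd n c s x y : 0 < n -> c ^+ 2 + s ^+ 2 = 1 -> 0 <= c -> 0 < s ->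
  n * s <= 2 -> 1 <= n * (h * L) ->
  n * (Phi (c *: x + s *: y) - Phi x) <=
  dot ((n * s) *: H x) y + 16 * (h * L) ^+ 2 * sqn y / (2 * h) +
  (2 * h * sqn (H x) + 10 * h * L ^+ 2 * sqn x).
Proof.
move=> n0 cs c0 s0 ns nhL.
have c1 : c <= 1 by nra.
have sc : 1 - c <= s ^+ 2 by nra.
have sc2 : (1 - c) ^+ 2 <= s ^+ 2 by nra.
have dE : c *: x + s *: y - x = s *: y - (1 - c) *: x.
  by apply/rowP => i; rewrite !mxE; ring.
have ty := taylor x (c *: x + s *: y); rewrite dE in ty.
have q1 : sqn (s *: y - (1 - c) *: x) <= 2 * s ^+ 2 * (sqn y + sqn x).
  have := sqnD_le (s *: y) (- ((1 - c) *: x)); rewrite sqnN !sqnZ.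
  have := ler_wpM2r (sqn_ge0 x) sc2; lra.
rewrite dotBr !dotZr in ty; rewrite dotZl.
have x0 := sqn_ge0 x; have y0 := sqn_ge0 y; have H0 := sqn_ge0 (H x).
have hL0 : 0 < h * L by rewrite mulr_gt0.
(* n s^2 <= 4/n <= 4 h L *)
have ns2 : n * s ^+ 2 <= 4 * (h * L).
  have nss : 0 <= n * s by rewrite mulr_ge0 ?(ltW n0) ?(ltW s0).
  have : n * (n * s ^+ 2) <= 4.
    have -> : n * (n * s ^+ 2) = (n * s) ^+ 2 by ring.
    by nra.
  have : 4 <= n * (4 * (h * L)) by lra.
  move=> a b; have := le_trans b a; by rewrite ler_pM2l.
have n1c : n * (1 - c) <= 4 * (h * L).
  by apply: le_trans ns2; rewrite ler_pM2l.
have n1c0 : 0 <= n * (1 - c) by rewrite mulr_ge0 ?(ltW n0)// subr_ge0.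
have yg : - (2 * dot (H x) x) <= L^-1 * sqn (H x) + L * sqn x.
  have Li : 0 < L^-1 by rewrite invr_gt0.
  by have := dot_young (- H x) x Li; rewrite invrK dotNl sqnN; lra.
have yg0 : 0 <= L^-1 * sqn (H x) + L * sqn x.
  by rewrite addr_ge0 ?mulr_ge0 ?invr_ge0 ?(ltW L0).
have t1 : - (n * (1 - c) * dot (H x) x) <= 2 * h * sqn (H x) + 2 * h * L ^+ 2 * sqn x.
  have -> : 2 * h * sqn (H x) + 2 * h * L ^+ 2 * sqn x =
     4 * (h * L) * ((L^-1 * sqn (H x) + L * sqn x) / 2) by field; rewrite gt_eqF.
  apply: (@le_trans _ _ (n * (1 - c) * ((L^-1 * sqn (H x) + L * sqn x) / 2))).
    by rewrite -mulrN ler_wpM2l//; lra.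
  by rewrite ler_wpM2r// divr_ge0.
have t2 : n * (L * sqn (s *: y - (1 - c) *: x)) <= 8 * h * L ^+ 2 * (sqn y + sqn x).
  apply: (@le_trans _ _ (n * (L * (2 * s ^+ 2 * (sqn y + sqn x))))).
    by rewrite !ler_pM2l.
  have -> : n * (L * (2 * s ^+ 2 * (sqn y + sqn x))) = n * s ^+ 2 * (2 * L * (sqn y + sqn x)) by ring.
  have -> : 8 * h * L ^+ 2 * (sqn y + sqn x) = 4 * (h * L) * (2 * L * (sqn y + sqn x)) by ring.
  by rewrite ler_wpM2r// !mulr_ge0 ?(ltW L0)// addr_ge0.
have t3 : 16 * (h * L) ^+ 2 * sqn y / (2 * h) = 8 * h * L ^+ 2 * sqn y.
  by field; rewrite gt_eqF.
rewrite t3; apply: (le_trans (ler_wpM2l (ltW n0) ty)).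
move: t1 t2; move: (sqn (s *: y - (1 - c) *: x)) => Z t1 t2.
have -> : n * (s * dot (H x) y - (1 - c) * dot (H x) x + L * Z) =
  n * s * dot (H x) y + - (n * (1 - c) * dot (H x) x) + n * (L * Z) by ring.
lra.
Qed.

(** At a small angle the exponent is linear in [y] up to small quadratic terms, so the integrals
    over [y] and then [x] are explicit. Their determinants contribute 16 d and 92 d times (h L)^2,
    together 108 d; the hypothesis with 184 = 2 * 92 keeps both integrals within [sqrt_inv_exp]. *)
Lemma pisier_bound :
  (dint (fun x y => (g x * g y * expR (Phi y - Phi x))%R) <=
   (expR (6 * h * B + 108 * d%:R * (h * L) ^+ 2))%:E)%E.
Proof.
have hL0 : 0 < h * L by rewrite mulr_gt0.
have hL' := hL; set eta := (h * L) ^+ 2 in hL' *.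
have eta0 : 0 <= eta by rewrite sqr_ge0.
have -> : dint (fun x y => g x * g y * expR (Phi y - Phi x)) = E 1 0 1.
  by apply: eq_dint => x y; rewrite /T scale0r add0r scale1r mul1r.
(* Finitely many halvings suffice: once n h L >= 1, the accumulated remainder is at most 8 h L^2
   (|x|^2 + |y|^2), which is of order (h L)^2 in units of the Gaussian exponent. *)
have [j jb] : exists j : nat, (h * L)^-1 <= 2 ^+ j.
  exists (Num.truncn (h * L)^-1).+1.
  apply: (@le_trans _ _ (Num.truncn (h * L)^-1).+1%:R); first by rewrite ltW// truncnS_gt.
  by rewrite -natrX ler_nat ltnW// ltn_expl.
apply: (le_trans (iter_doubling j)).
pose n : R := 2 ^+ j; rewrite -/n.
have n0 : 0 < n by rewrite exprn_gt0.
have nhL : 1 <= n * (h * L) by rewrite -ler_pdivrMr// div1r.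
have /andP[a0 a1] := ang_bd j.
have s0 : 0 < sin (ang j).
  by apply: sin_gt0_pi; rewrite a0/=; have := pi_gt0 R; lra.
have c0 : 0 <= cos (ang j).
  by apply: cos_ge0_pihalf; rewrite a1 andbT; have := pi_gt0 R; lra.
have ns : n * sin (ang j) <= 2.
  have [/andP[_ p2] _] := pihalf_02_cos_pihalf R.
  apply: le_trans p2; apply: (@le_trans _ _ (n * ang j)).
    by rewrite ler_pM2l// sin_le.
  by rewrite /ang mulrC divfK// gt_eqF.
have cs := cos2Dsin2 (ang j).
move: (cos (ang j)) (sin (ang j)) cs c0 s0 ns => c s cs c0 s0 ns.
have e1 : 16 * eta < 1 by lra.
have e2 : 92 * eta < 1 by lra.
have e16 : 16 * eta <= 2^-1 by lra.
have e92 : 92 * eta <= 2^-1 by lra.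
pose k1 := (Num.sqrt (1 - 16 * eta)) ^- d : R.
pose k2 := (Num.sqrt (1 - 92 * eta)) ^- d : R.
have k10 : 0 <= k1 by rewrite invr_ge0 exprn_ge0.
have k1e : k1 <= expR (d%:R * (16 * eta)) by apply: sqrt_inv_exp; lra.
have k2e : k2 <= expR (d%:R * (92 * eta)) by apply: sqrt_inv_exp; lra.
have ns0 : 0 <= n * s by rewrite mulr_ge0 ?(ltW n0) ?(ltW s0).
have inner x : (nint (fun y => (g x * g y * T n c s x y)%R) <=
   (k1 * expR (6 * h * B) * (g x * expR (dot 0 x + 92 * eta * sqn x / (2 * h))))%:E)%E.
  pose r := 2 * h * sqn (H x) + 10 * h * L ^+ 2 * sqn x.
  pose D y := g y * expR (dot ((n * s) *: H x) y + 16 * eta * sqn y / (2 * h)).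
  have mD : measurable_fun setT D by rewrite /D; meas.
  have D0 y : 0 <= D y := mulr_ge0 (g0 y) (expR_ge0 _).
  have mTx : measurable_fun setT (fun y => g x * g y * T n c s x y).
    exact: (measurableT_comp (mgT n c s) (pair1_measurable x)).
  have gr0 : 0 <= g x * expR r := mulr_ge0 (g0 x) (expR_ge0 _).
  apply: (@le_trans _ _ (nint (fun y => g x * expR r * D y)%R)).
    apply: le_nint => [|||y].
    - exact: mTx.
    - exact: (measurable_funM (measurable_cst _) mD).
    - by move=> y; exact: gT0.
    - have -> : g x * expR r * D y = g x * g y *
          (expR (dot ((n * s) *: H x) y + 16 * eta * sqn y / (2 * h)) * expR r).
        by rewrite /D; ring.
      apply: (ler_wpM2l (mulr_ge0 (g0 x) (g0 y))); rewrite -expRD ler_expR.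
      exact: exponent_bd.
  rewrite (nintZ mD gr0 D0) /D nint_gauss_exp// -EFinM lee_fin -/k1.
  have -> : dot 0 x = 0 by rewrite -(scale0r (0 : V)) dotZl mul0r.
  rewrite add0r sqnZ.
  have b1 : h * ((n * s) ^+ 2 * sqn (H x)) / (2 * (1 - 16 * eta)) <= 4 * h * sqn (H x).
    rewrite ler_pdivrMr; last by lra.
    have ns4 : (n * s) ^+ 2 <= 4 by nra.
    have hH : 0 <= h * sqn (H x) by rewrite mulr_ge0 ?sqn_ge0// ltW.
    have : h * sqn (H x) * (n * s) ^+ 2 <= h * sqn (H x) * 4 by rewrite ler_wpM2l.
    have : 0 <= h * sqn (H x) * (1 - 32 * eta) by rewrite mulr_ge0//; lra.
    nra.
  have b2 : 4 * h * sqn (H x) + r <= 6 * h * B + 92 * eta * sqn x / (2 * h).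
    have -> : 92 * eta * sqn x / (2 * h) = 46 * h * L ^+ 2 * sqn x.
      by rewrite /eta; field; rewrite gt_eqF.
    (* The total is 6 h |H|^2 + 10 h L^2 |x|^2, and 6 * 6 + 10 = 46 is half of 92. *)
    have := ler_wpM2l (ltW h0) (Hbd x); rewrite /r; lra.
  apply: (@le_trans _ _ (g x * expR r * (k1 * expR (4 * h * sqn (H x))))).
    by rewrite ler_wpM2l// ler_wpM2l// ler_expR.
  have -> : g x * expR r * (k1 * expR (4 * h * sqn (H x))) =
     k1 * g x * (expR (4 * h * sqn (H x)) * expR r) by ring.
  have -> : k1 * expR (6 * h * B) * (g x * expR (92 * eta * sqn x / (2 * h))) =
     k1 * g x * (expR (6 * h * B) * expR (92 * eta * sqn x / (2 * h))) by ring.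
  by rewrite -!expRD ler_wpM2l ?ler_expR// mulr_ge0// g0.
have mK : measurable_fun setT (fun x : V => g x * expR (dot 0 x + 92 * eta * sqn x / (2 * h))).
  apply: measurable_funM; first by meas.
  apply: measurable_exp; apply: measurable_funD; last by meas.
  exact: (measurable_dot (measurable_cst _) (@measurable_id _ _ setT)).
have K0 x : 0 <= g x * expR (dot 0 x + 92 * eta * sqn x / (2 * h)) :=
  mulr_ge0 (g0 x) (expR_ge0 _).
have kB : 0 <= k1 * expR (6 * h * B) := mulr_ge0 k10 (expR_ge0 _).
apply: (@le_trans _ _ (nint (fun x => k1 * expR (6 * h * B) *
    (g x * expR (dot 0 x + 92 * eta * sqn x / (2 * h))))%R)).
  rewrite nintE; apply: ge0_le_integral.
  - exact: measurableT.
  - by move=> x _; apply: nint_ge0 => y; exact: gT0.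
  - exact: (measurable_nint (mgT n c s) (gT0 n c s)).
  - by apply/measurable_EFinP; exact: (measurable_funM (measurable_cst _) mK).
  - by move=> x _; exact: inner.
rewrite (nintZ mK kB K0) nint_gauss_exp// -EFinM lee_fin -/k2.
have -> : sqn (0 : V) = 0 by rewrite -(scale0r (0 : V)) sqnZ expr2 !mul0r.
rewrite mulr0 mul0r expR0 mulr1.
have -> : expR (6 * h * B + 108 * d%:R * eta) =
   expR (d%:R * (16 * eta)) * expR (6 * h * B) * expR (d%:R * (92 * eta)).
  by rewrite -!expRD; congr expR; ring.
by rewrite ler_pM// ?invr_ge0 ?exprn_ge0// ler_wpM2r ?expR_ge0.
Qed.
End Pisier.

(** * One-step chi-square estimate *)

Section KernelBounds.
Context {R : realType} {d : nat}.
Local Notation V := 'rV[R]_d.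
Variables (h : R) (h0 : 0 < h).
Local Notation g := (gauss h).
Variables (p : V -> R) (F b : V -> V) (L e2 : R).
Hypotheses (mp : measurable_fun setT p) (p0 : forall x, 0 < p x) (ip : nint p = 1%E)
  (mb : measurable_fun setT b) (mF : measurable_fun setT F) (L0 : 0 < L) (e20 : 0 <= e2)
  (desc : forall x v, `|ln (p (x + v)) - ln (p x) - dot (F x) v| <= L * sqn v)
  (lip : forall x y, sqn (F x - F y) <= L ^+ 2 * sqn (x - y))
  (bF : forall x, sqn (b x - F x) <= e2).

Let ple x : 0 <= p x. Proof. exact: ltW. Qed.
Let g0 (x : V) : 0 <= g x := gauss_ge0 h x.

Let gauss_shift (w c : V) : g (w + h *: c) = g w * expR (- (dot w c + h * sqn c / 2)).
Proof.
rewrite !gaussE -[RHS]mulrA -expRD; apply: (congr1 (fun t => _ * expR t)).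
by rewrite sqnD sqnZ dotZr; field; rewrite gt_eqF.
Qed.

Let sqnF x : sqn (F x) <= 2 * sqn (b x) + 2 * e2.
Proof.
have -> : F x = b x - (b x - F x) by rewrite opprB addrC subrK.
by have := sqnD_le (b x) (- (b x - F x)); have := bF x; rewrite sqnN; lra.
Qed.

Let sqnb x : sqn (b x) <= 2 * sqn (F x) + 2 * e2.
Proof.
have {1}-> : b x = F x + (b x - F x) by rewrite addrC subrK.
by have := sqnD_le (F x) (b x - F x); have := bF x; lra.
Qed.

Section Excess.
Hypothesis hL : 184 * (h * L) ^+ 2 <= 1.
Variables (x y : V).
Let bx := b x.
Let o : V := y + h *: bx.
(** Centring at w = z - o makes the second half-step a standard Gaussian [g]; in this variable p(z)
    g(z - y) is g exp(-Phi), and the squared kernel over it is g exp(Phi). [H] is the gradient of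
    [Phi]. *)
Let Phi (w : V) : R := dot w bx + h * sqn bx / 2 - ln (p (w + o)).
Let H (w : V) : V := bx - F (w + o).
Let B : R := 2 * e2 + 6 * L ^+ 2 * (sqn (y - x) + h ^+ 2 * sqn bx).

Let mlnp : measurable_fun setT (fun x => ln (p x)).
Proof. exact: (measurableT_comp (@measurable_ln R)). Qed.

Let mPhi : measurable_fun setT Phi.
Proof.
have ms : measurable_fun setT (fun w : V => w + o) by exact: measurable_shift.
have ml : measurable_fun setT (fun w : V => ln (p (w + o))) := measurableT_comp mlnp ms.
by rewrite /Phi; meas.
Qed.

Let taylor w w' : Phi w' - Phi w <= dot (H w) (w' - w) + L * sqn (w' - w).
Proof.
have := desc (w + o) (w' - w).
have -> : w + o + (w' - w) = w' + o by apply/rowP => i; rewrite !mxE; ring.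
rewrite ler_norml => /andP[dl _].
rewrite /Phi /H dotBl !dotBr (dotC bx w') (dotC bx w); rewrite dotBr in dl; lra.
Qed.

Let Hbd w : sqn (H w) <= B + 6 * L ^+ 2 * sqn w.
Proof.
have -> : H w = (bx - F x) + (F x - F (w + o)).
  by rewrite /H; apply/rowP => i; rewrite !mxE; ring.
have l1 := lip x (w + o).
have oE : x - (w + o) = - ((y - x) + h *: bx + w).
  by apply/rowP => i; rewrite !mxE; ring.
rewrite oE sqnN in l1.
have s3 := sqnD3_le (y - x) (h *: bx) w; rewrite sqnZ in s3.
have s2 := sqnD_le (bx - F x) (F x - F (w + o)).
have l2 := ler_wpM2l (sqr_ge0 L) s3.
have := bF x; rewrite -/bx /B; lra.
Qed.

(** After recentring, the two factors are the Gaussian means of exp(-Phi) and exp(Phi). Their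
    product is the double integral of exp(Phi y - Phi x) that [pisier_bound] controls. *)
Lemma excess_pointwise :
  ((heat h p y)%:E * nint (fun z => (g (z - y - h *: b x) ^+ 2 / (p z * g (z - y)))%R) <=
   (expR (6 * h * B + 108 * d%:R * (h * L) ^+ 2))%:E)%E.
Proof.
have pb := pisier_bound h0 mPhi L0 hL taylor Hbd.
apply: (le_trans _ pb) => {pb}.
have po0 w : 0 < p (w + o) by exact: p0.
have eP w : expR (- Phi w) = expR (- (dot w bx + h * sqn bx / 2)) * p (w + o).
  rewrite /Phi opprB addrC expRD lnK ?posrE//.
have E1 : (heat h p y)%:E = nint (fun w => g w * expR (- Phi w)).
  rewrite -(nint_heat_kernel h0 mp ple ip y).
  refine (etrans (esym (@nint_shift _ _ (fun x => p x * g (y - x)) o _ _)) _).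
  - by meas.
  - by move=> z; exact: (mulr_ge0 (ple z) (g0 _)).
  - apply: eq_nint => w; rewrite eP mulrA -gauss_shift mulrC; apply: (congr1 (fun t => t * _)).
    rewrite -gaussN; apply: (congr1 (gauss h)).
    by apply/rowP => i; rewrite !mxE; ring.
have ePi w : expR (Phi w) = (expR (- (dot w bx + h * sqn bx / 2)) * p (w + o))^-1.
  by rewrite -eP expRN invrK.
have E2 : nint (fun z => g (z - y - h *: b x) ^+ 2 / (p z * g (z - y))) =
   nint (fun w => g w * expR (Phi w)).
  refine (etrans (esym (@nint_shift _ _
    (fun z => g (z - y - h *: b x) ^+ 2 / (p z * g (z - y))) o _ _)) _).
  - meas => z; exact: (mulr_ge0 (ple z) (g0 _)).
  - by move=> z; exact: (divr_ge0 (sqr_ge0 _) (mulr_ge0 (ple z) (g0 _))).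
  - apply: eq_nint => w.
    have -> : w + o - y - h *: b x = w by apply/rowP => i; rewrite !mxE; ring.
    have -> : w + o - y = w + h *: bx by apply/rowP => i; rewrite !mxE; ring.
    rewrite gauss_shift ePi; field.
    by rewrite (gt_eqF (po0 w)) !gt_eqF ?expR_gt0 ?gauss_gt0.
rewrite E1 E2.
have mE : measurable_fun setT (fun w => g w * expR (Phi w)) by meas.
have mE' : measurable_fun setT (fun w => g w * expR (- Phi w)) by meas.
have E0 w : 0 <= g w * expR (Phi w) := mulr_ge0 (g0 w) (expR_ge0 _).
have E'0 w : 0 <= g w * expR (- Phi w) := mulr_ge0 (g0 w) (expR_ge0 _).
rewrite [X in (X * _)%E]nintE -ge0_integralZr; last 4 first.
- exact: measurableT.
- by meas.
- by move=> w _; rewrite lee_fin.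
- exact: nint_ge0.
rewrite le_eqVlt; apply/orP; left; apply/eqP; apply: eq_integral => w _.
rewrite -(nintZ mE (E'0 w) E0); apply: eq_nint => w'.
rewrite (_ : Phi w' - Phi w = - Phi w + Phi w') ?expRD; last by ring.
by ring.
Qed.
End Excess.

(** Averaging [excess_pointwise] over the midpoint integrates exp(36 h L^2 |y - x|^2), which adds 72
    d to the 108 d already present. Passing from [b] to [F] doubles 36 to 72 and turns 12 h e2 into
    13 h e2. *)
Lemma excess_bound x : 184 * (h * L) ^+ 2 <= 1 ->
  (kernel_excess h p b x <= (expR (13 * (h * e2) + 72 * (h * L) ^+ 2 * (h * sqn (F x)) +
     180 * d%:R * (h * L) ^+ 2))%:E)%E.
Proof.
move=> hL; set eta := (h * L) ^+ 2 in hL *.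
have eta0 : 0 <= eta by exact: sqr_ge0.
pose cst0 := 12 * (h * e2) + 36 * eta * (h * sqn (b x)) + 108 * d%:R * eta.
pose K (z : V) := g z * expR (dot 0 z + 72 * eta * sqn z / (2 * h)).
have mK : measurable_fun setT K.
  apply: measurable_funM; first by meas.
  apply: measurable_exp; apply: measurable_funD; last by meas.
  exact: (measurable_dot (measurable_cst _) (@measurable_id _ _ setT)).
have K0 z : 0 <= K z := mulr_ge0 (g0 z) (expR_ge0 _).
have mKx : measurable_fun setT (fun y : V => K (y - x)).
  exact: (measurableT_comp mK (measurable_shift (- x))).
have w0 y z : 0 <= g (z - y - h *: b x) ^+ 2 / (p z * g (z - y)).
  exact: (divr_ge0 (sqr_ge0 _) (mulr_ge0 (ple z) (g0 _))).
apply: (@le_trans _ _ (nint (fun y => expR cst0 * K (y - x))%R)).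
  rewrite nintE; apply: ge0_le_integral.
  - exact: measurableT.
  - move=> y _; apply: mule_ge0; first by rewrite lee_fin.
    by apply: mule_ge0; [rewrite lee_fin; exact: (heat_ge0 h0 mp ple ip)|exact: nint_ge0].
  - apply: emeasurable_funM; first by meas.
    apply: emeasurable_funM; first by have := measurable_heat h mp ple => ?; meas.
    apply: (@measurable_nint _ _ _ _ (fun y z : V => g (z - y - h *: b x) ^+ 2 / (p z * g (z - y)))).
      by meas => z; exact: (mulr_ge0 (ple z.2) (g0 _)).
    by move=> y z; exact: w0.
  - by apply/measurable_EFinP; exact: (measurable_funM (measurable_cst _) mKx).
  move=> y _.
  apply: le_trans (lee_wpmul2l _ (excess_pointwise hL x y)) _; first by rewrite lee_fin.
  rewrite -EFinM lee_fin /K.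
  have -> : dot 0 (y - x) = 0 by rewrite -(scale0r (0 : V)) dotZl mul0r.
  rewrite add0r [leRHS]mulrCA -expRD ler_wpM2l// ler_expR /cst0.
  have -> : 72 * eta * sqn (y - x) / (2 * h) = 36 * h * L ^+ 2 * sqn (y - x).
    by rewrite /eta; field; rewrite gt_eqF.
  rewrite le_eqVlt; apply/orP; left; apply/eqP.
  by rewrite /eta; ring.
rewrite (nintZ mKx (expR_ge0 _) (fun y => K0 _)).
rewrite (_ : nint (fun y => K (y - x)) = nint K); last exact: (nint_shift _ mK K0).
have e1 : 72 * eta < 1 by lra.
rewrite nint_gauss_exp// -EFinM lee_fin.
have -> : sqn (0 : V) = 0 by rewrite -(scale0r (0 : V)) sqnZ expr2 !mul0r.
rewrite mulr0 mul0r expR0 mulr1.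
have k2 : (Num.sqrt (1 - 72 * eta)) ^- d <= expR (d%:R * (72 * eta)).
  by apply: sqrt_inv_exp; lra.
apply: le_trans (ler_wpM2l (expR_ge0 _) k2) _.
rewrite -expRD ler_expR /cst0.
have := ler_wpM2l (mulr_ge0 eta0 (ltW h0)) (sqnb x).
have : 72 * eta * (h * e2) <= h * e2.
  by rewrite ler_piMl ?mulr_ge0 ?(ltW h0)//; lra.
lra.
Qed.

Section Conjugate.
Variables (q : V -> R) (m : R).
Hypotheses (mq : measurable_fun setT q) (q0 : forall x, 0 <= q x) (iq : nint q = m%:E)
  (hL8 : 8 * (h * L) <= 1).
Local Notation g2 := (gauss (2 * h)).

Let h20 : 0 < 2 * h. Proof. by rewrite mulr_gt0. Qed.

Let ratio (v c : V) : g2 (v - h *: c) ^+ 2 / g2 v = g2 v * expR (dot c v - h * sqn c / 2).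
Proof.
have E : g2 (v - h *: c) = g2 v * expR ((dot c v - h * sqn c / 2) / 2).
  rewrite !gaussE -[RHS]mulrA -expRD; apply: (congr1 (fun t => _ * expR t)).
  by rewrite sqnB sqnZ dotZr (dotC v); field; rewrite gt_eqF.
have g20 := gauss_gt0 v h20.
have -> : expR (dot c v - h * sqn c / 2) =
   expR ((dot c v - h * sqn c / 2) / 2) ^+ 2.
  by rewrite expr2 -expRD; apply: (congr1 expR); field.
by rewrite E; field; rewrite gt_eqF.
Qed.

Let Wt x : R := expR (4 * (d%:R * (h * L)) + 3 * (h * e2) - h * sqn (F x) / 4).

(** The tilt gives exp(<b,v> - h |b|^2/2), and p(x)/p(z) at most exp(-<F,v> + L |v|^2). The linear
    terms cancel up to b - F, while the factor exp(-h |b|^2/2) survives: this is the gain in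
    |F|^2. *)
Let inner x :
  (nint (fun z => (g2 (z - x - h *: b x) ^+ 2 / (g2 (z - x) * p z))%R) <= (Wt x / p x)%:E)%E.
Proof.
have hl0 : 0 < h * L by rewrite mulr_gt0.
have h8 := hL8.
pose a := b x - F x.
pose K (v : V) := g2 v * expR (dot a v + 4 * (h * L) * sqn v / (2 * (2 * h))).
have mK : measurable_fun setT K.
  apply: measurable_funM; first by meas.
  apply: measurable_exp; apply: measurable_funD; last by meas.
  exact: (measurable_dot (measurable_cst _) (@measurable_id _ _ setT)).
have K0 v : 0 <= K v := mulr_ge0 (gauss_ge0 _ _) (expR_ge0 _).
have c0 : 0 <= expR (- (h * sqn (b x) / 2)) / p x := divr_ge0 (expR_ge0 _) (ple x).
have mKx : measurable_fun setT (fun z : V => K (z - x)).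
  exact: (measurableT_comp mK (measurable_shift (- x))).
apply: (@le_trans _ _ (nint (fun z => expR (- (h * sqn (b x) / 2)) / p x * K (z - x))%R)).
  apply: le_nint => [|||z].
  - by meas => z; exact: (mulr_ge0 (gauss_ge0 _ _) (ple z)).
  - exact: (measurable_funM (measurable_cst _) mKx).
  - by move=> z; exact: (divr_ge0 (sqr_ge0 _) (mulr_ge0 (gauss_ge0 _ _) (ple z))).
  - have -> : g2 (z - x - h *: b x) ^+ 2 / (g2 (z - x) * p z) =
      (g2 (z - x - h *: b x) ^+ 2 / g2 (z - x)) / p z by rewrite invfM mulrA.
    rewrite ratio.
    have := desc x (z - x); rewrite (addrC x) subrK ler_norml => /andP[dl _].
    set v := z - x in dl *.
    have pr : p x / p z <= expR (- dot (F x) v + L * sqn v).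
      rewrite -[leLHS]lnK ?posrE ?divr_gt0// ler_expR ln_div ?posrE//; lra.
    have -> : g2 v * expR (dot (b x) v - h * sqn (b x) / 2) / p z =
      g2 v * expR (dot (b x) v - h * sqn (b x) / 2) / p x * (p x / p z).
      by field; rewrite !gt_eqF.
    have q1 : 0 <= g2 v * expR (dot (b x) v - h * sqn (b x) / 2) / p x.
      exact: (divr_ge0 (mulr_ge0 (gauss_ge0 _ _) (expR_ge0 _)) (ple x)).
    apply: le_trans (ler_wpM2l q1 pr) _; rewrite le_eqVlt; apply/orP; left; apply/eqP.
    rewrite /K (_ : 4 * (h * L) * sqn v / (2 * (2 * h)) = L * sqn v); last by field; rewrite gt_eqF.
    have -> : g2 v * expR (dot (b x) v - h * sqn (b x) / 2) / p x *
       expR (- dot (F x) v + L * sqn v) = g2 v / p x *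
       (expR (dot (b x) v - h * sqn (b x) / 2) * expR (- dot (F x) v + L * sqn v)) by ring.
    have -> : expR (- (h * sqn (b x) / 2)) / p x * (g2 v * expR (dot a v + L * sqn v)) =
      g2 v / p x * (expR (- (h * sqn (b x) / 2)) * expR (dot a v + L * sqn v)) by ring.
    rewrite -!expRD; apply: (congr1 (fun t => _ * expR t)).
    by rewrite /a dotBl; ring.
rewrite (nintZ mKx c0 (fun y => K0 _)).
rewrite (_ : nint (fun y => K (y - x)) = nint K); last exact: (nint_shift _ mK K0).
have e1 : 4 * (h * L) < 1 by lra.
rewrite nint_gauss_exp// -EFinM lee_fin.
have k2 : (Num.sqrt (1 - 4 * (h * L))) ^- d <= expR (d%:R * (4 * (h * L))).
  by apply: sqrt_inv_exp; lra.
have k3 : expR (2 * h * sqn a / (2 * (1 - 4 * (h * L)))) <= expR (2 * (h * e2)).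
  rewrite ler_expR ler_pdivrMr; last by lra.
  have ha : h * sqn a <= h * e2 by rewrite ler_wpM2l ?(ltW h0) ?bF.
  have : 0 <= h * e2 * (1 - 8 * (h * L)) by rewrite !mulr_ge0 ?(ltW h0)//; lra.
  by nra.
have k20 : 0 <= (Num.sqrt (1 - 4 * (h * L))) ^- d by rewrite invr_ge0 exprn_ge0.
have := ler_pM k20 (expR_ge0 _) k2 k3; rewrite -expRD => k4.
apply: le_trans (ler_wpM2l c0 k4) _.
rewrite mulrAC ler_pM2r ?invr_gt0// -expRD ler_expR.
have := ler_wpM2l (ltW h0) (sqnF x); have := mulr_ge0 (ltW h0) e20; lra.
Qed.

(** Cauchy-Schwarz in [x] with the driftless Gaussian of variance 2h as weight. No contraction is
    gained, but large |F| is damped through [Wt]. *)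
Lemma conj_bound :
  (nint (fun z => (drift_step h b q z ^+ 2 / p z)%R) <= nint (fun x => (q x ^+ 2 / p x * Wt x)%R))%E.
Proof.
have mWt : measurable_fun setT Wt by rewrite /Wt; meas.
have mip : measurable_fun setT (fun x => (p x)^-1) by apply: measurable_inv.
have g2p (x z : V) : 0 < g2 (z - x) by exact: gauss_gt0.
pose K (x z : V) := q x ^+ 2 * (g2 (z - x - h *: b x) ^+ 2 / (g2 (z - x) * p z)).
have w0 (x z : V) : 0 <= g2 (z - x - h *: b x) ^+ 2 / (g2 (z - x) * p z).
  exact: (divr_ge0 (sqr_ge0 _) (mulr_ge0 (gauss_ge0 _ _) (ple z))).
have K0 x z : 0 <= K x z := mulr_ge0 (sqr_ge0 _) (w0 x z).
have mw : measurable_fun setT (fun w : V * V =>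
    g2 (w.2 - w.1 - h *: b w.1) ^+ 2 / (g2 (w.2 - w.1) * p w.2)).
  by meas => w; exact: (mulr_ge0 (gauss_ge0 _ _) (ple w.2)).
have mK : measurable_fun setT (fun w : V * V => K w.1 w.2).
  apply: measurable_funM; last exact: mw.
  by meas.
have mdr := measurable_drift_step h mq q0 mb.
apply: (@le_trans _ _ (\int[leb d]_z nint (K^~ z))%E).
  rewrite nintE; apply: ge0_le_integral.
  - exact: measurableT.
  - by move=> z _; rewrite lee_fin; exact: (divr_ge0 (sqr_ge0 _) (ple z)).
  - by meas.
  - apply: (@measurable_nint _ _ _ _ (fun z x : V => K x z)) => [|z x]; last exact: K0.
    have msw : measurable_fun setT (fun z : V * V => (z.2, z.1)) by meas.
    exact: (measurableT_comp mK msw).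
  move=> z _.
  have E x : K x z = (p z)^-1 * ((q x * g2 (z - x - h *: b x)) ^+ 2 / g2 (z - x)).
    by rewrite /K; field; rewrite !gt_eqF.
  have mf : measurable_fun setT (fun x : V => q x * g2 (z - x - h *: b x)) by meas.
  have mg2 : measurable_fun setT (fun x : V => g2 (z - x)) by meas.
  have ig2 : nint (fun x => g2 (z - x)) = 1%:E.
    rewrite -[RHS](nint_gaussB z h20); apply: eq_nint => x.
    by rewrite -gaussN opprB.
  have mi : measurable_fun setT (fun x : V => (q x * g2 (z - x - h *: b x)) ^+ 2 / g2 (z - x)).
    by meas => x; exact: gauss_ge0.
  have i0 x : 0 <= (q x * g2 (z - x - h *: b x)) ^+ 2 / g2 (z - x).
    exact: (divr_ge0 (sqr_ge0 _) (gauss_ge0 _ _)).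
  have pi0 : 0 <= (p z)^-1 by rewrite invr_ge0.
  rewrite (eq_nint E) (nintZ mi pi0 i0) mulrC EFinM.
  apply: lee_wpmul2l; first by rewrite lee_fin.
  have := nint_cs mf mg2 (fun x => mulr_ge0 (q0 x) (gauss_ge0 _ _)) (fun x => g2p x z) ltr01 ig2
    (nint_drift_kernel h0 mq q0 iq mb z).
  by rewrite divr1.
rewrite -(nint_tonelli mK K0) nintE; apply: ge0_le_integral.
- exact: measurableT.
- by move=> x _; apply: nint_ge0 => z; exact: K0.
- exact: (measurable_nint mK K0).
- by meas.
move=> x _.
have mwx := measurableT_comp mw (pair1_measurable x).
rewrite (nintZ mwx (sqr_ge0 (q x)) (w0 x)).
have -> : q x ^+ 2 / p x * Wt x = q x ^+ 2 * (Wt x / p x) by ring.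
rewrite [X in (_ <= X)%E]EFinM.
have q20 : (0 <= (q x ^+ 2)%:E)%E by rewrite lee_fin; exact: sqr_ge0.
exact: (lee_wpmul2l q20 (inner x)).
Qed.
End Conjugate.
End KernelBounds.

(** [IG] and [m2] belong to the near part, [a] stands for h e2 and [s] for the contraction rate. The
    far part has size u^4, so the factor u^-2 of the weighted square still leaves order u^2. Of c =
    16^4 only [2670 <= c] matters, to absorb the coefficient 2664 + 2. *)
Lemma one_step_arith (R : realFieldType) (u D a s Iq IG m2 : R) :
  0 <= s -> s <= 1 -> 0 <= IG -> IG <= Iq -> 0 <= m2 -> m2 <= 1 ->
  0 < u -> 1 <= D -> 10000 * u <= 1 -> 16 * (D * u) <= 1 -> 0 <= a -> 100 * a <= 1 ->
  (1 + u ^+ 2) * ((1 - s + (29 * a + 2664 * (D * u ^+ 2))) * IG + s * m2) +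
    (1 + (u ^+ 2)^-1) * (2 * (16 * u) ^+ 4 * Iq) <=
  (1 - s + (29 * a + 5 * 16 ^+ 4 * (D * u ^+ 2))) * Iq + s + u ^+ 2.
Proof.
move=> s0 s1 IG0 IGI m20 m21 u0 D1 us Dus a0 a_small.
have {us}us : 1000 * u <= 1 by lra.
have u20 : 0 < u ^+ 2 by rewrite exprn_gt0.
have u21 : u ^+ 2 <= 1 by rewrite expr_le1 ?(ltW u0)//; lra.
have Du2 : D * u ^+ 2 <= u / 16.
  have -> : D * u ^+ 2 = (D * u) * u by ring.
  by rewrite (mulrC u) ler_pM2r//; lra.
have u2D : u ^+ 2 <= D * u ^+ 2 by rewrite ler_peMl// ltW.
move: (D * u ^+ 2) => w in Du2 u2D *.
have Iq0 : 0 <= Iq by exact: le_trans IG0 IGI.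
have [c c16_ge cE] : exists2 c : R, 2670 <= c & 16 ^+ 4 = c.
  exists (256 * 256); last by ring.
  have : (16 : R) * 256 <= 256 * 256 by rewrite ler_pM2r// ler_nat.
  by apply: le_trans; lra.
have -> : (1 + (u ^+ 2)^-1) * (2 * (16 * u) ^+ 4 * Iq) = 2 * c * (u ^+ 2 * (1 + u ^+ 2) * Iq).
  rewrite exprMn cE.
  have e4 : (u ^+ 2)^-1 * u ^+ 4 = u ^+ 2.
    by rewrite (_ : u ^+ 4 = u ^+ 2 * u ^+ 2) ?mulKf ?gt_eqF// -exprD.
  transitivity (2 * c * Iq * ((u ^+ 2)^-1 * u ^+ 4 + u ^+ 4)).
    by move: ((u ^+ 2)^-1) => z; ring.
  by rewrite e4; ring.
rewrite cE; move: (u ^+ 2) => v in u20 u21 u2D *.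
set E1 := 29 * a + 2664 * w.
have E10 : 0 <= E1 by rewrite /E1; lra.
have E11 : E1 <= 1 by rewrite /E1; lra.
have E1w : E1 <= 29 * a + 2664 * w by [].
clearbody E1; clear us.
have c1 : (1 - s + E1) * IG + s * m2 <= (1 - s + E1) * Iq + s.
  have : (1 - s + E1) * IG <= (1 - s + E1) * Iq by rewrite ler_wpM2l//; lra.
  have : s * m2 <= s by rewrite ler_piMr.
  lra.
have c2 : 2 * c * (v * (1 + v) * Iq) <= 2 * c * (v * 2 * Iq).
  rewrite ler_wpM2l//; first by lra.
  by rewrite ler_wpM2r// ler_pM2l//; lra.
have c3 : (1 + v) * ((1 - s + E1) * IG + s * m2) <= (1 + v) * ((1 - s + E1) * Iq + s).
  by rewrite ler_wpM2l//; lra.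
have c4 : v * ((1 - s + E1) * Iq) <= v * (2 * Iq).
  by rewrite ler_pM2l// ler_wpM2r//; lra.
have c5 : v * s <= v by rewrite ler_piMr// ltW.
have c6 : (E1 + (4 * c + 2) * v) * Iq <= (29 * a + 5 * c * w) * Iq.
  rewrite ler_wpM2r//.
  have : (4 * c + 2) * v <= (4 * c + 2) * w by rewrite ler_wpM2l//; lra.
  have : 2670 * w <= c * w by rewrite ler_wpM2r//; lra.
  lra.
apply: (le_trans (lerD c3 c2)); lra.
Qed.

Section OneStep.
Context {R : realType} {d : nat}.
Local Notation V := 'rV[R]_d.
Variables (h : R) (h0 : 0 < h).
Variables (p : V -> R) (F b : V -> V) (L e2 k : R).
Hypotheses (mp : measurable_fun setT p) (p0 : forall x, 0 < p x) (ip : nint p = 1%E)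
  (mb : measurable_fun setT b) (mF : measurable_fun setT F) (L0 : 0 < L) (e20 : 0 <= e2)
  (desc : forall x v, `|ln (p (x + v)) - ln (p x) - dot (F x) v| <= L * sqn v)
  (lip : forall x y, sqn (F x - F y) <= L ^+ 2 * sqn (x - y))
  (bF : forall x, sqn (b x - F x) <= e2)
  (k0 : 0 < k) (k1 : k < 1).
Hypothesis contr : forall (q : V -> R) (m : R),
  measurable_fun setT q -> (forall x, 0 <= q x) -> nint q = m%:E ->
  (nint (fun y => (heat h q y ^+ 2 / heat h p y)%R) <=
   k%:E * nint (fun x => (q x ^+ 2 / p x)%R) + ((1 - k) * m ^+ 2)%:E)%E.

Let u : R := h * L.
Let D : R := d%:R.
Hypotheses (D1 : 1 <= D) (u_small : 10000 * u <= 1) (Du_small : 16 * (D * u) <= 1)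
  (he_small : 100 * (h * e2) <= 1).

Let ple x : 0 <= p x. Proof. exact: ltW. Qed.
Let D0 : 0 <= D := le_trans ler01 D1.
Let u0 : 0 < u. Proof. by rewrite mulr_gt0. Qed.
Let he0 : 0 <= h * e2. Proof. by rewrite mulr_ge0// ltW. Qed.
Let mip : measurable_fun setT (fun x => (p x)^-1).
Proof. by apply: measurable_inv. Qed.

Let t (x : V) : R := h * sqn (F x).
Let t0 x : 0 <= t x. Proof. by rewrite mulr_ge0 ?sqn_ge0// ltW. Qed.
Let mt : measurable_fun setT t. Proof. by rewrite /t; meas. Qed.

Lemma expR_le1D2x (x : R) : 0 <= x -> x <= 2^-1 -> expR x <= 1 + 2 * x.
Proof.
move=> x0 x1; have := expR_ge1Dx (- x); rewrite expRN => H.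
have e0 := expR_gt0 x.
have ei0 : 0 < (expR x)^-1 by rewrite invr_gt0.
have : expR x * (expR x)^-1 = 1 by rewrite divff// gt_eqF.
nra.
Qed.

Let X x := 13 * (h * e2) + 72 * u ^+ 2 * t x + 180 * D * u ^+ 2.
Let W x := expR (4 * (D * u) + 3 * (h * e2) - t x / 4).
Let mX : measurable_fun setT X. Proof. by rewrite /X; meas. Qed.
Let mW : measurable_fun setT W. Proof. by rewrite /W; meas. Qed.
Let lam := 288 * u.
Let E1 := 29 * (h * e2) + 2664 * (D * u ^+ 2).

Let X0 x : 0 <= X x.
Proof.
have := t0 x; have := he0; have u20 := sqr_ge0 u; move=> a b'.
have := mulr_ge0 (mulr_ge0 (ler0n R 72) u20) (t0 x).
have := mulr_ge0 (mulr_ge0 (ler0n R 180) D0) u20.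
by rewrite /X; lra.
Qed.

Let Xhalf x : t x * u <= 1 -> X x <= 2^-1.
Proof.
move=> tu; have := u0; have := t0 x; have := he_small; have := Du_small; have := u_small.
rewrite /X => a1 a2 a3 a4 a5.
have c1 : u ^+ 2 * t x <= u.
  by have := ler_wpM2l (ltW a5) tu; rewrite mulr1; lra.
have c2 : D * u ^+ 2 <= u / 16.
  have -> : D * u ^+ 2 = (D * u) * u by ring.
  by rewrite (mulrC u) ler_pM2r//; lra.
lra.
Qed.

(** The unbounded term 144 u^2 t of 2X is paid for by the damping 1 - exp(-t/4) in [W]; t u <= 1 is
    what makes 288 u a sufficient weight. In [E1], 29 = 26 + 3 and 2664 = 360 + 2304. The weight
    reappears on the right as [lam] itself, so after averaging it only slows the contraction. *)
Let mix x : t x * u <= 1 -> (1 - lam) * (2 * X x) + lam * W x <= lam + E1.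
Proof.
move=> tu.
have := u0; have := t0 x; have := he_small; have := Du_small; have := u_small; have := he0.
move=> hh a1 a2 a3 a4 a5.
have l0 : 0 <= lam by rewrite /lam; lra.
have X0x := X0 x.
have Du0 : 0 <= D * u by exact: (mulr_ge0 D0 (ltW a5)).
pose a := 4 * (D * u) + 3 * (h * e2).
have ea : expR a <= 1 + 2 * a by apply: expR_le1D2x; rewrite /a; lra.
pose y := expR (- (t x / 4)).
have y1 : y <= 1 by rewrite /y -[leRHS]expR0 ler_expR; lra.
have y0 : 0 < y by exact: expR_gt0.
have WE : W x = expR a * y by rewrite /W /y -expRD.
have Wle : W x <= y + 2 * a.
  rewrite WE; have : expR a * y <= (1 + 2 * a) * y by rewrite ler_pM2r.
  have : 0 <= a by rewrite /a; lra.
  nra.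
have yt : y * (4 + t x) <= 4.
  have := expR_ge1Dx (t x / 4).
  have yy : y * expR (t x / 4) = 1 by rewrite /y -expRD addNr expR0.
  nra.
(* lam (1 - y) >= 144 u^2 t, from 1 - y >= t/(4 + t) and u (4 + t) <= 2 *)
have yk : 144 * u ^+ 2 * t x <= lam * (1 - y).
  have c4 : 0 < 4 + t x by lra.
  rewrite -(ler_pM2r c4).
  have : 144 * u ^+ 2 * t x * (4 + t x) <= 288 * (u * t x).
    have : u * (4 + t x) <= 2 by lra.
    have ut : 0 <= u * t x by exact: (mulr_ge0 (ltW a5) a4).
    move=> /(ler_wpM2l ut); lra.
  move=> H; apply: (le_trans H); rewrite /lam.
  have : u * t x <= u * ((1 - y) * (4 + t x)).
    by rewrite ler_pM2l//; lra.
  lra.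
have s1 : (1 - lam) * (2 * X x) <= 2 * X x by nra.
have s2 : lam * W x <= lam * y + lam * (2 * a) by rewrite -mulrDr ler_wpM2l.
have s3 : lam * (2 * a) = 2304 * (D * u ^+ 2) + 1728 * u * (h * e2).
  by rewrite /lam /a; ring.
have s4 : 1728 * u * (h * e2) <= 3 * (h * e2) by rewrite ler_wpM2r//; lra.
rewrite /E1 /X; rewrite /X in s1; lra.
Qed.

Section Near.
Variables (q : V -> R) (m Iq : R).
Hypotheses (mq : measurable_fun setT q) (q0 : forall x, 0 <= q x) (iq : nint q = m%:E)
  (iI : nint (fun x => q x ^+ 2 / p x) = Iq%:E)
  (qG : forall x, t x * u <= 1 \/ q x = 0).

Let Iq0 : 0 <= Iq.
Proof. by rewrite -lee_fin -iI nint_ge0// => x; rewrite divr_ge0 ?sqr_ge0. Qed.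

(** The new functional is written as (1 - lam) times itself plus lam times itself, with
    [drift_step_chi2] and [conj_bound] applied to the two shares. The 1 in kernel_excess <= 1 + 2X
    cancels the [Iq] on the left of [drift_step_chi2]. *)
Lemma near_step : (nint (fun z => (drift_step h b q z ^+ 2 / p z)%R) <=
  ((1 - (1 - lam) * (1 - k) + E1) * Iq + (1 - lam) * (1 - k) * m ^+ 2)%:E)%E.
Proof.
have us := u_small; have u0' := u0.
have l0 : 0 <= lam by rewrite /lam; lra.
have l1 : lam <= 1 by rewrite /lam; lra.
pose r x := q x ^+ 2 / p x.
have r0 x : 0 <= r x := divr_ge0 (sqr_ge0 _) (ple x).
have mr : measurable_fun setT r by rewrite /r; meas.
have eta_small : 184 * (h * L) ^+ 2 <= 1 by rewrite -/u; nra.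
have hL8 : 8 * (h * L) <= 1 by rewrite -/u; lra.
have le1 := drift_step_chi2 h0 mp mq mb p0 q0 ip iq iI.
have le2 := conj_bound h0 mp p0 mb mF L0 e20 desc bF mq q0 iq hL8.
have le3 := contr mq q0 iq.
rewrite iI -EFinM -EFinD in le3.
pose N := nint (fun x => r x * (2 * X x)).
have rX0 x : 0 <= r x * (2 * X x) := mulr_ge0 (r0 x) (mulr_ge0 (ler0n R 2) (X0 x)).
have mrX : measurable_fun setT (fun x => r x * (2 * X x)) by meas.
have le4 : (\int[leb d]_x ((r x)%:E * kernel_excess h p b x) <= Iq%:E + N)%E.
  have -> : (Iq%:E + N)%E = nint (fun x => r x + r x * (2 * X x)).
    by rewrite nintD// -iI.
  have m1 : measurable_fun setT (fun x => (r x)%:E * kernel_excess h p b x)%E.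
    apply: emeasurable_funM; first by meas.
    exact: (measurable_kernel_excess h0 mp mb p0 ip).
  rewrite nintE; apply: ge0_le_integral.
  - exact: measurableT.
  - move=> x _; apply: mule_ge0; first by rewrite lee_fin; exact: r0.
    exact: (kernel_excess_ge0 h0 b mp p0 ip).
  - exact: m1.
  - by meas.
  move=> x _; have [tu|qx0] := qG x; last first.
    by rewrite /r qx0 expr0n/= !mul0r mul0e addr0.
  apply: (@le_trans _ _ ((r x)%:E * (1 + 2 * X x)%:E)%E).
    apply: lee_wpmul2l; first by rewrite lee_fin; exact: r0.
    apply: (le_trans (excess_bound h0 mp p0 ip L0 e20 desc lip bF x eta_small)).
    rewrite lee_fin; apply: (@expR_le1D2x (X x)); [exact: X0|exact: Xhalf].
  by rewrite -EFinM lee_fin mulrDr mulr1.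
have [A iA /andP[A0 _]] : exists2 A, N = A%:E & 0 <= A <= Iq.
  apply: nint_fin_le => //; rewrite -iI; apply: le_nint => // x.
  have [tu|qx0] := qG x; last by rewrite /r qx0 expr0n/= !mul0r.
  by rewrite ler_piMr//; have := Xhalf tu; lra.
pose M := nint (fun x => r x * W x).
have rW0 x : 0 <= r x * W x := mulr_ge0 (r0 x) (expR_ge0 _).
have [A' iA' /andP[A'0 _]] : exists2 A, M = A%:E & 0 <= A <= 2 * Iq.
  apply: nint_fin_le => //; rewrite EFinM -iI -nintZ//.
  apply: le_nint => //; [by meas|by meas|move=> x].
  rewrite mulrC ler_wpM2r//.
  have := @expR_le1D2x (4 * (D * u) + 3 * (h * e2)).
  have := Du_small; have := he_small; have := he0.
  have Du0 : 0 <= D * u by exact: (mulr_ge0 D0 (ltW u0')).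
  move=> a1 a2 a3 H.
  have : W x <= expR (4 * (D * u) + 3 * (h * e2)).
    by rewrite /W ler_expR; have := t0 x; lra.
  by have := H _ _; lra.
have J0 : (0 <= nint (fun z => (drift_step h b q z ^+ 2 / p z)%R))%E.
  by apply: nint_ge0 => z; exact: (divr_ge0 (sqr_ge0 _) (ple z)).
have le2' : (nint (fun z => (drift_step h b q z ^+ 2 / p z)%R) <= A'%:E)%E.
  by rewrite -iA'; exact: le2.
have [I' iI' /andP[I'0 I'A']] : exists2 A, nint (fun z => drift_step h b q z ^+ 2 / p z) = A%:E &
    0 <= A <= A'.
  by apply: nint_fin_le => // z; exact: (divr_ge0 (sqr_ge0 _) (ple z)).
rewrite iI' lee_fin.
have I'1 : I' + Iq <= (k * Iq + (1 - k) * m ^+ 2) + (Iq + A).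
  rewrite -lee_fin; rewrite iI' -EFinD in le1; apply: (le_trans le1).
  by rewrite EFinD; apply: leeD => //; rewrite EFinD -iA; exact: le4.
have mixI : (1 - lam) * A + lam * A' <= (lam + E1) * Iq.
  have ml1 : 0 <= 1 - lam by lra.
  have E10 : 0 <= lam + E1.
    have := he0; have : 0 <= D * u ^+ 2 by exact: (mulr_ge0 D0 (sqr_ge0 u)).
    by rewrite /E1; lra.
  rewrite -lee_fin EFinD !EFinM -iA -iA' -iI -(nintZ mrX ml1 rX0) -nintZ//; last by meas.
  rewrite -(nintZ mr E10 r0) -nintD; [|by meas|by meas| |].
  - apply: le_nint => [|||x]; [by meas|by meas| |].
    + by move=> x; exact: (addr_ge0 (mulr_ge0 ml1 (rX0 x)) (mulr_ge0 l0 (rW0 x))).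
    + have [tu|qx0] := qG x; last by rewrite /r qx0 expr0n/= !mul0r !mulr0 addr0.
      have -> : (1 - lam) * (r x * (2 * X x)) + lam * (r x * W x) =
         r x * ((1 - lam) * (2 * X x) + lam * W x) by ring.
      by rewrite (mulrC (lam + E1)) ler_wpM2l// mix.
  - by move=> x; exact: (mulr_ge0 ml1 (rX0 x)).
  - by move=> x; exact: (mulr_ge0 l0 (rW0 x)).
have f1 : (1 - lam) * I' <= (1 - lam) * (k * Iq + (1 - k) * m ^+ 2 + A).
  by rewrite ler_wpM2l//; lra.
have f2 : lam * I' <= lam * A' by rewrite ler_wpM2l.
have -> : I' = (1 - lam) * I' + lam * I' by ring.
have -> : (1 - (1 - lam) * (1 - k) + E1) * Iq + (1 - lam) * (1 - k) * m ^+ 2 =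
  (1 - lam) * (k * Iq + (1 - k) * m ^+ 2) + (lam + E1) * Iq by ring.
lra.
Qed.
End Near.

(** The fourth power of r <= exp(r) at r = t/16 gives exp(-t/4) <= (16/t)^4, and 1/t < u. This power
    is chosen to outweigh the u^-2 lost when the two parts are recombined. *)
Let far_weight x : 1 < t x * u -> W x <= 2 * (16 * u) ^+ 4.
Proof.
move=> tu; have := u0; have := t0 x; have := he_small; have := Du_small; have := he0.
move=> a1 a2 a3 a4 a5.
have Du0 : 0 <= D * u := mulr_ge0 D0 (ltW a5).
have ea : expR (4 * (D * u) + 3 * (h * e2)) <= 2.
  by apply: le_trans (expR_le1D2x _ _) _; lra.
pose y := expR (- (t x / 4)).
have y0 : 0 <= y by exact: expR_ge0.
have WE : W x = expR (4 * (D * u) + 3 * (h * e2)) * y by rewrite /W /y -expRD.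
have t16 : 0 < t x / 16 by nra.
have yt : y * (t x / 16) ^+ 4 <= 1.
  have e1 : t x / 16 <= expR (t x / 16) by have := expR_ge1Dx (t x / 16); lra.
  have e4 : (t x / 16) ^+ 4 <= expR (t x / 16) ^+ 4.
    by apply: lerXn2r; rewrite ?nnegrE ?expR_ge0 ?(ltW t16).
  apply: (le_trans (ler_wpM2l y0 e4)).
  rewrite -expRM_natl /y -expRD (_ : - (t x / 4) + _ = 0) ?expR0//; by field.
have ut : 1 <= (16 * u) ^+ 4 * (t x / 16) ^+ 4.
  rewrite -exprMn (_ : 16 * u * (t x / 16) = t x * u); last by field.
  by rewrite exprn_ege1// ltW.
have y4 : y <= (16 * u) ^+ 4.
  rewrite -(@ler_pM2r _ ((t x / 16) ^+ 4)) ?exprn_gt0//; exact: le_trans yt ut.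
by rewrite WE ler_pM// expR_ge0.
Qed.

(** The density is split where h |F|^2 crosses 1/u, and [drift_step] is linear. The near part is
    only a sub-density, which is why [near_step] carries a mass m. *)
Lemma one_step (q : V -> R) (m Iq : R) :
  measurable_fun setT q -> (forall x, 0 <= q x) -> nint q = m%:E -> m <= 1 ->
  nint (fun x => q x ^+ 2 / p x) = Iq%:E ->
  (nint (fun z => (drift_step h b q z ^+ 2 / p z)%R) <=
   ((1 - (1 - lam) * (1 - k) + (29 * (h * e2) + 5 * 16 ^+ 4 * (D * u ^+ 2))) * Iq +
    (1 - lam) * (1 - k) + u ^+ 2)%:E)%E.
Proof.
move=> mq q0 iq m1 iI.
have us := u_small; have up := u0; have k0' := k0; have k1' := k1.
have u20 : 0 < u ^+ 2 by rewrite exprn_gt0.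
have hL8 : 8 * (h * L) <= 1 by rewrite -/u; lra.
pose A : set V := (fun x => t x * u) @^-1` `]-oo, 1]%classic.
have mA : measurable A.
  rewrite -[A]setTI; have mtu : measurable_fun setT (fun x => t x * u) by meas.
  exact: (mtu measurableT _ (measurable_itv _)).
pose i x : R := \1_A x.
have mi : measurable_fun setT i by exact: measurable_indic.
have iP x : (t x * u <= 1 /\ i x = 1) \/ (1 < t x * u /\ i x = 0).
  have [tu|tu] := leP (t x * u) 1; [left|right]; split=> //; rewrite /i indicE.
    by rewrite mem_set// /A /= in_itv.
  by rewrite memNset// /A /= in_itv/= leNgt tu.
pose qG x := q x * i x.
pose qF x := q x * (1 - i x).
have mqG : measurable_fun setT qG by rewrite /qG; meas.
have mqF : measurable_fun setT qF by rewrite /qF; meas.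
have qG0 x : 0 <= qG x by rewrite /qG; have [[_ ->]|[_ ->]] := iP x; rewrite ?mulr1 ?mulr0.
have qF0 x : 0 <= qF x.
  by rewrite /qF; have [[_ ->]|[_ ->]] := iP x; rewrite ?subrr ?subr0 ?mulr1 ?mulr0.
have qGq x : qG x <= q x by rewrite /qG; have [[_ ->]|[_ ->]] := iP x; rewrite ?mulr1 ?mulr0.
have qFq x : qF x <= q x.
  by rewrite /qF; have [[_ ->]|[_ ->]] := iP x; rewrite ?subrr ?subr0 ?mulr1 ?mulr0.
have r0 (f : V -> R) x : 0 <= f x ^+ 2 / p x := divr_ge0 (sqr_ge0 _) (ple x).
have mr (f : V -> R) : measurable_fun setT f -> measurable_fun setT (fun x => f x ^+ 2 / p x).
  by move=> mf; meas.
have sub (f : V -> R) : measurable_fun setT f -> (forall x, 0 <= f x) -> (forall x, f x <= q x) ->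
    (exists2 a, nint f = a%:E & 0 <= a <= m) /\
    (exists2 a, nint (fun x => f x ^+ 2 / p x) = a%:E & 0 <= a <= Iq).
  move=> mf f0 fq; split.
    by apply: (nint_fin_le f0); rewrite -iq; exact: le_nint.
  apply: (nint_fin_le (r0 f)); rewrite -iI; apply: (le_nint (mr f mf) (mr q mq) (r0 f)) => x.
  by rewrite ler_wpM2r ?invr_ge0// ler_sqr ?nnegrE ?q0 ?f0.
have [[mG imG /andP[mG0 mGm]] [IG iIG /andP[IG0 IGI]]] := sub qG mqG qG0 qGq.
have [[mF' imF _] [IF iIF /andP[IF0 IFI]]] := sub qF mqF qF0 qFq.
have qGt x : t x * u <= 1 \/ qG x = 0.
  by rewrite /qG; have [[tu _]|[_ ->]] := iP x; [left|right; rewrite mulr0].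
have nG := near_step mqG qG0 imG iIG qGt.
have nF := conj_bound h0 mp p0 mb mF L0 e20 desc bF mqF qF0 imF hL8.
have c40 : 0 <= 2 * (16 * u) ^+ 4 by rewrite mulr_ge0// exprn_ge0// mulr_ge0// ltW.
have {}nF : (nint (fun z => (drift_step h b qF z ^+ 2 / p z)%R) <=
    (2 * (16 * u) ^+ 4 * Iq)%:E)%E.
  apply: (le_trans nF); rewrite EFinM -iI -(nintZ (mr q mq) c40 (r0 q)).
  have mqFp := mr qF mqF.
  apply: le_nint => [|||x].
  - exact: (measurable_funM mqFp mW).
  - exact: (measurable_funM (measurable_cst _) (mr q mq)).
  - by move=> x; exact: (mulr_ge0 (r0 qF x) (expR_ge0 _)).
  - rewrite /qF; have [[_ ->]|[tu ->]] := iP x.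
      by rewrite subrr mulr0 expr0n/= !mul0r mulr_ge0.
    rewrite subr0 mulr1 mulrC; apply: (ler_wpM2r (r0 q x)); exact: far_weight.
have drE z : drift_step h b q z = drift_step h b qG z + drift_step h b qF z.
  apply: EFin_inj; rewrite EFinD -(nint_drift_kernel h0 mq q0 iq mb).
  rewrite -(nint_drift_kernel h0 mqG qG0 imG mb) -(nint_drift_kernel h0 mqF qF0 imF mb).
  rewrite -nintD.
  - by apply: eq_nint => x; rewrite /qG /qF; ring.
  - by meas.
  - by meas.
  - by move=> x; exact: (mulr_ge0 (qG0 x) (gauss_ge0 _ _)).
  - by move=> x; exact: (mulr_ge0 (qF0 x) (gauss_ge0 _ _)).
have mdG := measurable_drift_step h mqG qG0 mb.
have mdF := measurable_drift_step h mqF qF0 mb.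
have mdq := measurable_drift_step h mq q0 mb.
have mrG := mr _ mdG; have mrF := mr _ mdF.
have w1 : 0 <= 1 + u ^+ 2 by lra.
have w2 : 0 <= 1 + (u ^+ 2)^-1 by rewrite addr_ge0// invr_ge0 ltW.
(* The weighted inequality (a + b)^2 <= (1 + u^2) a^2 + (1 + u^-2) b^2: the main part is charged
   only a relative u^2. *)
apply: (@le_trans _ _ ((1 + u ^+ 2)%:E * nint (fun z => (drift_step h b qG z ^+ 2 / p z)%R) +
   (1 + (u ^+ 2)^-1)%:E * nint (fun z => (drift_step h b qF z ^+ 2 / p z)%R))%E).
  rewrite -(nintZ mrG w1 (r0 _)) -(nintZ mrF w2 (r0 _)) -nintD.
  - apply: (le_nint (mr _ mdq) _ (r0 _)).
      exact: (measurable_funD (measurable_funM (measurable_cst _) mrG)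
                              (measurable_funM (measurable_cst _) mrF)).
    move=> z; rewrite drE.
    move: (drift_step h b qG z) (drift_step h b qF z) => a b'.
    have -> : (1 + u ^+ 2) * (a ^+ 2 / p z) + (1 + (u ^+ 2)^-1) * (b' ^+ 2 / p z) =
      ((1 + u ^+ 2) * a ^+ 2 + (1 + (u ^+ 2)^-1) * b' ^+ 2) / p z by ring.
    rewrite ler_pM2r ?invr_gt0// -subr_ge0.
    have -> : (1 + u ^+ 2) * a ^+ 2 + (1 + (u ^+ 2)^-1) * b' ^+ 2 - (a + b') ^+ 2 =
      (u ^+ 2 * a - b') ^+ 2 / u ^+ 2 by field; rewrite gt_eqF.
    by rewrite divr_ge0 ?sqr_ge0.
  - exact: (measurable_funM (measurable_cst _) mrG).
  - exact: (measurable_funM (measurable_cst _) mrF).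
  - by move=> z; exact: (mulr_ge0 w1 (r0 _ z)).
  - by move=> z; exact: (mulr_ge0 w2 (r0 _ z)).
have w1e : (0 <= (1 + u ^+ 2)%:E)%E by rewrite lee_fin.
have w2e : (0 <= (1 + (u ^+ 2)^-1)%:E)%E by rewrite lee_fin.
have H := leeD (lee_wpmul2l w1e nG) (lee_wpmul2l w2e nF).
apply: (le_trans H).
rewrite -!EFinM -EFinD lee_fin.
have lam0 : 0 <= lam by exact: (mulr_ge0 (ler0n R 288) (ltW up)).
have lam1 : lam <= 1 by rewrite /lam; lra.
have k1'' : 0 <= 1 - k by rewrite subr_ge0 ltW.
have lam1' : 0 <= 1 - lam by rewrite subr_ge0.
apply: (one_step_arith _ _ _ _ _ _ up D1 us Du_small he0 he_small) => //.
- exact: mulr_ge0.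
- by rewrite mulr_ile1// ?gerBl// ltW.
- exact: sqr_ge0.
- by rewrite expr_le1//; exact: le_trans mGm m1.
Qed.
End OneStep.

(** * Coupling and iteration *)

Section Coupling.
Context {R : realType} {d : nat}.
Local Notation V := 'rV[R]_d.
Variables (h : R) (h0 : 0 < h).

(** Pointwise |q K - q' K'| is at most |q - q'| K plus q' |K - K'|, and the kernels differ only
    where i = 1. There |K - K'| <= K + K', whence the factor 2. *)
Lemma nint_dist_drift_step (b b' : V -> V) (q q' i : V -> R) (m r t : R) :
  measurable_fun setT b -> measurable_fun setT b' -> measurable_fun setT i ->
  measurable_fun setT q -> (forall x, 0 <= q x) -> nint q = m%:E ->
  measurable_fun setT q' -> (forall x, 0 <= q' x) -> nint q' = m%:E ->
  (forall x, 0 <= i x) -> (forall x, b x = b' x \/ i x = 1) ->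
  nint (fun x => `|q x - q' x|) = r%:E -> nint (fun x => q' x * i x) = t%:E ->
  (nint (fun y => `|drift_step h b q y - drift_step h b' q' y|%R) <= (r + 2 * t)%:E)%E.
Proof.
move=> mb mb' mi mq q0 iq mq' q'0 iq' i0 bi ir it.
pose dl (x : V) := `|q x - q' x|.
pose w (x : V) := q' x * i x.
have mdl : measurable_fun setT dl.
  exact: (measurableT_comp (@normr_measurable R setT) (measurable_funB mq mq')).
have mw : measurable_fun setT w by exact: (measurable_funM mq' mi).
have dl0 x : 0 <= dl x by exact: normr_ge0.
have w0 x : 0 <= w x by exact: (mulr_ge0 (q'0 x) (i0 x)).
have dl1 x : q' x - q x <= dl x by rewrite /dl distrC ler_norm.
have dl2 x : q x - q' x <= dl x by rewrite /dl ler_norm.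
have wE x : w x = q' x * i x by [].
have {}ir : nint dl = r%:E by [].
have {}it : nint w = t%:E by [].
clearbody dl w.
have m1 := measurable_drift_step h mdl dl0 mb.
have m2 := measurable_drift_step h mw w0 mb.
have m3 := measurable_drift_step h mw w0 mb'.
have m4 := measurable_drift_step h mq q0 mb.
have m5 := measurable_drift_step h mq' q'0 mb'.
have g1 := drift_step_ge0 h0 mdl dl0 ir mb.
have g2 := drift_step_ge0 h0 mw w0 it mb.
have g3 := drift_step_ge0 h0 mw w0 it mb'.
have g4 := drift_step_ge0 h0 mq q0 iq mb.
have g5 := drift_step_ge0 h0 mq' q'0 iq' mb'.
have -> : (r + 2 * t)%:E = nint (fun y => drift_step h b dl y +
    (drift_step h b w y + drift_step h b' w y)).
  have A1 := nint_drift_step h0 mdl dl0 ir mb.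
  have A2 := nint_drift_step h0 mw w0 it mb.
  have A3 := nint_drift_step h0 mw w0 it mb'.
  have -> : r + 2 * t = r + (t + t) by ring.
  rewrite !EFinD -A1 -{1}A2 -A3.
  refine (esym (etrans (nintD m1 (measurable_funD m2 m3) g1 _) _)).
    by move=> y; exact: (addr_ge0 (g2 y) (g3 y)).
  exact: (congr1 (fun t => (nint (drift_step h b dl) + t)%E) (nintD m2 m3 g2 g3)).
have nm (K : V -> R) (f : V -> R) : measurable_fun setT K -> measurable_fun setT f ->
  measurable_fun setT (fun x => f x * K x) by move=> mK mf; exact: measurable_funM.
apply: le_nint => [|||y].
- exact: (measurableT_comp (@normr_measurable R setT) (measurable_funB m4 m5)).
- exact: (measurable_funD m1 (measurable_funD m2 m3)).
- by move=> y; exact: normr_ge0.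
- pose K (x : V) := gauss (2 * h) (y - x - h *: b x).
  pose K' (x : V) := gauss (2 * h) (y - x - h *: b' x).
  have mK : measurable_fun setT K by rewrite /K; meas.
  have mK' : measurable_fun setT K' by rewrite /K'; meas.
  have K0 x : 0 <= K x by exact: gauss_ge0.
  have K'0 x : 0 <= K' x by exact: gauss_ge0.
  have e1 : nint (fun x => dl x * K x) = (drift_step h b dl y)%:E
    := nint_drift_kernel h0 mdl dl0 ir mb y.
  have e2 : nint (fun x => w x * K x) = (drift_step h b w y)%:E
    := nint_drift_kernel h0 mw w0 it mb y.
  have e3 : nint (fun x => w x * K' x) = (drift_step h b' w y)%:E
    := nint_drift_kernel h0 mw w0 it mb' y.
  have e4 : nint (fun x => q x * K x) = (drift_step h b q y)%:E
    := nint_drift_kernel h0 mq q0 iq mb y.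
  have e5 : nint (fun x => q' x * K' x) = (drift_step h b' q' y)%:E
    := nint_drift_kernel h0 mq' q'0 iq' mb' y.
  have KE x : K x = K' x \/ i x = 1.
    by rewrite /K /K'; have [->|] := bi x; [left|right].
  clearbody K K'.
  have dK x : 0 <= dl x * K x := mulr_ge0 (dl0 x) (K0 x).
  have wK x : 0 <= w x * K x := mulr_ge0 (w0 x) (K0 x).
  have wK' x : 0 <= w x * K' x := mulr_ge0 (w0 x) (K'0 x).
  have qK x : 0 <= q x * K x := mulr_ge0 (q0 x) (K0 x).
  have qK' x : 0 <= q' x * K' x := mulr_ge0 (q'0 x) (K'0 x).
  have mww := measurable_funD (nm _ _ mK mw) (nm _ _ mK' mw).
  have mdw := measurable_funD (nm _ _ mK mdl) mww.
  have ww0 x : 0 <= w x * K x + w x * K' x := addr_ge0 (wK x) (wK' x).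
  have dw0 x : 0 <= dl x * K x + (w x * K x + w x * K' x) := addr_ge0 (dK x) (ww0 x).
  have eR : nint (fun x => dl x * K x + (w x * K x + w x * K' x)) =
    (drift_step h b dl y + (drift_step h b w y + drift_step h b' w y))%:E.
    rewrite (nintD (nm _ _ mK mdl) mww dK ww0) (nintD (nm _ _ mK mw) (nm _ _ mK' mw) wK wK').
    by rewrite e1 e2 e3 -!EFinD.
  have H (a c s : R) : nint (fun x => q x * K x) = a%:E -> nint (fun x => q' x * K' x) = c%:E ->
      nint (fun x => dl x * K x + (w x * K x + w x * K' x)) = s%:E -> `|a - c| <= s.
    move=> ea ec es; rewrite ler_norml lerNl opprB !lerBlDr.
    apply/andP; split; rewrite -lee_fin EFinD -ea -ec -es.
    + rewrite -(nintD mdw (nm _ _ mK mq) dw0 qK).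
      apply: (le_nint (nm _ _ mK' mq') (measurable_funD mdw (nm _ _ mK mq)) qK') => x /=.
      have := ler_wpM2r (K0 x) (dl1 x).
      have := wK x; have := wK' x; have := qK x; have := dK x; rewrite !wE.
      have [->|e] := KE x; [by lra|rewrite e].
      rewrite !mulr1; lra.
    + rewrite -(nintD mdw (nm _ _ mK' mq') dw0 qK').
      apply: (le_nint (nm _ _ mK mq) (measurable_funD mdw (nm _ _ mK' mq')) qK) => x /=.
      have := ler_wpM2r (K0 x) (dl2 x).
      have := wK x; have := wK' x; have := qK' x; have := dK x; rewrite !wE.
      have [->|e] := KE x; [by lra|rewrite e].
      rewrite !mulr1; lra.
  exact: (H _ _ _ e4 e5 eR).
Qed.

(** The mass that an iterate puts on the exceptional set. [e] and [T] are upper bounds for the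
    square roots in Cauchy-Schwarz. *)
Lemma nint_cs_weight (p q i : V -> R) (I P e T : R) :
  measurable_fun setT p -> (forall x, 0 < p x) ->
  measurable_fun setT q -> (forall x, 0 <= q x) ->
  measurable_fun setT i -> (forall x, 0 <= i x <= 1) ->
  nint (fun x => q x ^+ 2 / p x) = I%:E -> nint (fun x => p x * i x) = P%:E ->
  0 < e -> 0 < T -> P <= e ^+ 2 -> I <= T ^+ 2 ->
  (nint (fun x => (q x * i x)%R) <= (e * T)%:E)%E.
Proof.
move=> mp p0 mq q0 mi i01 iI iP e0 T0 Pe IT.
have ple x : 0 <= p x by exact: ltW.
have i0 x : 0 <= i x by case/andP: (i01 x).
have mip : measurable_fun setT (fun x => (p x)^-1) by apply: measurable_inv.
have a0 : 0 <= e / T / 2 by rewrite !divr_ge0// ltW.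
have b0 : 0 <= T / e / 2 by rewrite !divr_ge0// ltW.
have f0 x : 0 <= q x ^+ 2 / p x := divr_ge0 (sqr_ge0 _) (ple x).
have g0 x : 0 <= p x * i x := mulr_ge0 (ple x) (i0 x).
have mf : measurable_fun setT (fun x => q x ^+ 2 / p x) by meas.
have mg : measurable_fun setT (fun x => p x * i x) by meas.
apply: (@le_trans _ _ ((e / T / 2)%:E * I%:E + (T / e / 2)%:E * P%:E)%E); last first.
  rewrite -!EFinM -EFinD lee_fin.
  have -> : e * T = e / T / 2 * T ^+ 2 + T / e / 2 * e ^+ 2.
    by field; rewrite !gt_eqF.
  by rewrite lerD// ler_wpM2l.
rewrite -iI -iP -(nintZ mf a0 f0) -(nintZ mg b0 g0) -nintD.
- apply: le_nint => [|||x]; [by meas|by meas|by move=> x; rewrite mulr_ge0|].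
  have /andP[j0 j1] := i01 x; have px := p0 x.
  (* AM-GM with weights chosen so that both terms are at most eT/2 *)
  have ii : i x ^+ 2 <= i x by rewrite expr2 ler_piMl.
  have H : T / e / 2 * (p x * i x ^+ 2) <= T / e / 2 * (p x * i x).
    by rewrite ler_wpM2l// ler_pM2l.
  apply: le_trans (lerD (lexx _) H); rewrite -subr_ge0.
  have -> : e / T / 2 * (q x ^+ 2 / p x) + T / e / 2 * (p x * i x ^+ 2) - q x * i x =
     (e * q x - T * p x * i x) ^+ 2 / (2 * e * T * p x).
    by field; rewrite !gt_eqF.
  by rewrite divr_ge0 ?sqr_ge0// !mulr_ge0// ltW.
- by meas.
- by meas.
- by move=> x; exact: (mulr_ge0 a0 (f0 x)).
- by move=> x; exact: (mulr_ge0 b0 (g0 x)).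
Qed.
End Coupling.

Section Iterates.
Context {R : realType} {d : nat}.
Local Notation V := 'rV[R]_d.
Variables (h : R) (h0 : 0 < h).

Lemma drift_iterP (b : V -> V) (q : V -> R) (m : R) (k : nat) :
  measurable_fun setT b -> measurable_fun setT q -> (forall x, 0 <= q x) -> nint q = m%:E ->
  [/\ measurable_fun setT (iter k (drift_step h b) q),
      forall x, 0 <= iter k (drift_step h b) q x & nint (iter k (drift_step h b) q) = m%:E].
Proof.
move=> mb mq q0 iq; elim: k => [|k [mk k0 ik]]; first by split.
split=> /=.
- exact: (measurable_drift_step h mk k0 mb).
- exact: (drift_step_ge0 h0 mk k0 ik mb).
- exact: (nint_drift_step h0 mk k0 ik mb).
Qed.

Lemma lmc_density_iter (b : V -> V) (q : V -> R) (m : R) (k : nat) :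
  measurable_fun setT b -> measurable_fun setT q -> (forall x, 0 <= q x) -> nint q = m%:E ->
  lmc_density b h q k = iter k (drift_step h b) q.
Proof.
move=> mb mq q0 iq; elim: k => [//|k IH]; apply/funext => y.
have [mk k0 ik] := drift_iterP k mb mq q0 iq.
rewrite /= IH; set qk := iter k _ q in mk k0 ik *.
apply: EFin_inj; rewrite -(nint_drift_kernel h0 mk k0 ik mb y).
have e : lebint (fun x => (qk x * gauss (2 * h) (y - x - h *: b x))%:E) =
         nint (fun x => qk x * gauss (2 * h) (y - x - h *: b x)).
  apply: lebint_nint => [|x]; first by meas.
  exact: (mulr_ge0 (k0 x) (gauss_ge0 _ _)).
by rewrite e (nint_drift_kernel h0 mk k0 ik mb y).
Qed.

(** Half of the rate s absorbs the errors: since eta <= 1, E <= s/2, and the constant part E + v <=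
    s eta/2 is exactly what keeps eta invariant under the recursion. *)
Lemma chi2_iter (p : V -> R) (b : V -> V) (q : V -> R) (s E v eta K2 I0 : R) :
  (forall x, 0 < p x) -> measurable_fun setT b ->
  measurable_fun setT q -> (forall x, 0 <= q x) -> nint q = 1%:E ->
  (forall (f : V -> R) (I : R), measurable_fun setT f -> (forall x, 0 <= f x) ->
    nint f = 1%:E -> nint (fun x => f x ^+ 2 / p x) = I%:E ->
    (nint (fun z => (drift_step h b f z ^+ 2 / p z)%R) <= ((1 - s + E) * I + s + v)%:E)%E) ->
  0 <= s -> s <= 1 -> 0 <= E -> 0 <= v -> 0 <= eta -> eta <= 1 -> 0 <= K2 ->
  E + v <= s * eta / 2 ->
  nint (fun x => q x ^+ 2 / p x) = I0%:E -> I0 <= 1 + K2 ->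
  forall k, exists2 I, nint (fun x => iter k (drift_step h b) q x ^+ 2 / p x) = I%:E &
    I <= 1 + (1 - s / 2) ^+ k * K2 + eta.
Proof.
move=> p0 mb mq q0 iq step s0 s1 E0 v0 eta0 eta1 K20 Ev iI0 I0K.
elim=> [|k [I iI IH]]; first by exists I0; rewrite ?expr0 ?mul1r//; lra.
have [mk k0 ik] := drift_iterP k mb mq q0 iq.
have le1 := step _ _ mk k0 ik iI.
have f0 x : 0 <= iter k.+1 (drift_step h b) q x ^+ 2 / p x.
  exact: (divr_ge0 (sqr_ge0 _) (ltW (p0 x))).
have [I' iI' /andP[_ I'le]] := nint_fin_le f0 le1.
exists I'; first exact: iI'.
apply: (le_trans I'le).
have X0 : 0 <= (1 - s / 2) ^+ k * K2 by rewrite mulr_ge0// exprn_ge0//; lra.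
rewrite exprS -mulrA; move: (_ ^+ k * _) => X in IH X0 *.
have seta : s * eta <= s by rewrite ler_piMr.
have c0 : 0 <= 1 - s + E by lra.
have := ler_wpM2l c0 IH.
have : E * (X + eta) <= s / 2 * (X + eta) by rewrite ler_wpM2r//; lra.
lra.
Qed.

Lemma nint_dist_iter (b b' : V -> V) (q i : V -> R) (t : nat -> R) :
  measurable_fun setT b -> measurable_fun setT b' ->
  measurable_fun setT i -> (forall x, 0 <= i x) -> (forall x, b x = b' x \/ i x = 1) ->
  measurable_fun setT q -> (forall x, 0 <= q x) -> nint q = 1%:E ->
  (forall k, nint (fun x => (iter k (drift_step h b') q x * i x)%R) <= (t k)%:E)%E ->
  forall k, (nint (fun x => `|iter k (drift_step h b) q x - iter k (drift_step h b') q x|%R) <=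
    (2 * \sum_(j < k) t j)%:E)%E.
Proof.
move=> mb mb' mi i0 bi mq q0 iq ht; elim=> [|k IH].
  rewrite big_ord0 mulr0 /= (@eq_nint _ _ _ (fun=> 0)) => [|x]; last by rewrite subrr normr0.
  by rewrite nintE integral0.
have [mk k0 ik] := drift_iterP k mb mq q0 iq.
have [mk' k0' ik'] := drift_iterP k mb' mq q0 iq.
have [r ir /andP[_ rle]] := nint_fin_le (fun x => normr_ge0 _) IH.
have [a ia /andP[_ ale]] := nint_fin_le (fun x => mulr_ge0 (k0' x) (i0 x)) (ht k).
apply: (le_trans (nint_dist_drift_step h0 mb mb' mi mk k0 ik mk' k0' ik' i0 bi ir ia)).
by rewrite lee_fin big_ord_recr /= mulrDr lerD// ler_pM2l.
Qed.
End Iterates.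

(** * Numerical constraints: step size, contraction rate and error budget *)

Section StepSize.
Context {R : realType}.
Variables (h L C D w a2 : R).
Hypotheses (h0 : 0 < h) (L1 : 1 <= L) (C1' : 1 <= C) (D1 : 1 <= D) (w0 : 0 < w) (w1 : w <= 1)
  (a20 : 0 < a2) (a2_small : 60 * (60 * (10 * a2)) <= 1) (ca2_small : 60 * (60 * (10 * (16 ^+ 4 * a2))) <= 1)
  (hle : h * (D * L ^+ 2 * C) <= a2 * w).

Let u := h * L.
(** The square of the truncation threshold eps_chi / (500 sqrt C). In this section and in
    [decay_bound], [w] is eps_chi^2; in [budget] and [lmc_coupled] it is eps_chi. *)
Let e2 := (500^-1 * Num.sqrt w / Num.sqrt C) ^+ 2.
Let k := kap h (5 * C).
Let s := (1 - 288 * u) * (1 - k).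

Let C0 : 0 < C. Proof. exact: lt_le_trans C1'. Qed.
Let D0 : 0 < D. Proof. exact: lt_le_trans D1. Qed.
Let L0 : 0 < L. Proof. exact: lt_le_trans L1. Qed.

Let Du_le : D * u <= a2 * w.
Proof.
apply: le_trans hle; rewrite /u mulrCA ler_pM2l// -mulrA ler_pM2l//.
by rewrite expr2 -mulrA ler_peMr ?(ltW L0)// mulr_ege1.
Qed.

Let u0 : 0 < u. Proof. by rewrite mulr_gt0. Qed.

Let a2w_small : 10000 * (a2 * w) <= 1.
Proof.
have : a2 * w <= a2 by rewrite ler_piMr// ltW.
have := a2_small; lra.
Qed.

Let u_le : u <= D * u. Proof. by rewrite ler_peMl// ltW. Qed.

Let h1 : h <= 1.
Proof.
have : h <= u by rewrite /u ler_peMr// ltW.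
have := u_le; have := Du_le; have := a2w_small; lra.
Qed.

Let y := h * w / C.
Let y0 : 0 < y. Proof. by rewrite divr_gt0// mulr_gt0. Qed.

Let he2E : h * e2 = (500 * 500)^-1 * y.
Proof.
rewrite /e2 /y !exprMn !exprVn !sqr_sqrtr ?(ltW w0) ?(ltW C0)// expr2.
by field; rewrite gt_eqF.
Qed.

Let y1 : y <= 1.
Proof.
rewrite /y ler_pdivrMr// mul1r; apply: le_trans C1'.
by rewrite mulr_ile1// ltW.
Qed.

Lemma step_small : [/\ 10000 * u <= 1, 16 * (D * u) <= 1 & 100 * (h * e2) <= 1].
Proof.
have := u_le; have := Du_le; have := a2w_small; have := u0; have := y1; rewrite he2E.
by move=> *; split; lra.
Qed.

(** The Poincare constant 5 C gives 1 - k = h/(h + 80 C), at least h/(81 C) because h <= 1 <= C. The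
    factor 1 - 288 u >= 1/2 doubles 81 to 162. *)
Lemma rate_bounds : h / (162 * C) <= s <= 1.
Proof.
have [us _ _] := step_small; have u0' := u0.
have {us}us : 288 * u <= 2^-1 by lra.
have kE : 1 - k = h / (h + 80 * C).
  by rewrite /k /kap; field; rewrite !gt_eqF//= !addr_gt0// !mulr_gt0.
have hC0 : 0 < h + 80 * C by rewrite addr_gt0// mulr_gt0.
have k_ge : h / (81 * C) <= 1 - k.
  rewrite kE ler_pM2l// lef_pV2 ?posrE//; last by rewrite mulr_gt0.
  by have := h1; have := C1'; lra.
have k_le : 1 - k <= 1.
  by rewrite kE ler_pdivrMr// mul1r lerDl mulr_ge0// ltW.
have k_ge0 : 0 <= 1 - k by rewrite kE divr_ge0// ltW.
have l0 : 0 <= 1 - 288 * u by lra.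
have l1 : 1 - 288 * u <= 1 by lra.
apply/andP; split; last exact: (mulr_ile1 l0 k_ge0 l1 k_le).
have -> : h / (162 * C) = 2^-1 * (h / (81 * C)) by field; rewrite gt_eqF.
have hC81 : 0 <= h / (81 * C) by rewrite divr_ge0 ?mulr_ge0// ltW.
by rewrite /s ler_pM//; lra.
Qed.

(** Every error is measured against y = h w/C, the rate times the target up to constants. The step
    size enters through D u^2 = h (D L^2 C) (h/C) <= a2 y. The right side is at least y/2592, while
    the left is at most (29/250000 + 6/36000) y. *)
Lemma error_small : 29 * (h * e2) + 5 * 16 ^+ 4 * (D * u ^+ 2) + u ^+ 2 <= s * (w / 8) / 2.
Proof.
have Du2 : D * u ^+ 2 <= a2 * y.
  have -> : D * u ^+ 2 = h * (D * L ^+ 2 * C) * (h / C).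
    by rewrite /u; field; rewrite gt_eqF.
  have -> : a2 * y = a2 * w * (h / C) by rewrite /y; ring.
  by rewrite ler_wpM2r// divr_ge0// ltW.
have u2D : u ^+ 2 <= D * u ^+ 2 by rewrite ler_peMl// sqr_ge0.
have Du20 : 0 <= D * u ^+ 2 by rewrite mulr_ge0 ?sqr_ge0// ltW.
have /andP[s_ge _] := rate_bounds.
have sw : y / 162 <= s * w.
  have -> : y / 162 = h / (162 * C) * w by rewrite /y; field; rewrite gt_eqF.
  by rewrite ler_pM2r.
have y0' := y0.
have y0l := ltW y0'.
have c1 : 60 * (60 * (10 * (16 ^+ 4 * (D * u ^+ 2)))) <= y.
  have -> : 60 * (60 * (10 * (16 ^+ 4 * (D * u ^+ 2)))) =
    60 * (60 * (10 * 16 ^+ 4)) * (D * u ^+ 2) by rewrite !mulrA.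
  have c160 : 0 <= 60 * (60 * (10 * 16 ^+ 4)) :> R.
    by rewrite !(mulr_ge0 (ler0n _ _))// exprn_ge0// ler0n.
  apply: (le_trans (ler_wpM2l c160 Du2)).
  have -> : 60 * (60 * (10 * 16 ^+ 4)) * (a2 * y) =
    60 * (60 * (10 * (16 ^+ 4 * a2))) * y by rewrite !mulrA.
  exact: (ler_piMl y0l ca2_small).
have c2 : 60 * (60 * (10 * (a2 * y))) <= y.
  have -> : 60 * (60 * (10 * (a2 * y))) = 60 * (60 * (10 * a2)) * y by rewrite !mulrA.
  exact: (ler_piMl y0l a2_small).
have -> : s * (w / 8) / 2 = s * w / 16 by field.
have c3 : 500 * (500 * (h * e2)) = y.
  by rewrite he2E; move: (y) => z; field.
move: c1 c2 c3 Du2 u2D sw y0'; rewrite -(mulrA 5).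
move: (h * e2) (16 ^+ 4 * (D * u ^+ 2)) (D * u ^+ 2) (u ^+ 2) (a2 * y) (s * w) (y) => H A B B' G S z.
lra.
Qed.
End StepSize.

Section Budget.
Context {R : realType}.

Lemma sum_geometric_le (s K : R) (N : nat) : 0 < s -> s <= 1 -> 0 <= K ->
  \sum_(j < N) (2 + (1 - s / 4) ^+ j * K) <= 2 * N%:R + 4 * K / s.
Proof.
move=> s0 s1 K0; rewrite big_split /= sumr_const card_ord -mulr_suml.
rewrite -[2 *+ N]mulr_natr lerD2l mulrAC ler_wpM2r//.
have e := subrX1 (1 - s / 4) N.
have : 0 <= (1 - s / 4) ^+ N by rewrite exprn_ge0//; lra.
move: (\sum_(j < N) _) e => S e q0.
rewrite ler_pdivlMr//; lra.
Qed.

(** A root-free upper bound for the square root of the chi-square estimate, needed as [T] in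
    [nint_cs_weight]. The rate halves because 1 - s/2 <= (1 - s/4)^2. *)
Lemma sqr_bound (s K eta : R) (j : nat) : 0 < s -> s <= 1 -> 0 <= K -> eta <= 1 ->
  1 + (1 - s / 2) ^+ j * K ^+ 2 + eta <= (2 + (1 - s / 4) ^+ j * K) ^+ 2.
Proof.
move=> s0 s1 K0 eta1.
have c : (1 - s / 2) ^+ j <= ((1 - s / 4) ^+ j) ^+ 2.
  rewrite -exprM mulnC exprM lerXn2r ?nnegrE ?sqr_ge0//; first by lra.
  by have := sqr_ge0 (s / 4); lra.
have r0 : 0 <= (1 - s / 4) ^+ j by rewrite exprn_ge0//; lra.
have := ler_wpM2r (sqr_ge0 K) c.
move: (_ ^+ j * K ^+ 2) (_ ^+ j) r0 => A r r0; have := mulr_ge0 r0 K0.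
nra.
Qed.

(** As 648 = 4 * 162, the running time gives N s >= 4 ln r, so the decay factor is at most r^-2;
    with r = 2K/w this leaves w^2/4 <= w/4. *)
Lemma decay_bound (h s C K w : R) (N : nat) : 0 < h -> 1 <= C -> 0 < w -> w <= 1 -> w < 2 * K ->
  h / (162 * C) <= s -> s <= 1 -> 648 * (C * ln (2 * K / w)) <= N%:R * h ->
  (1 - s / 2) ^+ N * K ^+ 2 <= w / 4.
Proof.
move=> h0 C1 w0 w1 wK hs s1 Nh.
have C0 : 0 < C by lra.
have K0 : 0 < K by lra.
set r := 2 * K / w in Nh.
have r0 : 0 < r by rewrite divr_gt0// mulr_gt0.
have e1 : (1 - s / 2) ^+ N <= expR (- (2 * ln r)).
  apply: (@le_trans _ _ (expR (- (s / 2)) ^+ N)).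
    rewrite lerXn2r ?nnegrE ?expR_ge0//; first by lra.
    by have := expR_ge1Dx (- (s / 2)); lra.
  rewrite -expRM_natl ler_expR mulrN lerN2.
  have : N%:R * (h / (162 * C)) <= N%:R * s by rewrite ler_wpM2l.
  have -> : N%:R * (h / (162 * C)) = N%:R * h / (162 * C) by rewrite mulrA.
  rewrite ler_pdivrMr ?mulr_gt0// => H.
  rewrite -(ler_pM2r C0); lra.
have e2 : expR (- (2 * ln r)) = (r ^+ 2)^-1.
  by rewrite expRN -[2 * _]/(2%:R * _) expRM_natl lnK.
apply: (le_trans (ler_wpM2r (sqr_ge0 K) e1)); rewrite e2.
have -> : (r ^+ 2)^-1 * K ^+ 2 = w ^+ 2 / 4 by rewrite /r; field; rewrite !gt_eqF.
by rewrite ler_pM2r// expr2 ler_piMl// ltW.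
Qed.

(** The left factor is at most h tv / (40 * 81 C M). The running time contributes 2 * 1296 C l and
    the initial transient 648 C K, and 2592 + 648 = 40 * 81. These two contributions are the origin
    of the maximum [M]. *)
Lemma budget (a1 h s L C D K w tv l M : R) (N : nat) :
  0 < a1 -> 0 < h -> 1 <= L -> 1 <= C -> 1 <= D -> 0 < w -> 0 < K -> 0 < tv -> 0 < s ->
  a1 * (w ^+ 2 / (D * L ^+ 2 * C)) <= h -> h / (162 * C) <= s ->
  N%:R * h <= 1296 * (C * l) -> l <= M -> K <= M ->
  (a1 * 500^-1 / (40 * 81) * (tv * w ^+ 3 / (D * L ^+ 2 * (C ^+ 2 * Num.sqrt C) * M))) /
    (500^-1 * w / Num.sqrt C) * (2 * N%:R + 4 * K / s) <= tv.
Proof.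
move=> a10 h0 L1 C1 D1 w0 K0 tv0 s0 ah hs Nh lM KM.
have C0 : 0 < C by lra.
have L0 : 0 < L by lra.
have D0 : 0 < D by lra.
have M0 : 0 < M by lra.
have sC0 : 0 < Num.sqrt C by rewrite sqrtr_gt0.
have -> : (a1 * 500^-1 / (40 * 81) * (tv * w ^+ 3 / (D * L ^+ 2 * (C ^+ 2 * Num.sqrt C) * M))) /
    (500^-1 * w / Num.sqrt C) =
    a1 * (w ^+ 2 / (D * L ^+ 2 * C)) * tv / ((40 * 81) * (C * M)).
  by field; rewrite !gt_eqF.
have X0 : 0 <= 2 * N%:R + 4 * K / s.
  by rewrite addr_ge0 ?mulr_ge0 ?invr_ge0// ltW.
have CM0 : 0 < (40 * 81) * (C * M) by rewrite !mulr_gt0.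
set A := a1 * _ in ah *; set X := 2 * N%:R + _ in X0 *; set Z := 40 * 81 * _ in CM0 *.
have -> : A * tv / Z * X = A * X / Z * tv by ring.
rewrite ler_piMl ?(ltW tv0)// ler_pdivrMr// mul1r /X /Z.
apply: (@le_trans _ _ (h * (2 * N%:R + 4 * K / s))); first by rewrite ler_wpM2r.
have Ks : h * (4 * K / s) <= 648 * (C * K).
  rewrite mulrA ler_pdivrMr//.
  move: hs; rewrite ler_pdivrMr ?mulr_gt0// => hs.
  have := ler_wpM2l (ltW K0) hs; lra.
have := ler_wpM2l (ltW C0) lM; have := ler_wpM2l (ltW C0) KM.
lra.
Qed.
End Budget.

(** * Guarantee for the estimated score *)

Section Guarantee.
Context {R : realType} {d : nat}.
Local Notation V := 'rV[R]_d.

(* The score is replaced by the exact one where its error exceeds [e]; by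
   Markov's inequality this changes it on a set of small [p]-measure. *)
Lemma score_truncation (p : V -> R) (F b : V -> V) (eps e : R) :
  measurable_fun setT p -> (forall x, 0 < p x) ->
  measurable_fun setT F -> measurable_fun setT b -> 0 < e ->
  (nint (fun x => (p x * sqn (F x - b x))%R) <= (eps ^+ 2)%:E)%E ->
  exists (b' : V -> V) (i : V -> R) (P : R),
    [/\ measurable_fun setT b', measurable_fun setT i & forall x, 0 <= i x <= 1] /\
    [/\ forall x, b x = b' x \/ i x = 1, forall x, sqn (b' x - F x) <= e ^+ 2,
        nint (fun x => p x * i x) = P%:E & P <= (eps / e) ^+ 2].
Proof.
move=> mp p0 mF mb e0 err.
have ple x : 0 <= p x by exact: ltW.
pose r (x : V) := sqn (F x - b x).
have mr : measurable_fun setT r by rewrite /r; meas.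
pose B : set V := r @^-1` `]e ^+ 2, +oo[%classic.
have mB : measurable B by rewrite -[B]setTI; exact: (mr measurableT _ (measurable_itv _)).
pose i x : R := \1_B x.
have mi : measurable_fun setT i by exact: measurable_indic.
have iP x : (r x <= e ^+ 2 /\ i x = 0) \/ (e ^+ 2 < r x /\ i x = 1).
  have [re|re] := leP (r x) (e ^+ 2); [left|right]; split=> //; rewrite /i indicE.
    by rewrite memNset// /B /= in_itv/= andbT => /(le_lt_trans re); rewrite ltxx.
  by rewrite mem_set// /B /= in_itv/= andbT.
have i01 x : 0 <= i x <= 1 by have [[_ ->]|[_ ->]] := iP x; rewrite ?lexx ?ler01.
pose b' x := b x + i x *: (F x - b x).
have mcoord (f : V -> V) j : measurable_fun setT f -> measurable_fun setT (fun x => f x ord0 j).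
  by move=> mf; exact: (measurableT_comp (@measurable_coord R d j) mf).
have mb' : measurable_fun setT b'.
  apply: measurable_rV => j.
  rewrite (_ : (fun _ => _) = fun x => b x ord0 j + i x * (F x ord0 j - b x ord0 j)).
    apply: measurable_funD; first exact: mcoord.
    by apply: measurable_funM => //; apply: measurable_funB; exact: mcoord.
  by apply/funext => x; rewrite !mxE.
have m1 : measurable_fun setT (fun x => p x * i x) by meas.
have m2 : measurable_fun setT (fun x => p x * r x) by meas.
have r0 x : 0 <= r x by exact: sqn_ge0.
have pi0 x : 0 <= p x * i x by case/andP: (i01 x) => j0 _; exact: (mulr_ge0 (ple x) j0).
have e20 : 0 < e ^+ 2 by rewrite exprn_gt0.
have ei0 : 0 <= (e ^+ 2)^-1 by rewrite invr_ge0 ltW.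
have [P iP' /andP[_ Ple]] : exists2 P, nint (fun x => p x * i x) = P%:E & 0 <= P <= (eps / e) ^+ 2.
  apply: (nint_fin_le pi0).
  have pr0 x : 0 <= p x * r x by exact: (mulr_ge0 (ple x) (r0 x)).
  apply: (@le_trans _ _ ((e ^+ 2)^-1%:E * nint (fun x => p x * r x)%R)%E).
    rewrite -(nintZ m2 ei0 pr0); apply: (le_nint m1 _ pi0).
      exact: (measurable_funM (measurable_cst _) m2).
    move=> x; rewrite mulrCA ler_pM2l//.
    have [[_ ->]|[re ->]] := iP x; first exact: (mulr_ge0 ei0 (r0 x)).
    by rewrite mulrC ler_pdivlMr// mul1r ltW.
  have eiE : (0 <= (e ^+ 2)^-1%:E)%E by rewrite lee_fin.
  apply: (le_trans (lee_wpmul2l eiE err)).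
  by rewrite -EFinM lee_fin exprMn exprVn mulrC.
exists b', i, P; split; split=> // x.
- by rewrite /b'; have [[_ ->]|[_ ->]] := iP x; [left; rewrite scale0r addr0|right].
- rewrite /b'; have [[re ->]|[_ ->]] := iP x.
    by rewrite scale0r addr0 -sqnN opprB.
  have -> : b x + 1 *: (F x - b x) - F x = 0 *: F x.
    by rewrite scale1r addrCA subrr addr0 subrr scale0r.
  by rewrite sqnZ expr0n/= mul0r ltW.
Qed.

Variables (p p0 : V -> R) (s : V -> V) (L C eps tv w K h a1 a2 : R) (N : nat).
Let F := grad (fun x => ln (p x)).
Let r := ln (2 * K / w ^+ 2).
Let M := Num.max r K.
Hypotheses (d0 : (0 < d)%N) (dp : is_density p) (pp : forall x, 0 < p x)
  (cp : C1 (fun x => ln (p x))) (L1 : 1 <= L) (LipF : lipschitz_e L F)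
  (C1' : 1 <= C) (lsi : LSI p C) (ms : measurable_fun setT s)
  (err : (nint (fun x => (p x * sqn (F x - s x))%R) <= (eps ^+ 2)%:E)%E)
  (eps0 : 0 <= eps) (tv0 : 0 < tv) (w0 : 0 < w) (w1 : w < 1) (wK : w ^+ 2 < 2 * K)
  (mp0 : measurable_fun setT p0) (p00 : forall x, 0 <= p0 x) (ip0 : nint p0 = 1%E)
  (chi0 : (nint (fun x => (p0 x ^+ 2 / p x)%R) <= (1 + K ^+ 2)%:E)%E)
  (a10 : 0 < a1) (a20 : 0 < a2) (a2_small : 60 * (60 * (10 * a2)) <= 1)
  (ca2_small : 60 * (60 * (10 * (16 ^+ 4 * a2))) <= 1)
  (eps_le : eps <= a1 * 500^-1 / (40 * 81) *
     (tv * w ^+ 3 / (d%:R * L ^+ 2 * (C ^+ 2 * Num.sqrt C) * M)))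
  (h_ge : a1 * (w ^+ 2 / (d%:R * L ^+ 2 * C)) <= h)
  (h_le : h <= a2 * (w ^+ 2 / (d%:R * L ^+ 2 * C)))
  (T_ge : 648 * (C * r) <= N%:R * h) (T_le : N%:R * h <= 1296 * (C * r)).

(** The witness is the N-th iterate of the chain driven by the truncated score, started from the
    same [p0], so the distance comes only from visits to the exceptional set. The bound is [2 * tv]
    because the distance is in L^1. *)
Lemma lmc_coupled : exists (q : V -> R) (I : R),
  [/\ measurable_fun setT q, forall x, 0 <= q x & nint q = 1%E] /\
  [/\ (nint (fun x => `|lmc_density s h p0 N x - q x|%R) <= (2 * tv)%:E)%E,
      nint (fun x => q x ^+ 2 / p x) = I%:E & I <= 1 + w ^+ 2].
Proof.
have mp : measurable_fun setT p by apply/borel_measurable; case: dp.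
have ip := density_nint dp.
have mF : measurable_fun setT F := C1_measurable_grad cp.
have L0 : 0 < L := lt_le_trans ltr01 L1.
have C0 : 0 < C := lt_le_trans ltr01 C1'.
have D1 : 1 <= d%:R :> R by rewrite ler1n.
have D0 : 0 < d%:R :> R := lt_le_trans ltr01 D1.
have Z0 : 0 < d%:R * L ^+ 2 * C by rewrite !mulr_gt0// exprn_gt0.
have w20 : 0 < w ^+ 2 by rewrite exprn_gt0.
have w21 : w ^+ 2 <= 1 by rewrite expr_le1// ltW.
have h0 : 0 < h by apply: lt_le_trans h_ge; rewrite mulr_gt0// divr_gt0.
have K0 : 0 < K by have := wK; lra.
have hle : h * (d%:R * L ^+ 2 * C) <= a2 * w ^+ 2.
  by move: h_le; rewrite mulrA ler_pdivlMr.
have sC0 : 0 < Num.sqrt C by rewrite sqrtr_gt0.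
have M0 : 0 < M by rewrite lt_max K0 orbT.
pose e := 500^-1 * w / Num.sqrt C.
have c500 : 0 < 500^-1 :> R by rewrite invr_gt0 ltr0n.
have c3240 : 0 < (40 * 81)^-1 :> R by rewrite invr_gt0 -natrM ltr0n.
have e0 : 0 < e := divr_gt0 (mulr_gt0 c500 w0) sC0.
have eE : 500^-1 * Num.sqrt (w ^+ 2) / Num.sqrt C = e by rewrite sqrtr_sqr gtr0_norm.
(* The largest admissible error replaces [eps], which may be 0 while [nint_cs_weight] needs a
   positive number. *)
pose eps' := a1 * 500^-1 / (40 * 81) * (tv * w ^+ 3 / (d%:R * L ^+ 2 * (C ^+ 2 * Num.sqrt C) * M)).
have Z'0 : 0 < d%:R * L ^+ 2 * (C ^+ 2 * Num.sqrt C) * M.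
  by rewrite mulr_gt0// mulr_gt0 ?mulr_gt0 ?exprn_gt0.
have eps'0 : 0 < eps'.
  exact: (mulr_gt0 (mulr_gt0 (mulr_gt0 a10 c500) c3240)
                   (divr_gt0 (mulr_gt0 tv0 (exprn_gt0 3 w0)) Z'0)).
have err' : (nint (fun x => (p x * sqn (F x - s x))%R) <= (eps' ^+ 2)%:E)%E.
  by apply: (le_trans err); rewrite lee_fin ler_sqr ?nnegrE// ltW.
have [b [i [P [[mb mi i01] [bi bF iP Ple]]]]] := score_truncation mp pp mF ms e0 err'.
pose k := kap h (5 * C).
pose t := (1 - 288 * (h * L)) * (1 - k).
have [us Dus hes] := step_small h0 L1 C1' D1 w20 w21 a20 a2_small hle.
have /andP[t_ge t1] := rate_bounds h0 L1 C1' D1 w20 w21 a20 a2_small hle.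
have Esmall := error_small h0 L1 C1' D1 w20 w21 a20 a2_small ca2_small hle.
rewrite eE in hes Esmall; rewrite -/k -/t in t_ge t1 Esmall.
have C50 : 0 < 5 * C by rewrite mulr_gt0.
have PI := lsi_poincare dp pp cp (ltW C0) lsi.
have /andP[k0 k1] := kap_bd h0 C50.
have contr := heat_contraction h0 mp pp ip C50 PI.
have desc := descent cp L0 LipF.
have lip := sqn_lip L0 LipF.
have step := one_step h0 mp pp ip mb mF L0 (sqr_ge0 e) desc lip bF k0 k1 contr D1 us Dus hes.
pose E := 29 * (h * e ^+ 2) + 5 * 16 ^+ 4 * (d%:R * (h * L) ^+ 2).
have step' (f : V -> R) (I : R) : measurable_fun setT f -> (forall x, 0 <= f x) ->
    nint f = 1%:E -> nint (fun x => f x ^+ 2 / p x) = I%:E ->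
    (nint (fun z => (drift_step h b f z ^+ 2 / p z)%R) <=
      ((1 - t + E) * I + t + (h * L) ^+ 2)%:E)%E.
  by move=> mf f0 if1 iI; exact: (step f 1 I mf f0 if1 (lexx _) iI).
have t0 : 0 < t by apply: lt_le_trans t_ge; rewrite divr_gt0// mulr_gt0.
have E0 : 0 <= E.
  exact: (addr_ge0 (mulr_ge0 (ler0n _ 29) (mulr_ge0 (ltW h0) (sqr_ge0 e)))
    (mulr_ge0 (mulr_ge0 (ler0n _ 5) (exprn_ge0 4 (ler0n _ 16)))
              (mulr_ge0 (ler0n _ d) (sqr_ge0 _)))).
have p20 x : 0 <= p0 x ^+ 2 / p x := divr_ge0 (sqr_ge0 _) (ltW (pp x)).
have [I0 iI0 /andP[_ I0le]] := nint_fin_le p20 chi0.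
(* The stationary level w^2/8 and the transient w^2/4 of [decay_bound] together stay below w^2. *)
have eta0 : 0 <= w ^+ 2 / 8 by rewrite divr_ge0// ltW.
have eta1 : w ^+ 2 / 8 <= 1 by rewrite ler_pdivrMr// mul1r (le_trans w21)// ler1n.
have chik := chi2_iter h0 pp mb mp0 p00 ip0 step' (ltW t0) t1 E0 (sqr_ge0 _) eta0 eta1
  (sqr_ge0 K) Esmall iI0 I0le.
have [mq q0 iq] := drift_iterP h0 N mb mp0 p00 ip0.
have [I iI Ile] := chik N.
exists (iter N (drift_step h b) p0), I; split; first by split.
have i0 x : 0 <= i x by case/andP: (i01 x).
pose tt (j : nat) := eps' / e * (2 + (1 - t / 4) ^+ j * K).
have ett : 0 < eps' / e by rewrite divr_gt0.
have htt j : (nint (fun x => (iter j (drift_step h b) p0 x * i x)%R) <= (tt j)%:E)%E.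
  have [mj j0 ij] := drift_iterP h0 j mb mp0 p00 ip0.
  have [Ij iIj Ijle] := chik j.
  have Tj0 : 0 < 2 + (1 - t / 4) ^+ j * K.
    by rewrite ltr_wpDr// mulr_ge0 ?(ltW K0)// exprn_ge0//; lra.
  apply: (nint_cs_weight mp pp mj j0 mi i01 iIj iP ett Tj0 Ple).
  exact: le_trans Ijle (sqr_bound j t0 t1 (ltW K0) eta1).
split; last 1 first.
- have := decay_bound h0 C1' w20 w21 wK t_ge t1 T_ge; lra.
- rewrite (lmc_density_iter h0 N ms mp0 p00 ip0).
  apply: (le_trans (nint_dist_iter h0 ms mb mi i0 bi mp0 p00 ip0 htt N)).
  rewrite lee_fin ler_pM2l// /tt -mulr_sumr.
  have rM : r <= M by rewrite le_max lexx.
  have KM : K <= M by rewrite le_max lexx orbT.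
  have bud := budget a10 h0 L1 C1' D1 w0 K0 tv0 t0 h_ge t_ge T_le rM KM.
  apply: le_trans bud; rewrite -/eps' -/e ler_pM2l//.
  exact: (sum_geometric_le N t0 t1 (ltW K0)).
- exact: iI.
Qed.
End Guarantee.

Section Comparison.
Context {R : realType} {d : nat}.
Local Notation V := 'rV[R]_d.

(** Cauchy-Schwarz with weight [p] applied to |q - p|, whose square over [p] integrates to I - 1. *)
Lemma nint_dist_le_chi2 (p q : V -> R) (I e : R) :
  measurable_fun setT p -> (forall x, 0 < p x) -> nint p = 1%E ->
  measurable_fun setT q -> (forall x, 0 <= q x) -> nint q = 1%E -> 0 <= e ->
  nint (fun x => q x ^+ 2 / p x) = I%:E -> I <= 1 + e ^+ 2 ->
  (nint (fun x => `|q x - p x|%R) <= e%:E)%E.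
Proof.
move=> mp p0 ip mq q0 iq e0 iI Ie.
have ple x : 0 <= p x by exact: ltW.
have mip : measurable_fun setT (fun x => (p x)^-1) by apply: measurable_inv.
pose f x := `|q x - p x|.
have mf : measurable_fun setT f.
  exact: (measurableT_comp (@normr_measurable R setT) (measurable_funB mq mp)).
have f0 x : 0 <= f x by exact: normr_ge0.
have [r ir /andP[r0 _]] : exists2 r, nint f = r%:E & 0 <= r <= 1 + 1.
  apply: (nint_fin_le f0); rewrite EFinD -{1}iq -ip -nintD//.
  apply: le_nint => // [|x]; first by meas.
  by rewrite (le_trans (ler_normB _ _))// !ger0_norm.
have g0 x : 0 <= f x ^+ 2 / p x := divr_ge0 (sqr_ge0 _) (ple x).
have mg : measurable_fun setT (fun x => f x ^+ 2 / p x) by meas.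
have iJ : (nint (fun x => (f x ^+ 2 / p x)%R) + 2%:E = I%:E + 1)%E.
  have h0 x : 0 <= q x ^+ 2 / p x := divr_ge0 (sqr_ge0 _) (ple x).
  have mh : measurable_fun setT (fun x => q x ^+ 2 / p x) by meas.
  have m2 : measurable_fun setT (fun x => 2 * q x) by meas.
  have q20 x : 0 <= 2 * q x by rewrite mulr_ge0.
  have -> : 2%:E = nint (fun x => 2 * q x) by rewrite nintZ// iq mule1.
  rewrite -(nintD mg m2 g0 q20) -iI -ip -(nintD mh mp h0 ple).
  apply: eq_nint => x; rewrite /f real_normK ?num_real//.
  by field; rewrite gt_eqF.
have := nint_cs mf mp f0 p0 ltr01 ip ir; rewrite divr1.
have -> : nint (fun x => f x ^+ 2 / p x) = (I - 1)%:E.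
  have c : (2%:E : \bar R) \is a fin_num by [].
  move/(congr1 (fun x => x - 2%:E)%E): iJ; rewrite (addeK _ c) => ->.
  change ((I + 1 - 2)%:E = (I - 1)%:E); congr EFin; ring.
rewrite lee_fin => rI; rewrite ir lee_fin -ler_sqr ?nnegrE//; lra.
Qed.

Lemma TV_nint (q1 q2 : V -> R) : measurable_fun setT q1 -> measurable_fun setT q2 ->
  TV q1 q2 = ((2%:R)^-1%:E * nint (fun x => `|q1 x - q2 x|%R))%E.
Proof.
move=> m1 m2; rewrite /TV lebint_nint//.
exact: (measurableT_comp (@normr_measurable R setT) (measurable_funB m1 m2)).
Qed.
End Comparison.

Theorem theorem1 (R : realType) :
  exists (c_eps a1 a2 b1 b2 : R),
    0 < c_eps /\ 0 < a1 /\ a1 <= a2 /\ 0 < b1 /\ b1 <= b2 /\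
  forall (d : nat) (p : 'rV[R]_d -> R) (L C_LS : R) (s : 'rV[R]_d -> 'rV[R]_d)
         (eps eps_TV eps_chi K_chi : R) (p0 : 'rV[R]_d -> R) (h : R) (N : nat),
    (0 < d)%N ->
    is_density p -> (forall x, 0 < p x) ->
    C1 (fun x => ln (p x)) ->
    1 <= L -> lipschitz_e L (grad (fun x => ln (p x))) ->
    1 <= C_LS -> LSI p C_LS ->
    borel_vfun s ->
    0 <= eps ->
    (lebint (fun x => (p x * enorm (grad (fun y => ln (p y)) x - s x) ^+ 2)%:E)
       <= (eps ^+ 2)%:E)%E ->
    0 < eps_TV < 1 -> 0 < eps_chi < 1 ->
    eps_chi ^+ 2 < 2 * K_chi ->
    is_density p0 -> (chi2 p0 p <= (K_chi ^+ 2)%:E)%E ->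
    eps <= c_eps * (eps_TV * eps_chi ^+ 3 /
             (d%:R * L ^+ 2 * (C_LS ^+ 2 * Num.sqrt C_LS) *
              Num.max (ln (2 * K_chi / eps_chi ^+ 2)) K_chi)) ->
    a1 * (eps_chi ^+ 2 / (d%:R * L ^+ 2 * C_LS)) <= h <=
      a2 * (eps_chi ^+ 2 / (d%:R * L ^+ 2 * C_LS)) ->
    b1 * (C_LS * ln (2 * K_chi / eps_chi ^+ 2)) <= N%:R * h <=
      b2 * (C_LS * ln (2 * K_chi / eps_chi ^+ 2)) ->
    (exists pbar : 'rV[R]_d -> R,
        is_density pbar /\
        (TV (lmc_density s h p0 N) pbar <= eps_TV%:E)%E /\
        (chi2 pbar p <= (eps_chi ^+ 2)%:E)%E) /\
    (eps_chi = eps_TV -> (TV (lmc_density s h p0 N) p <= (2 * eps_TV)%:E)%E).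
Proof.
have n60 n : 0 <= n%:R :> R := ler0n R n.
pose c16 : R := 16 ^+ 4.
have c16_ge1 : 1 <= c16 by rewrite /c16 exprn_ege1// ler1n.
have c16_0 : 0 < c16 := lt_le_trans ltr01 c16_ge1.
(* Chosen so that the smallness condition of [error_small] involving 16^4 holds with equality. *)
pose a2 : R := (60 * (60 * (10 * c16)))^-1.
have a20 : 0 < a2 by rewrite /a2 invr_gt0 !(mulr_gt0 (ltr0Sn _ _)).
have ca2 : 60 * (60 * (10 * (c16 * a2))) = 1 by rewrite /a2; field; rewrite gt_eqF.
have a2_small : 60 * (60 * (10 * a2)) <= 1.
  rewrite -[leRHS]ca2; do 3! apply: (ler_wpM2l (n60 _)).
  exact: (ler_peMl (ltW a20) c16_ge1).
have ca2_small : 60 * (60 * (10 * (16 ^+ 4 * a2))) <= 1 by rewrite -/c16 ca2.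
clearbody a2; pose a1 := a2 / 2.
have a10 : 0 < a1 by rewrite divr_gt0.
have a12 : a1 <= a2 by rewrite /a1 ler_pdivrMr// ler_peMr ?ler1n// ltW.
have c500 : 0 < 500^-1 :> R by rewrite invr_gt0 ltr0n.
have c3240 : 0 < (40 * 81)^-1 :> R by rewrite invr_gt0 -natrM ltr0n.
(* 648 comes from [decay_bound], its double 1296 leaves a range for the time [N * h], and 500 and 40
   * 81 come from the truncation threshold and [budget]. *)
exists (a1 * 500^-1 / (40 * 81)), a1, a2, 648, 1296.
split; first exact: (mulr_gt0 (mulr_gt0 a10 c500) c3240).
split; first exact: a10.
split; first exact: a12.
split; first by rewrite ltr0n.
split; first by rewrite ler_nat.
move=> d p L C s eps tv w K p0 h N d0 dp pp cp L1 LipF C1' lsi bs eps0 err.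
move=> /andP[tv0 _] /andP[w0 w1] wK dp0 chi0 eps_le /andP[h_ge h_le] /andP[T_ge T_le].
have mp : measurable_fun setT p by apply/borel_measurable; case: dp.
have mp0 : measurable_fun setT p0 by apply/borel_measurable; case: dp0.
have p00 : forall x, 0 <= p0 x by case: dp0 => _ [].
have ple x : 0 <= p x by exact: ltW.
have ip := density_nint dp; have ip0 := density_nint dp0.
have mip : measurable_fun setT (fun x => (p x)^-1) by apply: measurable_inv.
have mF := C1_measurable_grad cp.
have ms : measurable_fun setT s.
  by apply: measurable_rV => i; apply/borel_measurable; exact: bs.
have mchi (q : 'rV[R]_d -> R) : measurable_fun setT q -> measurable_fun setT (fun x => q x ^+ 2 / p x).
  by move=> mq; meas.
have chiE (q : 'rV[R]_d -> R) : measurable_fun setT q ->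
    chi2 q p = (nint (fun x => (q x ^+ 2 / p x)%R) - 1)%E.
  move=> mq; rewrite /chi2 lebint_nint//; first exact: mchi.
  by move=> x; exact: (divr_ge0 (sqr_ge0 _) (ple x)).
have err' : (nint (fun x => (p x * sqn (grad (fun y => ln (p y)) x - s x))%R) <=
    (eps ^+ 2)%:E)%E.
  apply: le_trans err; rewrite lebint_nint.
  - rewrite (@eq_nint _ _ (fun x => p x * sqn _) (fun x => p x * enorm (grad (fun y => ln (p y)) x - s x) ^+ 2))//.
    by move=> x; rewrite enorm_sqr.
  - rewrite (_ : (fun _ => _) = fun x => p x * sqn (grad (fun y => ln (p y)) x - s x)).
      by meas.
    by apply/funext => x; rewrite enorm_sqr.
  - by move=> x; exact: (mulr_ge0 (ple x) (sqr_ge0 _)).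
have chi0' : (nint (fun x => (p0 x ^+ 2 / p x)%R) <= (1 + K ^+ 2)%:E)%E.
  by move: chi0; rewrite chiE// leeBlDr// addeC -EFinD.
have [q [I [[mq q0 iq] [qd iI Ile]]]] := lmc_coupled d0 dp pp cp L1 LipF C1' lsi ms err' eps0 tv0
  w0 w1 wK mp0 p00 ip0 chi0' a10 a20 a2_small ca2_small eps_le h_ge h_le T_ge T_le.
have C0 : 0 < C := lt_le_trans ltr01 C1'.
have h0 : 0 < h.
  apply: lt_le_trans h_ge; rewrite mulr_gt0// divr_gt0 ?exprn_gt0//.
  by rewrite !mulr_gt0 ?exprn_gt0// ?ltr0n// (lt_le_trans ltr01).
have mlmc : measurable_fun setT (lmc_density s h p0 N).
  rewrite (lmc_density_iter h0 N ms mp0 p00 ip0).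
  by case: (drift_iterP h0 N ms mp0 p00 ip0).
have half0 : (0 <= (2%:R)^-1%:E :> \bar R)%E by rewrite lee_fin invr_ge0.
have TVq : (TV (lmc_density s h p0 N) q <= tv%:E)%E.
  rewrite TV_nint//; apply: (le_trans (lee_wpmul2l half0 qd)).
  by rewrite -EFinM lee_fin mulKf.
split.
  exists q; split; last split; [|exact: TVq|].
  - split; first exact/borel_measurable.
    by split=> //; rewrite lebint_nint.
  - by rewrite chiE// iI -EFinB lee_fin lerBlDl.
move=> wtv; rewrite TV_nint//.
have qp := nint_dist_le_chi2 mp pp ip mq q0 iq (ltW w0) iI Ile.
have mnorm (f g : 'rV[R]_d -> R) : measurable_fun setT f -> measurable_fun setT g ->
    measurable_fun setT (fun x => `|f x - g x|).
  by move=> mf mg; exact: (measurableT_comp (@normr_measurable R setT) (measurable_funB mf mg)).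
have tri : (nint (fun x => `|lmc_density s h p0 N x - p x|%R) <= (2 * tv + w)%:E)%E.
  rewrite EFinD; apply: le_trans (leeD qd qp).
  rewrite -nintD//; [|exact: mnorm|exact: mnorm].
  apply: le_nint => [|||x]; [exact: mnorm| |by move=> x|exact: ler_distD].
  exact: (measurable_funD (mnorm _ _ mlmc mq) (mnorm _ _ mq mp)).
(* For w = tv, half of [2 * tv + w] is 3/2 tv, within the claimed bound. *)
apply: (le_trans (lee_wpmul2l half0 tri)); rewrite -EFinM lee_fin wtv.
by rewrite -(ler_pM2l (ltr0Sn R 1)) mulVKf//; lra.
Qed.
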